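(* Let $D$ be a non-empty, bounded, open interval in $\mathbb{R}$. Let $X=(X_t)_{t\in[0,1]}$ be a zero-mean Gaussian process in $\mathbb{R}$ with càdlàg paths starting at the origin under the probability measure $\mathbb{P}=\mathbb{P}_0$ such that for each $t\in(0,1]$, $\sup_{s\in[0,t]}X_s<\infty$ $\mathbb{P}$-a.s. and $X_t$ is non-degenerate. Then for any $t\in(0,1]$ satisfying $\mu_t<|D|/2$, $$|D|-Q^X_D(t)=2\mu_t-\mathrm{Error}_Q(t),$$ where $$0<\mathrm{Error}_Q(t)\le\frac{4\sigma_t^2}{|D|-\mu_t}\,e^{-\frac12\left(\frac{|D|-\mu_t}{\sigma_t}\right)^2}+\frac{4\sigma_t^2}{\frac12|D|-\mu_t}\,e^{-\frac12\left(\frac{\frac12|D|-\mu_t}{\sigma_t}\right)^2}.$$ Consequently, $$\lim_{t\downarrow0}\frac{|D|-Q^X_D(t)}{\mu_t}=2.$$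
   Context: A real-valued process is a Gaussian process if all its finite-dimensional distributions are (multivariate) Gaussian. The process $X$ is the coordinate process on the space $\mathbb{D}[0,1]$ of real-valued càdlàg functions on $[0,1]$, equipped with the Borel $\sigma$-algebra of the Skorokhod $J_1$ topology (equivalently, the $\sigma$-algebra generated by coordinate projections), under a probability measure $\mathbb{P}=\mathbb{P}_0$ with $\mathbb{P}(X_0=0)=1$. Non-degenerate means $\mathbb{P}(X_t\ne0)>0$. Notation: $\mu_t=\mathbb{E}[\sup_{s\in[0,t]}X_s]$ and $\sigma_t^2=\sup_{s\in[0,t]}\mathbb{E}[X_s^2]$ with $\sigma_t=\sqrt{\sigma_t^2}$. For $x\in D$, $\mathbb{P}_x(F):=\mathbb{P}(F-x)$ with $F-x=\{\omega:\omega(\cdot)+x\in F\}$; that is, $X$ under $\mathbb{P}_x$ has the law of $x+X$ under $\mathbb{P}$. The first exit time is $\tau^X_D=\inf\{t>0:X_t\in D^c\}$, and the spectral heat content is $Q^X_D(t):=\int_D\mathbb{P}_x(\tau^X_D>t)\,dx$, $t\in(0,1]$. $|D|$ is the length of $D$. *)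

(* Defs.v *)
From HB Require Import structures.
From mathcomp Require Import all_boot all_order all_algebra.
From mathcomp Require Import all_classical all_reals all_analysis.

Set Implicit Arguments.
Unset Strict Implicit.
Unset Printing Implicit Defensive.

Import Order.TTheory GRing.Theory Num.Theory.
Import numFieldNormedType.Exports.

Local Open Scope classical_set_scope.
Local Open Scope ring_scope.

Definition unit_interval (R : realType) : set R := `[0, 1].
Arguments unit_interval : clear implicits.

Lemma unit_interval_0 (R : realType) : (0 : R) \in unit_interval R.
Proof. by apply/mem_set; rewrite /unit_interval /= in_itv /= lexx ler01. Qed.

Definition time0 (R : realType) : unit_interval R :=
  exist _ 0 (unit_interval_0 R).
Arguments time0 : clear implicits.

(* The left limit at 0 and the right limit at 1 are taken along the improper
   filter, so they impose nothing there. *)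
Definition cadlag (R : realType) (f : unit_interval R -> R) : Prop :=
  forall s : unit_interval R,
    (f @ within [set u | set_val s < set_val u] (nbhs s) --> f s) /\
    (exists l : R, f @ within [set u | set_val u < set_val s] (nbhs s) --> l).

Record skorokhod (R : realType) := Skorokhod {
  path_fun :> unit_interval R -> R ;
  path_cadlag : cadlag path_fun }.

Lemma cadlag_cst (R : realType) (c : R) :
  cadlag (fun _ : unit_interval R => c).
Proof. by move=> s; split; [|exists c]; exact: cvg_cst. Qed.

Lemma cadlag_translate (R : realType) (x : R) (w : skorokhod R) :
  cadlag (fun s : unit_interval R => w s + x).
Proof.
move=> s; have [ws [l wl]] := path_cadlag w s; split.
  by apply: cvgD; [exact: ws|exact: cvg_cst].
by exists (l + x); apply: cvgD; [exact: wl|exact: cvg_cst].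
Qed.

Definition translate (R : realType) (x : R) (w : skorokhod R) : skorokhod R :=
  Skorokhod (cadlag_translate x w).

HB.instance Definition _ (R : realType) := gen_eqMixin (skorokhod R).
HB.instance Definition _ (R : realType) := gen_choiceMixin (skorokhod R).
HB.instance Definition _ (R : realType) :=
  isPointed.Build (skorokhod R) (Skorokhod (@cadlag_cst R 0)).

Definition coordinate_sets (R : realType) : set (set (skorokhod R)) :=
  \bigcup_(s : unit_interval R)
    preimage_set_system setT (fun w : skorokhod R => w s) measurable.

HB.instance Definition _ (R : realType) :=
  Measurable.copy (skorokhod R) (g_sigma_algebraType (@coordinate_sets R)).

(* Point masses count as Gaussian; they are listed separately because
   [normal_prob m 0] is the uniform law on [0, 1] and not [\d_m]. *)
Definition gaussian_law (R : realType) (mu : set R -> \bar R) : Prop :=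
  (exists m : R, forall B : set R, measurable B -> mu B = \d_m B) \/
  (exists m s : R, 0 < s /\
     forall B : set R, measurable B -> mu B = normal_prob m s B).

(* A random vector is Gaussian when all its linear forms are; this is the
   definition that allows singular covariance matrices. *)
Definition gaussian_vector d (T : measurableType d) (R : realType)
    (P : probability T R) (n : nat) (Y : 'I_n -> T -> R) : Prop :=
  forall c : 'I_n -> R,
    gaussian_law (pushforward P (fun w => \sum_(i < n) c i * Y i w)).

(* The coordinate process under [P]. *)
Definition gaussian_process (R : realType)
    (P : probability (skorokhod R) R) : Prop :=
  forall (n : nat) (s : 'I_n -> unit_interval R),
    gaussian_vector P (fun i w => w (s i)).

Section functionals.
Context (R : realType).
Implicit Types (P : probability (skorokhod R) R) (t : R) (w : skorokhod R).

Definition running_sup t w : \bar R :=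
  ereal_sup [set (w s)%:E | s in [set s : unit_interval R | set_val s <= t]].

Definition mean_sup P t : \bar R := (\int[P]_w running_sup t w)%E.

Definition max_variance P t : \bar R :=
  ereal_sup [set ('E_P[fun w : skorokhod R => (w s ^+ 2)%R])%E
            | s in [set s : unit_interval R | set_val s <= t]].

Definition max_stddev P t : R := Num.sqrt (fine (max_variance P t)).

Definition exit_time (D : set R) w : \bar R :=
  ereal_inf [set (set_val s)%:E
            | s in [set s : unit_interval R | 0 < set_val s /\ (~` D) (w s)]].

(* [P] is completed because exit events of cadlag paths from open sets need not
   belong to the sigma-algebra generated by the coordinates, and [P] has no
   meaningful value outside of it. *)
Definition prob_from P (x : R) (F : set (skorokhod R)) : \bar R :=
  @completed_measure_extension _ _ _ P [set w | F (translate x w)].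

Definition heat_content P (D : set R) t : \bar R :=
  (\int[lebesgue_measure]_(x in D)
     prob_from P x [set w | t%:E < exit_time D w])%E.

End functionals.

(* Main.v *)
Require Import Defs.
From mathcomp Require Import all_boot all_order all_algebra.
From mathcomp Require Import all_classical all_reals all_analysis.
From mathcomp Require Import measurable_realfun ring lra.

Set Implicit Arguments.
Unset Strict Implicit.
Unset Printing Implicit Defensive.

Import Order.TTheory GRing.Theory Num.Theory.
Import numFieldNormedType.Exports.

Local Open Scope classical_set_scope.
Local Open Scope ring_scope.

(* Let S be the supremum over [0, t] of the path and J that of its opposite,
   both truncated below at 0, and let L = b - a. Right continuity shows that,
   up to boundary events, a path started at x stays in ]a, b[ up to time t iff
   S < b - x and J < x - a. Integrating over x by Fubini, the heat content is
   E (L - S - J)^+, and since E S = E J = mu (the law of the process is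
   symmetric) the error is E (S + J - L)^+ <= 2 E (S - L / 2)^+.
   The latter follows from E exp (l (S - mu)) <= exp (l^2 sigma^2 / 2) at
   l = (L / 2 - mu) / sigma^2.

   The exponential bound only uses that the law P of a centered Gaussian
   process is invariant under (w, w') |-> (w + w') / sqrt 2: iterating k times
   writes a path as a sum of 2^k independent copies scaled by 2^(- k / 2); each
   of them contributes its second order Taylor term, and the third order
   remainders add up to O(2^(- k / 2)). It is applied to log-sum-exp
   approximations of the maximum over finitely many times.

   For the limit, a Gaussian variable of standard deviation v exceeds v with a
   probability bounded below, so that sigma^2 <= C mu^2, the error is O(mu^2),
   and mu tends to 0 by right continuity at 0 and dominated convergence. *)

(** * Paths and laws on the path space *)

Section paths.
Context {R : realType}.
Implicit Types (x y w : skorokhod R) (s : unit_interval R).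

(** Laws are handled through linear forms of finitely many coordinates only: the integrals of their
    cosines determine a law on paths, so symmetry and stability under (w + w') / sqrt 2 reduce to
    the normal law on the line, and no covariance matrix or joint density appears. The exponent must
    contain the largest variance and not the second moment of the maximum; this is why the maximum
    is smoothed. To first order the increment of a log-sum-exp is a weighted mean of coordinate
    increments with weights of total at most 1, so its second moment at scale r is at most sigma^2
    r^2 + O(r^3), whereas the maximum itself would violate this near ties. The constant in O(r^3)
    depends on the smoothing, but it is gone before the smoothing is removed. Finiteness of mu,
    which the limit needs, is derived from the almost sure finiteness of the supremum. Exit events
    are only enclosed between measurable ones, so the heat content is squeezed between two integrals
    with the same value. *)

Lemma cadlag_comb (a b : R) x y :
  cadlag (fun s : unit_interval R => a * x s + b * y s).
Proof.
move=> s; have [xs [l xl]] := path_cadlag x s.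
have [ys [k yk]] := path_cadlag y s; split.
  by apply: cvgD; apply: cvgM => //; exact: cvg_cst.
by exists (a * l + b * k); apply: cvgD; apply: cvgM => //; exact: cvg_cst.
Qed.

(** Weights (1, r) add scaled noise to a path, (q, q) with q = 1 / sqrt 2 merge two independent
    copies, and (-1, 0) give the opposite path. *)
Definition comb (a b : R) x y : skorokhod R := Skorokhod (cadlag_comb a b x y).

Lemma measurable_coord s : measurable_fun setT (fun w : skorokhod R => w s).
Proof.
move=> _ B mB; apply: sub_sigma_algebra.
by exists s => //; exists B.
Qed.

Lemma measurable_path d (T : measurableType d) (F : T -> skorokhod R) :
  (forall s, measurable_fun setT (fun t => F t s)) -> measurable_fun setT F.
Proof.
move=> mF; apply: (@measurability _ _ _ _ setT F (@coordinate_sets R)) => //.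
move=> _ [_ [s _ [B mB <-]] <-].
have := mF s measurableT B mB.
by rewrite !setTI.
Qed.

Lemma measurable_comb d (T : measurableType d) (a b : R)
    (F G : T -> skorokhod R) : measurable_fun setT F -> measurable_fun setT G ->
  measurable_fun setT (fun t => comb a b (F t) (G t)).
Proof.
move=> mF mG; apply: measurable_path => s /=.
by apply: measurable_funD; apply: measurable_funM => //;
   exact: (measurableT_comp (measurable_coord s)).
Qed.

(** Forms are lists of terms so that a sum of forms is a concatenation, as the product-to-sum
    formula requires. *)
Definition linform (l : seq (R * unit_interval R)) (w : skorokhod R) : R :=
  \sum_(p <- l) p.1 * w p.2.

Lemma measurable_linform l : measurable_fun setT (linform l).
Proof.
apply: measurable_sum => p; apply: measurable_funM => //.
exact: measurable_coord.
Qed.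

Lemma linform_comb l a b x y :
  linform l (comb a b x y) = a * linform l x + b * linform l y.
Proof.
rewrite /linform !mulr_sumr -big_split/=; apply: eq_bigr => p _; ring.
Qed.

Lemma linform_cat l k w : linform (l ++ k) w = linform l w + linform k w.
Proof. exact: big_cat. Qed.

Definition lneg (l : seq (R * unit_interval R)) := [seq (- p.1, p.2) | p <- l].

Lemma linform_neg l w : linform (lneg l) w = - linform l w.
Proof.
by rewrite /linform big_map -sumrN; apply: eq_bigr => p _; rewrite mulNr.
Qed.

Lemma linform1 c s w : linform [:: (c, s)] w = c * w s.
Proof. by rewrite /linform big_seq1. Qed.

End paths.

(** * Polynomial approximation of the sign *)

Section smoothstep.
Context {R : realType}.

(* Iterating this odd polynomial on [-1, 1] converges to the sign function. *)
Definition smoothstep (u : R) : R := (3 * u - u ^+ 3) / 2.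

(** Writing p for [smoothstep], 2 (1 - p v) = (1 - v)^2 (2 + v) and 2 (1 + p v) = (1 + v)^2 (2 -
    v). *)
Lemma smoothstep_iter_le1 (u : R) n : `|u| <= 1 -> `|iter n smoothstep u| <= 1.
Proof.
move=> u1; elim: n => [//|n]; rewrite iterS; move: (iter n _ _) => v.
rewrite !ler_norml => /andP[v1 v2]; rewrite /smoothstep.
have := mulr_ge0 (sqr_ge0 (1 - v)) (_ : 0 <= 2 + v).
have := mulr_ge0 (sqr_ge0 (1 + v)) (_ : 0 <= 2 - v).
have p1 : 0 <= 2 - v by lra.
have p2 : 0 <= 2 + v by lra.
move=> /(_ p1) h1 /(_ p2) h2; apply/andP; split; nra.
Qed.

Lemma smoothstepN (u : R) : smoothstep (- u) = - smoothstep u.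
Proof. by rewrite /smoothstep; field. Qed.

(** For 0 < u <= 1 the iterates v stay above u, and 1 - p v = (1 - v) (1 - (v + v^2) / 2) shrinks
    the distance to 1 by at least the factor 1 - u / 2 at each step. Oddness and the fixed point 0
    give the other cases. *)
Lemma cvg_smoothstep (u : R) : `|u| <= 1 ->
  iter n smoothstep u @[n --> \oo] --> Num.sg u.
Proof.
wlog u0 : u / 0 <= u => [hw|].
  have [/hw//|/ltW u0 u1] := leP 0 u.
  have -> : Num.sg u = - Num.sg (- u) by rewrite sgrN opprK.
  have := hw (- u); rewrite oppr_ge0 normrN => /(_ u0 u1) /cvgN.
  apply: cvg_trans; apply: near_eq_cvg; apply: nearW => n /=.
  by rewrite !fctE; elim: n => [|n IHn]; rewrite ?opprK// !iterS -smoothstepN IHn.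
rewrite le_eqVlt in u0; case/predU1P : u0 => [<- _|u0 u1].
  rewrite sgr0; apply: cvg_trans (@cvg_cst _ (0 : R) nat \oo _).
  apply: near_eq_cvg; apply: nearW => n.
  by elim: n => [//|n IHn]; rewrite iterS -IHn /smoothstep; field.
rewrite gtr0_sg//.
have b n : [/\ u <= iter n smoothstep u, iter n smoothstep u <= 1 &
    1 - iter n smoothstep u <= (1 - u / 2) ^+ n].
  have {}u1 : u <= 1 by rewrite (le_trans (ler_norm _)).
  elim: n => [|n [h1 h2 h3]]; first by rewrite /= expr0; split; lra.
  rewrite iterS; move: (iter n _ _) h1 h2 h3 => v h1 h2 h3.
  have q : 1 - smoothstep v = (1 - v) * (1 - (v + v ^+ 2) / 2).
    by rewrite /smoothstep; field.
  have c : (1 - v) * (1 - (v + v ^+ 2) / 2) <= (1 - v) * (1 - u / 2).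
    by apply: ler_wpM2l; nra.
  have d : 0 <= (1 - v) * (1 - (v + v ^+ 2) / 2) by apply: mulr_ge0; nra.
  split.
  - have : 1 - smoothstep v <= 1 - v by rewrite q ler_piMr//; nra.
    lra.
  - lra.
  - rewrite q (le_trans c)// exprSr ler_wpM2r//; lra.
have g : (1 - u / 2) ^+ n @[n --> \oo] --> 0.
  have {}u1 := le_trans (ler_norm u) u1.
  by apply: cvg_expr; rewrite ltr_norml; apply/andP; split; lra.
apply: (@squeeze_cvgr _ _ _ _ (fun n => 1 - (1 - u / 2) ^+ n) (fun=> 1)).
- by apply: nearW => n; have [_ ? ?] := b n; apply/andP; split => //; lra.
- by rewrite -[X in _ --> X]subr0; apply: cvgB => //; exact: cvg_cst.
- exact: cvg_cst.
Qed.

End smoothstep.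

Lemma cvgn_norm_le {R : realType} (u : nat -> R) (l M : R) :
  (forall n, `|u n| <= M) -> u n @[n --> \oo] --> l -> `|l| <= M.
Proof.
move=> uM /cvg_norm ul; rewrite -(cvg_lim _ ul)//; apply: limr_le.
  by apply/cvg_ex; exists `|l|.
exact: nearW.
Qed.

Section bounded_measurable.
Context d (T : measurableType d) {R : realType}.
Implicit Types f g : T -> R.

Definition bmeas f := measurable_fun setT f /\ exists M : R, forall x, `|f x| <= M.

Lemma bmeas_cst c : bmeas (fun=> c).
Proof. by split; [exact: measurable_cst|exists `|c|]. Qed.

Lemma bmeasM f g : bmeas f -> bmeas g -> bmeas (fun x => f x * g x).
Proof.
move=> [mf [M fM]] [mg [N gN]]; split; first exact: measurable_funM.
by exists (M * N) => x; rewrite normrM ler_pM.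
Qed.

Lemma bmeasD f g : bmeas f -> bmeas g -> bmeas (fun x => f x + g x).
Proof.
move=> [mf [M fM]] [mg [N gN]]; split; first exact: measurable_funD.
by exists (M + N) => x; rewrite (le_trans (ler_normD _ _))// lerD.
Qed.

Lemma bmeas_integrable (m : {measure set T -> \bar R}) f :
  (m setT < +oo)%E -> bmeas f -> m.-integrable setT (EFin \o f).
Proof.
move=> moo [mf [M fM]]; apply: measurable_bounded_integrable => //.
by exists M; split; [exact: num_real|move=> N MN x _; exact: le_trans (fM x) (ltW MN)].
Qed.

End bounded_measurable.

Lemma probability_setTy d (T : measurableType d) (R : realType)
  (P : probability T R) : (P setT < +oo)%E.
Proof. by rewrite probability_setT ltry. Qed.

Lemma integral_probability_cst d (T : measurableType d) (R : realType)
  (P : probability T R) (c : R) : (\int[P]_w c%:E = c%:E)%E.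
Proof.
rewrite (integral_cst P measurableT c%:E) -[RHS]mule1; congr (_ * _)%E.
exact: probability_setT.
Qed.

(** * Uniqueness of a law on paths given its cosine integrals *)

Section cramer_wold.
Context {R : realType}.
Local Notation T := (skorokhod R).
Variables m1 m2 : {measure set T -> \bar R}.
Hypothesis m1oo : (m1 setT < +oo)%E.
Hypothesis m2oo : (m2 setT < +oo)%E.
Implicit Types (f g : T -> R) (l : seq (R * unit_interval R)) (x : R).

Definition trig l x (w : T) : R := cos (linform l w + x).

Lemma bmeas_trig l x : bmeas (trig l x).
Proof.
split; last by exists 1 => w; exact: cos_max.
apply: (@measurableT_comp _ _ _ _ _ _ (@cos R)).
  by apply: continuous_measurable_fun; exact: continuous_cos.
by apply: measurable_funD => //; exact: measurable_linform.
Qed.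

(* Multipliers form an algebra closed under bounded limits. It contains
   cosines of linear forms by the product-to-sum formula, hence signs of sines
   by [smoothstep], hence indicators of the half-spaces generating the
   sigma-algebra. This replaces Fourier inversion. *)
Definition same f := (\int[m1]_w (f w)%:E = \int[m2]_w (f w)%:E)%E.

(** The signed measure f (m1 - m2) has zero Fourier transform; the free phase x covers sines as well
    as cosines. *)
Definition balanced f :=
  bmeas f /\ forall l x, same (fun w => f w * trig l x w).

Definition multiplier f :=
  bmeas f /\ forall g, balanced g -> balanced (fun w => f w * g w).

Lemma same_lin f g (a b : R) : bmeas f -> bmeas g -> same f -> same g ->
  same (fun w => a * f w + b * g w).
Proof.
move=> bf bg fs gs; rewrite /same.
have I (m : {measure set T -> \bar R}) : (m setT < +oo)%E ->
    (\int[m]_w (a * f w + b * g w)%:E =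
     a%:E * \int[m]_w (f w)%:E + b%:E * \int[m]_w (g w)%:E)%E.
  move=> moo; have If := bmeas_integrable moo bf.
  have Ig := bmeas_integrable moo bg.
  under eq_integral do rewrite EFinD !EFinM.
  rewrite integralD//=; [|exact: integrableZl..].
  by rewrite !integralZl.
by rewrite !I// fs gs.
Qed.

Lemma same_lim (h : nat -> T -> R) f (M : R) :
  (forall n, measurable_fun setT (h n)) -> measurable_fun setT f ->
  (forall n w, `|h n w| <= M) -> (forall w, h n w @[n --> \oo] --> f w) ->
  (forall n, same (h n)) -> same f.
Proof.
move=> mh mf hM hf sh.
have I (m : {measure set T -> \bar R}) : (m setT < +oo)%E ->
    (\int[m]_w (h n w)%:E @[n --> \oo] --> \int[m]_w (f w)%:E)%E.
  move=> moo.
  have H1 n : measurable_fun setT (fun w => (h n w)%:E).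
    exact/measurable_EFinP.
  have H2 : measurable_fun setT (EFin \o f) by exact/measurable_EFinP.
  have H3 : {ae m, forall w, setT w -> (h n w)%:E @[n --> \oo] --> (EFin \o f) w}.
    by apply: aeW => w _; apply: cvg_EFin; [exact: nearW|exact: hf].
  have H4 : m.-integrable setT (cst M%:E).
    exact: (@bmeas_integrable _ T R m (cst M) moo (bmeas_cst T M)).
  have H5 : {ae m, forall w n, setT w -> (`|(h n w)%:E| <= cst M%:E w)%E}.
    by apply: aeW => w n _; rewrite lee_fin.
  by have [] := dominated_convergence measurableT H1 H2 H3 H4 H5.
have := I _ m1oo; rewrite (_ : (fun n => _) = (fun n => \int[m2]_w (h n w)%:E)%E).
  by move=> h1; exact: (cvg_unique _ h1 (I _ m2oo)).
by apply/funext => n; exact: sh.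
Qed.

Lemma balanced_lin f g (a b : R) : balanced f -> balanced g ->
  balanced (fun w => a * f w + b * g w).
Proof.
move=> [bf sf] [bg sg]; split.
  by apply: bmeasD; apply: bmeasM => //; exact: bmeas_cst.
move=> l x; have -> : (fun w => (a * f w + b * g w) * trig l x w) =
    (fun w => a * (f w * trig l x w) + b * (g w * trig l x w)).
  by apply/funext => w; ring.
by apply: same_lin => //; apply: bmeasM => //; exact: bmeas_trig.
Qed.

Lemma balanced_lim (h : nat -> T -> R) f (M : R) :
  (forall n w, `|h n w| <= M) -> (forall w, h n w @[n --> \oo] --> f w) ->
  (forall n, balanced (h n)) -> balanced f.
Proof.
move=> hM hf bh.
have mf : measurable_fun setT f.
  by apply: (@measurable_fun_cvg _ _ _ _ h) => // n; have [[]] := bh n.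
split.
  by split => //; exists M => w; apply: cvgn_norm_le (hf w).
move=> l x; have [mt _] := bmeas_trig l x.
apply: (@same_lim (fun n w => h n w * trig l x w) _ M).
- by move=> n; apply: measurable_funM => //; have [[]] := bh n.
- exact: measurable_funM.
- by move=> n w; rewrite normrM (le_trans _ (hM n w))// ler_piMr// cos_max.
- by move=> w; apply: cvgM; [exact: hf|exact: cvg_cst].
- by move=> n; have [_] := bh n.
Qed.

Lemma multiplier_trig l x : multiplier (trig l x).
Proof.
split; first exact: bmeas_trig.
move=> g [bg sg]; split; first by apply: bmeasM => //; exact: bmeas_trig.
move=> k y; have -> : (fun w => trig l x w * g w * trig k y w) =
    (fun w => 2^-1 * (g w * trig (l ++ k) (x + y) w) +
              2^-1 * (g w * trig (l ++ lneg k) (x - y) w)).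
  apply/funext => w; rewrite /trig !linform_cat linform_neg.
  rewrite (_ : linform l w + linform k w + (x + y) =
    (linform l w + x) + (linform k w + y)); last by ring.
  rewrite (_ : linform l w - linform k w + (x - y) =
    (linform l w + x) - (linform k w + y)); last by ring.
  move: (linform l w + x) (linform k w + y) => a b.
  by rewrite cosD cosB; field.
by apply: same_lin => //; apply: bmeasM => //; exact: bmeas_trig.
Qed.

Lemma multiplierM f g : multiplier f -> multiplier g ->
  multiplier (fun w => f w * g w).
Proof.
move=> [bf Mf] [bg Mg]; split; first exact: bmeasM.
move=> h bh; have := Mf _ (Mg _ bh).
by under eq_fun do rewrite mulrA.
Qed.

Lemma multiplier_cst x : multiplier (fun=> x).
Proof.
split; first exact: bmeas_cst.
move=> g bg; have := balanced_lin x 0 bg bg.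
by under eq_fun do rewrite mul0r addr0.
Qed.

Lemma multiplier_lin f g (a b : R) : multiplier f -> multiplier g ->
  multiplier (fun w => a * f w + b * g w).
Proof.
move=> [bf Mf] [bg Mg]; split.
  by apply: bmeasD; apply: bmeasM => //; exact: bmeas_cst.
move=> h bh; have := balanced_lin a b (Mf _ bh) (Mg _ bh).
by under eq_fun do rewrite !mulrA -mulrDl.
Qed.

Lemma multiplier_lim (h : nat -> T -> R) f (M : R) :
  (forall n w, `|h n w| <= M) -> (forall w, h n w @[n --> \oo] --> f w) ->
  (forall n, multiplier (h n)) -> multiplier f.
Proof.
move=> hM hf bh; split.
  split; last by exists M => w; apply: cvgn_norm_le (hf w).
  by apply: (@measurable_fun_cvg _ _ _ _ h) => // n; have [[]] := bh n.
move=> g bg; have [[_ [N gN]] _] := bg.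
apply: (@balanced_lim (fun n w => h n w * g w) _ (M * N)).
- by move=> n w; rewrite normrM ler_pM.
- by move=> w; apply: cvgM; [exact: hf|exact: cvg_cst].
- by move=> n; have [_] := bh n; exact.
Qed.

Lemma multiplier_sg f : (forall w, `|f w| <= 1) -> multiplier f ->
  multiplier (fun w => Num.sg (f w)).
Proof.
move=> f1 mf; apply: (@multiplier_lim (fun n w => iter n smoothstep (f w)) _ 1).
- by move=> n w; exact: smoothstep_iter_le1.
- by move=> w; exact: cvg_smoothstep.
- elim=> [//|n IHn].
  have := multiplier_lin (3 / 2) (- 2^-1) IHn (multiplierM IHn (multiplierM IHn IHn)).
  by congr multiplier; apply/funext => w /=; rewrite /smoothstep; field.
Qed.

(** The sign of sin (u / (n + 1)) equals the sign of u as soon as |u| / (n + 1) < pi, so slow sines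
    separate half-lines in the limit. *)
Lemma multiplier_sg_coord s x : multiplier (fun w : T => Num.sg (x - w s)).
Proof.
apply: (@multiplier_lim (fun n w => Num.sg (sin ((x - w s) / n.+1%:R))) _ 1).
- by move=> n w; rewrite normr_sg; case: (_ == _).
- move=> w; apply: (@cvg_trans _ (cst (Num.sg (x - w s)) @ \oo)); last exact: cvg_cst.
  apply: near_eq_cvg; near=> n => /=.
  have n0 : (0 : R) < n.+1%:R by [].
  have nb : `|x - w s| / n.+1%:R < pi.
    rewrite ltr_pdivrMr// mulrC -ltr_pdivrMr ?pi_gt0//.
    apply: (@lt_trans _ _ n%:R); last by rewrite ltr_nat.
    by near: n; exact: nbhs_infty_gtr.
  have [u0|u0|->] := ltgtP (x - w s) 0; last by rewrite mul0r sin0 sgr0.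
  - rewrite ltr0_norm// in nb; rewrite [LHS]ltr0_sg// [RHS]ltr0_sg//.
    rewrite -oppr_gt0 -sinN sin_gt0_pi// -mulNr nb andbT.
    by rewrite divr_gt0// oppr_gt0.
  - rewrite gtr0_norm// in nb; rewrite [LHS]gtr0_sg// [RHS]gtr0_sg//.
    by rewrite sin_gt0_pi// nb andbT divr_gt0.
- move=> n; apply: multiplier_sg; first by move=> w; exact: sin_max.
  (* A phase of - pi / 2 turns the cosine into the sine. *)
  have := multiplier_trig [:: (- n.+1%:R^-1, s)] (x / n.+1%:R - pi / 2).
  congr multiplier; apply/funext => w.
  rewrite /trig linform1 addrA cosB cos_pihalf sin_pihalf mulr0 add0r mulr1.
  by congr sin; ring.
Unshelve. all: by end_near. Qed.

Lemma multiplier_lt s x : multiplier (\1_[set w : T | w s < x]).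
Proof.
have -> : \1_[set w : T | w s < x] = (fun w : T => 2^-1 * 1 + 2^-1 *
    (if w s < x then 1 else -1)) :> (T -> R).
  apply/funext => w; rewrite indicE; case: ifPn => h.
    by rewrite mem_set//= mulr1n; field.
  by rewrite memNset//= ?mulr0n; [field|exact/negP].
apply: multiplier_lin; first exact: multiplier_cst.
(* The sign vanishes at equality; thresholds strictly below x make the limit -1 there, as a strict
   inequality demands. *)
apply: (@multiplier_lim (fun n w => Num.sg (x - n.+1%:R^-1 - w s)) _ 1).
- by move=> n w; rewrite normr_sg; case: (_ == _).
- move=> w; case: ifPn => h.
    rewrite -subr_gt0 in h.
    apply: (@cvg_trans _ (cst 1 @ \oo)); last exact: cvg_cst.
    apply: near_eq_cvg; near=> n => /=.
    rewrite gtr0_sg// subr_gt0 ltrBrDl -ltrBrDr.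
    by near: n; exact: near_infty_natSinv_lt (PosNum h).
  apply: (@cvg_trans _ (cst (-1) @ \oo)); last exact: cvg_cst.
  apply: near_eq_cvg; apply: nearW => n /=; rewrite -leNgt in h.
  by rewrite ltr0_sg// subr_lt0 (lt_le_trans _ h)// ltrBlDr ltrDl.
- by move=> n; exact: multiplier_sg_coord.
Unshelve. all: by end_near. Qed.

(** Products of multipliers are multipliers, so 1_A + 1_B - 1_A 1_B handles unions that are not
    disjoint; the class is a full sigma-algebra and can be tested on generators. *)
Lemma sigma_algebra_multiplier :
  sigma_algebra setT [set A : set T | multiplier (\1_A)].
Proof.
split => /=.
- by rewrite indic0; exact: multiplier_cst.
- move=> A mA; have := multiplier_lin 1 (-1) (multiplier_cst 1) mA.
  congr multiplier; apply/funext => w; rewrite setTD !indicE in_setC.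
  by case: (_ \in _) => /=; ring.
- move=> F mF.
  have mU n : multiplier (\1_(\bigcup_(i < n) F i)).
    elim: n => [|n IHn]; first by rewrite bigcup_mkord big_ord0 indic0; exact: multiplier_cst.
    have := multiplier_lin 1 1 IHn (multiplier_lin 1 (-1) (mF n) (multiplierM IHn (mF n))).
    congr multiplier; apply/funext => w.
    rewrite !bigcup_mkord big_ord_recr/= !indicE in_setU.
    by case: (_ \in _); case: (_ \in _) => /=; ring.
  apply: (@multiplier_lim (fun n => \1_(\bigcup_(i < n) F i)) _ 1) => //.
    by move=> n w; rewrite indicE; case: (_ \in _); rewrite ?normr1 ?normr0.
  move=> w; have [[k _ Fkw]|nF] := pselect ((\bigcup_k F k) w).
    apply: (@cvg_trans _ (cst 1 @ \oo)); last first.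
      by rewrite indicE mem_set; [exact: cvg_cst|exists k].
    apply: near_eq_cvg; exists k.+1 => // n /= kn.
    by rewrite indicE mem_set//; exists k.
  apply: (@cvg_trans _ (cst 0 @ \oo)); last first.
    by rewrite indicE memNset//; exact: cvg_cst.
  apply: near_eq_cvg; apply: nearW => n.
  by rewrite indicE memNset// => -[k _ Fk]; apply: nF; exists k.
Qed.

(** The assumption says that the constant 1 is balanced, hence so is every measurable indicator; the
    empty form with phase 0 then reads off the two measures. *)
Lemma cramer_wold :
  (forall l x, same (trig l x)) -> forall A, measurable A -> m1 A = m2 A.
Proof.
move=> st A mA.
have b1 : balanced (fun=> 1).
  by split => [|l x]; [exact: bmeas_cst|under eq_fun do rewrite mul1r].
have mu : [set B : set T | multiplier (\1_B)] A.
  apply: (smallest_sub sigma_algebra_multiplier _ mA) => _ [s _ [B mB <-]] /=.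
  have {}mB : (@RGenInftyO.G R).-sigma.-measurable B.
    by rewrite -RGenInftyO.measurableE.
  apply: (smallest_sub (sigma_algebra_image (fun w : T => w s)
    sigma_algebra_multiplier) _ mB) => _ [x ->].
  have e : [set w : T | w s < x] = (fun w : T => w s) @^-1` `]-oo, x[%classic.
    by apply/seteqP; split => w /=; rewrite in_itv.
  by rewrite /image_set_system /= setTI -e; exact: multiplier_lt.
have [_ /(_ [::] 0)] := mu.2 _ b1.
rewrite /same; under eq_integral do rewrite /trig /linform big_nil add0r cos0 !mulr1.
by under [RHS]eq_integral do rewrite /trig /linform big_nil add0r cos0 !mulr1; rewrite !integral_indic// !setIT.
Qed.

End cramer_wold.

(** * Centered Gaussian laws *)

Lemma nd_cvg_integral d (T : measurableType d) (R : realType)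
    (mu : {measure set T -> \bar R}) (h : nat -> T -> \bar R) (f : T -> \bar R) :
  (forall n, measurable_fun setT (h n)) -> (forall n x, 0 <= h n x)%E ->
  (forall x, {homo (fun n => h n x) : m n / (m <= n)%N >-> (m <= n)%E}) ->
  (forall x, h n x @[n --> \oo] --> f x) ->
  (\int[mu]_x h n x @[n --> \oo] --> \int[mu]_x f x)%E.
Proof.
move=> mh h0 nd hf.
rewrite (@eq_integral _ _ _ mu setT (fun x => limn (h ^~ x))).
  by apply: cvg_monotone_convergence => // x _; exact: nd.
by move=> x _; apply/esym/cvg_lim => //; exact: hf.
Qed.

(** * Integration against a density *)

Section density.
Context d (T : measurableType d) {R : realType}.
Variables (mu nu : {measure set T -> \bar R}) (g : T -> R).
Hypothesis mg : measurable_fun setT g.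
Hypothesis g0 : forall x, 0 <= g x.
Hypothesis nug : forall A, measurable A -> nu A = (\int[mu]_(x in A) (g x)%:E)%E.
Local Open Scope ereal_scope.

Import HBNNSimple.

Lemma nnsfun_integral_density (h : {nnsfun T >-> R}) :
  \int[nu]_x (h x)%:E = \int[mu]_x (h x * g x)%:E.
Proof.
have hE x : ((h x * g x)%R)%:E = \sum_(y \in range h)
    (y%:E * ((\1_(h @^-1` [set y]) x)%:E * (g x)%:E)).
  rewrite fimfunE EFinM -fsumEFin// ge0_mule_fsuml.
    by apply: eq_fsbigr => y _; rewrite EFinM muleA.
  by move=> y; exact: nnfun_muleindic_ge0.
under [RHS]eq_integral do rewrite hE.
rewrite integralT_nnsfun sintegralE ge0_integral_fsum//; last 2 first.
- move=> y; apply: measurable_funeM; apply: emeasurable_funM.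
    by apply/measurable_EFinP; exact: measurable_indic.
  exact/measurable_EFinP.
- move=> y x _; rewrite muleA mule_ge0 ?lee_fin//.
  exact: nnfun_muleindic_ge0.
apply: eq_fsbigr => y /[!inE] -[x _ <-].
rewrite ge0_integralZl//; last 3 first.
- apply: emeasurable_funM; last exact/measurable_EFinP.
  by apply/measurable_EFinP; exact: measurable_indic.
- by move=> z _; rewrite mule_ge0 ?lee_fin// indicE.
- by rewrite lee_fin.
rewrite nug// integral_mkcond; congr (_ * _); apply: eq_integral => z _.
by rewrite epatch_indic muleC.
Qed.

Lemma ge0_integral_density (f : T -> \bar R) :
  measurable_fun setT f -> (forall x, 0 <= f x) ->
  \int[nu]_x f x = \int[mu]_x (f x * (g x)%:E).
Proof.
move=> mf f0; pose h := nnsfun_approx measurableT mf.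
have hf x : (h n x)%:E @[n --> \oo] --> f x by exact: cvg_nnsfun_approx.
have nd x : {homo (fun n => (h n x)%:E) : m n / (m <= n)%N >-> m <= n}.
  by move=> m n mn; rewrite lee_fin; exact/lefP/nd_nnsfun_approx.
have e1 : \int[nu]_x (h n x)%:E @[n --> \oo] --> \int[nu]_x f x.
  apply: nd_cvg_integral => // [n|n x]; first exact/measurable_EFinP.
  by rewrite lee_fin.
have e2 : \int[mu]_x (h n x * g x)%:E @[n --> \oo] -->
    \int[mu]_x (f x * (g x)%:E).
  apply: nd_cvg_integral => [n|n x|x m n mn|x].
  - by apply/measurable_EFinP; exact: measurable_funM.
  - by rewrite lee_fin mulr_ge0.
  - by rewrite lee_fin ler_wpM2r// -lee_fin; exact: nd.
  - rewrite (_ : (fun n => _) = (fun n => (h n x)%:E * (g x)%:E)).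
      by apply: cvgeZr => //; exact: hf.
    by apply/funext => n; rewrite EFinM.
move: e1; rewrite (_ : (fun n => _) = (fun n => \int[mu]_x (h n x * g x)%:E)).
  by move=> e1; exact: (cvg_unique _ e1 e2).
by apply/funext => n; exact: nnsfun_integral_density.
Qed.

End density.

Section affine_substitution.
Context {R : realType}.
Notation mu := (@lebesgue_measure R).

Lemma ge0_integral_affine (c e : R) (G : R -> R) : 0 < c -> continuous G ->
  (forall x, 0 <= G x) ->
  (\int[mu]_x (G x)%:E = \int[mu]_x (c * G (c * x + e))%:E)%E.
Proof.
move=> c0 cG G0; pose F (x : R^o) := c * x + e : R^o.
have dF (x : R) : is_derive (x : R^o) 1 F c.
  rewrite /F; apply: is_derive_eq.
  by rewrite addr0 /GRing.scale/= mulr1.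
have F'E : F^`()%classic = cst c.
  by apply/funext => x; rewrite derive1E; exact: derive_val.
rewrite (@increasing_ge0_integration_by_substitutionT _ F G)//.
- by apply: eq_integral => x _; rewrite F'E/= fctE/= mulrC.
- by move=> x y xy; rewrite /F ltrD2r ltr_pM2l.
- by rewrite F'E => ?; exact: cvg_cst.
- by rewrite F'E; exact: is_cvg_cst.
- by rewrite F'E; exact: is_cvg_cst.
- rewrite /F; apply: (@cvg_comp _ _ _ (fun x : R => c * x) (fun x => x + e)).
    exact: (gt0_cvgMrNy c0 cvg_id).
  exact: cvg_addrr_Ny.
- rewrite /F; apply: (@cvg_comp _ _ _ (fun x : R => c * x) (fun x => x + e)).
    exact: (gt0_cvgMry c0 cvg_id).
  exact: cvg_addrr.
Qed.

Lemma ge0_integral_opp (f : R -> \bar R) : measurable_fun setT f ->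
  (forall x, 0 <= f x)%E -> (\int[mu]_x f x = \int[mu]_x f (- x)%R)%E.
Proof.
move=> mf f0; transitivity (\int[pushforward mu (-%R : _ -> measurableTypeR R)]_x f x)%E.
  by apply: eq_measure_integral => //= A mA _; exact/esym/lebesgue_measureN.
by rewrite ge0_integral_pushforward//= preimage_setT.
Qed.

End affine_substitution.

(** * Normal laws on the line *)

Section normal_law.
Context {R : realType}.
Notation mu := (@lebesgue_measure R).
Implicit Types (m v x : R).

Lemma ge0_integral_normal m v (f : R -> R) : measurable_fun setT f ->
  (forall x, 0 <= f x) ->
  (\int[normal_prob m v]_x (f x)%:E = \int[mu]_x (f x * normal_pdf m v x)%:E)%E.
Proof.
move=> mf f0; rewrite (@ge0_integral_density _ _ _ mu _ (normal_pdf m v))//.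
- exact: measurable_normal_pdf.
- by move=> x; exact: normal_pdf_ge0.
- exact/measurable_EFinP.
Qed.

Lemma normal_pdf_eq m v x : v != 0 -> normal_pdf m v x =
  normal_peak v * expR (- (x - m) ^+ 2 / (2 * v ^+ 2)).
Proof.
by move=> v0; rewrite normal_pdfE// /normal_fun mulr_natl.
Qed.

Lemma normal_peakM v : 0 < v -> normal_peak v = (Num.sqrt (2 * pi))^-1 / v.
Proof.
move=> v0; rewrite /normal_peak -mulrnAr mulr_natl sqrtrM ?sqr_ge0//.
by rewrite sqrtr_sqr gtr0_norm// invfM mulrC.
Qed.

Lemma normal_pdf_shift m v x : v != 0 ->
  normal_pdf m v (x + m) = normal_pdf 0 v x.
Proof. by move=> v0; rewrite !normal_pdf_eq// addrK subr0. Qed.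

Lemma normal_pdf_opp v x : v != 0 -> normal_pdf 0 v (- x) = normal_pdf 0 v x.
Proof. by move=> v0; rewrite !normal_pdf_eq// !subr0 sqrrN. Qed.

(* Trades Gaussian growth for a doubled standard deviation, which reduces
   moment bounds to the total mass of another normal law. *)
Lemma normal_pdf_wide m v x : 0 < v ->
  expR (3 * (x - m) ^+ 2 / (8 * v ^+ 2)) * normal_pdf m v x =
  2 * normal_pdf m (2 * v) x.
Proof.
move=> v0; have v20 : 0 < 2 * v by rewrite mulr_gt0.
rewrite !normal_pdf_eq ?gt_eqF// !normal_peakM// mulrCA -expRD.
move: (Num.sqrt _)^-1 => c; rewrite [RHS]mulrA.
by congr (_ * expR _); field; rewrite gt_eqF.
Qed.

Lemma le_integral_normal_wide m v (f : R -> R) (C : R) : 0 < v ->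
  measurable_fun setT f -> (forall x, 0 <= f x) ->
  (forall x, f x <= C * expR (3 * (x - m) ^+ 2 / (8 * v ^+ 2))) ->
  (\int[normal_prob m v]_x (f x)%:E <= (2 * C)%:E)%E.
Proof.
move=> v0 mf f0 fC; have v20 : 0 < 2 * v by rewrite mulr_gt0.
have C0 : 0 <= C.
  have := le_trans (f0 m) (fC m).
  by rewrite subrr expr0n/= mulr0 mul0r expR0 mulr1.
rewrite ge0_integral_normal//.
apply: (@le_trans _ _ (\int[mu]_x ((2 * C)%:E * (normal_pdf m (2 * v) x)%:E))%E).
  apply: ge0_le_integral => //=.
  - by move=> x _; rewrite lee_fin mulr_ge0// normal_pdf_ge0.
  - apply/measurable_EFinP; apply: measurable_funM => //.
    exact: measurable_normal_pdf.
  - apply/measurable_EFinP; apply: measurable_funM => //.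
    exact: measurable_normal_pdf.
  - move=> x _; rewrite lee_fin (mulrC 2) -mulrA -normal_pdf_wide// mulrA.
    by rewrite ler_wpM2r ?normal_pdf_ge0.
rewrite integralZl//=; last exact: integrable_normal_pdf.
by rewrite integral_normal_pdf mule1.
Qed.

Lemma normal_expR m v (K : R) : 0 < v ->
  (\int[normal_prob m v]_x (expR (K * `|x|))%:E < +oo)%E.
Proof.
move=> v0.
apply: (@le_lt_trans _ _ (2 * (expR (`|K| * `|m| + (K * v) ^+ 2)))%:E); last first.
  by rewrite ltry.
apply: le_integral_normal_wide => //.
- by apply: measurableT_comp => //; exact: measurable_funM.
- move=> x; rewrite -expRD ler_expR.
  have h1 : K * `|x| <= `|K| * `|m| + `|K| * `|x - m|.
    rewrite -mulrDr (le_trans (ler_wpM2r _ (ler_norm _)))// ler_wpM2l//.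
    by rewrite -{1}(subrKC m x) ler_normD.
  (* With p = |K| v and q = |x - m| / v this is p q <= p^2 + q^2 / 4, and 1 / 4 <= 3 / 8. *)
  have h2 : `|K| * `|x - m| <= (K * v) ^+ 2 + 3 * (x - m) ^+ 2 / (8 * v ^+ 2).
    have -> : `|K| * `|x - m| = (`|K| * v) * (`|x - m| / v).
      by field; rewrite gt_eqF.
    have -> : (K * v) ^+ 2 = (`|K| * v) ^+ 2 by rewrite !exprMn real_normK ?num_real.
    have -> : 3 * (x - m) ^+ 2 / (8 * v ^+ 2) = 3 / 8 * (`|x - m| / v) ^+ 2.
      by rewrite exprMn real_normK ?num_real//; field; rewrite gt_eqF.
    move: (`|K| * v) (_ / v) => p q.
    have := sqr_ge0 (p - q / 2); nra.
  lra.
Qed.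

(** The crude u <= exp u, with u = 3 x^2 / (8 v^2), is enough; 8 is twice the resulting constant
    4. *)
Lemma normal_sqr v : 0 < v ->
  (\int[normal_prob 0 v]_x (x ^+ 2)%:E <= (8 * v ^+ 2)%:E)%E.
Proof.
move=> v0; have -> : 8 * v ^+ 2 = 2 * (4 * v ^+ 2) by ring.
apply: le_integral_normal_wide => //.
  by move=> x; exact: sqr_ge0.
move=> x; rewrite subr0.
apply: (@le_trans _ _ (4 * v ^+ 2 * (3 * x ^+ 2 / (8 * v ^+ 2)))).
  rewrite (_ : 4 * v ^+ 2 * _ = 3 / 2 * x ^+ 2); last by field; rewrite gt_eqF.
  by have := sqr_ge0 x; lra.
rewrite ler_wpM2l//; first by rewrite mulr_ge0// sqr_ge0.
by rewrite (le_trans _ (expR_ge1Dx _))// lerDr.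
Qed.

(** The density decreases on [x, x + v], so this interval alone carries at least v times its value
    at x + v. *)
Lemma normal_tail v x : 0 < v -> 0 <= x ->
  (((Num.sqrt (2 * pi))^-1 * expR (- (x / v + 1) ^+ 2 / 2))%:E <=
   normal_prob 0 v `[x, +oo[)%E.
Proof.
move=> v0 x0.
have e : (Num.sqrt (2 * pi))^-1 * expR (- (x / v + 1) ^+ 2 / 2) =
    normal_pdf 0 v (x + v) * v.
  rewrite normal_pdf_eq ?gt_eqF// normal_peakM// mulrAC mulfVK ?gt_eqF//.
  by congr (_ * expR _); rewrite subr0; field; rewrite gt_eqF.
have h1 : ((normal_pdf 0 v (x + v) * v)%:E <=
    \int[mu]_(y in `[x, (x + v)%R]) (normal_pdf 0 v (x + v))%:E)%E.
  rewrite integral_cst//= lebesgue_measure_itv/= lte_fin ltrDl v0.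
  by rewrite -EFinB -EFinM (addrC x) addrK.
have h2 : (\int[mu]_(y in `[x, (x + v)%R]) (normal_pdf 0 v (x + v))%:E <=
    \int[mu]_(y in `[x, (x + v)%R]) (normal_pdf 0 v y)%:E)%E.
  apply: ge0_le_integral => //=.
  - by move=> y _; rewrite lee_fin normal_pdf_ge0.
  - by apply/measurable_EFinP/measurable_funTS; exact: measurable_normal_pdf.
  - move=> y; rewrite in_itv/= => /andP[xy yv].
    rewrite lee_fin !normal_pdf_eq ?gt_eqF// ler_wpM2l ?normal_peak_ge0//.
    rewrite ler_expR !subr0 !mulNr lerN2 ler_wpM2r ?invr_ge0 ?mulr_ge0 ?(ltW v0)//.
    by rewrite ler_sqr ?nnegrE//; lra.
have h3 : (\int[mu]_(y in `[x, (x + v)%R]) (normal_pdf 0 v y)%:E <=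
    normal_prob 0 v `[x, +oo[)%E.
  apply: ge0_subset_integral => //=.
  - by apply/measurable_EFinP/measurable_funTS; exact: measurable_normal_pdf.
  - by move=> y _; rewrite lee_fin normal_pdf_ge0.
  - by apply: subset_itvl; rewrite bnd_simp.
by rewrite e; exact: le_trans h1 (le_trans h2 h3).
Qed.

Lemma ge0_integral_normal_shift m v (f : R -> R) : v != 0 -> continuous f ->
  (forall x, 0 <= f x) ->
  (\int[normal_prob m v]_x (f x)%:E = \int[normal_prob 0 v]_x (f (x + m))%:E)%E.
Proof.
move=> v0 cf f0; have mf := continuous_measurable_fun cf.
have mfm : measurable_fun setT (fun x => f (x + m)).
  by apply: (measurableT_comp mf); exact: measurable_funD.
rewrite (ge0_integral_normal m v mf f0).
rewrite (ge0_integral_normal 0 v mfm (fun x => f0 _)).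
rewrite (@ge0_integral_affine _ 1 m)//.
- by apply: eq_integral => x _; rewrite !mul1r normal_pdf_shift.
- move=> x; apply: cvgM; first exact: cf.
  exact: continuous_normal_pdf.
- by move=> x; rewrite mulr_ge0// normal_pdf_ge0.
Qed.

Lemma ge0_integral_normal_opp v (f : R -> R) : v != 0 -> measurable_fun setT f ->
  (forall x, 0 <= f x) ->
  (\int[normal_prob 0 v]_x (f x)%:E = \int[normal_prob 0 v]_x (f (- x)%R)%:E)%E.
Proof.
move=> v0 mf f0.
have mfN : measurable_fun setT (fun x => f (- x)) by exact: (measurableT_comp mf).
rewrite (ge0_integral_normal 0 v mf f0).
rewrite (ge0_integral_normal 0 v mfN (fun x => f0 _)).
rewrite ge0_integral_opp.
- by apply: eq_integral => x _; rewrite normal_pdf_opp.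
- apply/measurable_EFinP; apply: measurable_funM => //.
  exact: measurable_normal_pdf.
- by move=> x; rewrite lee_fin mulr_ge0// normal_pdf_ge0.
Qed.

Lemma integrable_normal_id m v : 0 < v ->
  (normal_prob m v).-integrable setT (EFin \o (id : R -> R)).
Proof.
move=> v0; apply/integrableP; split; first exact/measurable_EFinP.
apply: le_lt_trans (normal_expR m 1 v0).
apply: ge0_le_integral => //=.
- by apply: measurableT_comp => //; exact/measurable_EFinP.
- apply/measurable_EFinP; apply: measurableT_comp => //.
  exact: measurable_funM.
- move=> x _; rewrite lee_fin mul1r (le_trans _ (expR_ge1Dx _))//.
  by rewrite lerDr.
Qed.

(** By symmetry the positive and negative parts of x - m have the same finite integral, so they
    cancel. *)
Lemma normal_mean m v : 0 < v -> (\int[normal_prob m v]_x x%:E = m%:E)%E.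
Proof.
move=> v0; have v1 : v != 0 by rewrite gt_eqF.
pose p x := Num.max (x - m) 0; pose q x := Num.max (m - x) 0.
have cp : continuous p.
  move=> x; apply: (@continuous_max _ _ (fun x => x - m) (fun=> 0)).
    by apply: cvgB => //; exact: cvg_cst.
  exact: cvg_cst.
have cq : continuous q.
  move=> x; apply: (@continuous_max _ _ (fun x => m - x) (fun=> 0)).
    by apply: cvgB => //; exact: cvg_cst.
  exact: cvg_cst.
have p0 x : 0 <= p x by rewrite le_max lexx orbT.
have q0 x : 0 <= q x by rewrite le_max lexx orbT.
have pq : (\int[normal_prob m v]_x (p x)%:E = \int[normal_prob m v]_x (q x)%:E)%E.
  rewrite (ge0_integral_normal_shift m v1 cp p0).
  rewrite (ge0_integral_normal_shift m v1 cq q0).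
  rewrite [RHS]ge0_integral_normal_opp.
  - by apply: eq_integral => x _; rewrite /p /q; congr (Num.max _ _)%:E; ring.
  - by [].
  - apply: (measurableT_comp (continuous_measurable_fun cq)).
    exact: measurable_funD.
  - by move=> x; exact: q0.
have Iid := integrable_normal_id m v0.
have Im : (normal_prob m v).-integrable setT (EFin \o cst m).
  exact: (bmeas_integrable (probability_setTy (normal_prob m v)) (bmeas_cst _ m)).
have Ip : (normal_prob m v).-integrable setT (EFin \o p).
  apply: (le_integrable measurableT _ _ (integrable_abse (integrableB measurableT Iid Im))).
    by apply/measurable_EFinP; exact: continuous_measurable_fun.
  move=> x _ /=; rewrite lee_fin ger0_norm// normr_id /p ge_max normr_ge0.
  by rewrite ler_norm.
have Iq : (normal_prob m v).-integrable setT (EFin \o q).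
  apply: (le_integrable measurableT _ _ (integrable_abse (integrableB measurableT Iid Im))).
    by apply/measurable_EFinP; exact: continuous_measurable_fun.
  move=> x _ /=; rewrite lee_fin ger0_norm// normr_id /q ge_max normr_ge0.
  by rewrite distrC ler_norm.
transitivity (\int[normal_prob m v]_x ((EFin \o cst m) x + ((EFin \o p) x - (EFin \o q) x)))%E.
  apply: eq_integral => x _ /=; rewrite -EFinB -EFinD /p /q; congr (_%:E).
  have [h|/ltW h] := leP x m.
    by rewrite (@max_r _ _ (x - m)) ?subr_le0// (@max_l _ _ (m - x)) ?subr_ge0//; ring.
  by rewrite (@max_l _ _ (x - m)) ?subr_ge0// (@max_r _ _ (m - x)) ?subr_le0//; ring.
rewrite integralD//; last exact: integrableB.
rewrite integralB// [X in (_ - X)%E](_ : _ = \int[normal_prob m v]_x (p x)%:E)%E//.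
rewrite subee ?adde0; last exact: integrable_fin_num.
exact: (integral_probability_cst (normal_prob m v)).
Qed.

End normal_law.

(** * Stability of the centered normal law *)

Section normal_stable.
Context {R : realType}.
Notation mu := (@lebesgue_measure R).
Implicit Types (m v x : R).

(** With s = sqrt 2 and y = s u - x the argument of g becomes u. As (s u - x)^2 + x^2 = u^2 + (s x -
    u)^2, the density of u splits off and the remaining integral over x has mass 1: this is the
    rotation invariance of a product of normal laws, one variable at a time. *)
Lemma normal_stable v (g : R -> R) : 0 < v -> continuous g ->
  (forall x, 0 <= g x) ->
  (\int[normal_prob 0 v]_x \int[normal_prob 0 v]_y
     (g ((Num.sqrt 2)^-1 * x + (Num.sqrt 2)^-1 * y))%:E =
   \int[normal_prob 0 v]_x (g x)%:E)%E.
Proof.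
move=> v0 cg g0; have v1 : v != 0 by rewrite gt_eqF.
set r := (Num.sqrt 2)^-1; pose s : R := Num.sqrt 2.
have s0 : 0 < s by rewrite sqrtr_gt0.
have rs : r * s = 1 by rewrite mulVf// gt_eqF.
have ss : s ^+ 2 = 2 by rewrite sqr_sqrtr.
have mg := continuous_measurable_fun cg.
have mpdf := measurable_normal_pdf 0 v.
have pdf0 := normal_pdf_ge0 0 v.
have cpdf : continuous (normal_pdf 0 v) by exact: continuous_normal_pdf.
have pdfsym (u x : R) : normal_pdf 0 v (s * u - x) * normal_pdf 0 v x =
    normal_pdf 0 v u * normal_pdf 0 v (s * x - u).
  rewrite !normal_pdf_eq// mulrACA -expRD [RHS]mulrACA -expRD !subr0.
  congr (_ * expR _); rewrite -!mulrDl -!opprD; congr (- _ / _).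
  by rewrite !sqrrB !exprMn ss; ring.
have mgc : measurable_fun setT (fun z : R * R => g (r * z.1 + r * z.2)).
  apply: measurableT_comp => //.
  by apply: measurable_funD; apply: measurable_funM.
have inner x : (\int[normal_prob 0 v]_y (g (r * x + r * y))%:E =
    \int[mu]_y (g (r * x + r * y) * normal_pdf 0 v y)%:E)%E.
  rewrite ge0_integral_normal//.
  by apply: measurableT_comp => //; apply: measurable_funD => //; exact: measurable_funM.
transitivity (\int[mu]_x \int[mu]_u
    (s * (g u * (normal_pdf 0 v (s * u - x) * normal_pdf 0 v x)))%:E)%E.
  rewrite (@ge0_integral_density _ _ _ mu _ (normal_pdf 0 v))//; last 2 first.
  - apply: (@measurable_fun_fubini_tonelli_F _ _ _ _ _ (normal_prob 0 v)
      (fun z : R * R => (g (r * z.1 + r * z.2))%:E)) => //.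
      exact/measurable_EFinP.
    by move=> z; rewrite lee_fin.
  - by move=> x; apply: integral_ge0 => y _; rewrite lee_fin.
  apply: eq_integral => x _; rewrite inner.
  rewrite -ge0_integralZr//; last 3 first.
  - apply/measurable_EFinP; apply: measurable_funM => //.
    by apply: measurableT_comp => //; apply: measurable_funD => //; exact: measurable_funM.
  - by move=> y _; rewrite lee_fin mulr_ge0.
  - by rewrite lee_fin.
  under eq_integral do rewrite -EFinM.
  rewrite (@ge0_integral_affine _ s (- x) (fun y => g (r * x + r * y) * normal_pdf 0 v y * normal_pdf 0 v x))//.
  - apply: eq_integral => u _; rewrite -mulrA; congr (_ * (g _ * _))%:E.
    by rewrite -mulrDr subrKC mulrA rs mul1r.
  - move=> y; apply: cvgM; last exact: cvg_cst.
    apply: cvgM; last exact: cpdf.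
    apply: (@cvg_comp _ _ _ (fun y => r * x + r * y) g); last exact: cg.
    by apply: cvgD; [exact: cvg_cst|apply: cvgM => //; exact: cvg_cst].
  - by move=> y; rewrite !mulr_ge0.
pose H (z : R * R) := (s * (g z.2 * (normal_pdf 0 v (s * z.2 - z.1) * normal_pdf 0 v z.1)))%:E.
rewrite (@fubini_tonelli _ _ _ _ _ mu mu H)//; last 2 first.
- apply/measurable_EFinP; apply: measurable_funM => //; apply: measurable_funM.
    exact: measurableT_comp.
  apply: measurable_funM; apply: measurableT_comp => //.
  by apply: measurable_funB => //; exact: measurable_funM.
- by move=> z; rewrite lee_fin !mulr_ge0// ltW.
rewrite ge0_integral_normal//; apply: eq_integral => u _ /=.
rewrite /H/=; transitivity (\int[mu]_x ((g u * normal_pdf 0 v u)%:E * (s * normal_pdf 0 v (s * x + - u))%:E))%E.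
  by apply: eq_integral => x _; rewrite pdfsym -EFinM; congr EFin; ring.
rewrite ge0_integralZl//; last 3 first.
- apply/measurable_EFinP; apply: measurable_funM => //.
  by apply: measurableT_comp => //; apply: measurable_funD => //; exact: measurable_funM.
- by move=> x _; rewrite lee_fin mulr_ge0// ltW.
- by rewrite lee_fin mulr_ge0.
by rewrite -ge0_integral_affine// integral_normal_pdf mule1.
Qed.

End normal_stable.

Section integral_law.
Context d d' (T : measurableType d) (T' : measurableType d') {R : realType}.
Variables (P : {measure set T -> \bar R}) (nu : {measure set T' -> \bar R}).
Variables (Y : T -> T') (mY : measurable_fun setT Y).
Hypothesis PY : forall B, measurable B -> P (Y @^-1` B) = nu B.

Lemma ge0_integral_law (f : T' -> \bar R) :
  measurable_fun setT f -> (forall x, 0 <= f x)%E ->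
  (\int[P]_w f (Y w) = \int[nu]_x f x)%E.
Proof.
move=> mf f0.
transitivity (\int[pushforward P Y]_x f x)%E.
  by rewrite ge0_integral_pushforward.
by apply: eq_measure_integral => B mB _; exact: PY.
Qed.

Lemma integral_law (f : T' -> \bar R) :
  measurable_fun setT f -> (\int[P]_w f (Y w) = \int[nu]_x f x)%E.
Proof.
move=> mf; rewrite integralE [RHS]integralE.
rewrite -(@ge0_integral_law f^\+%E)//; last exact: measurable_funepos.
rewrite -(@ge0_integral_law f^\-%E) => [||//]; last exact: measurable_funeneg.
by congr (_ - _)%E; apply: eq_integral => w _; rewrite ?(funepos_comp f Y) ?(funeneg_comp f Y).
Qed.

End integral_law.

Section laws.
Context d (T : measurableType d) {R : realType} (P : probability T R).
Variables (Y : T -> R) (mY : measurable_fun setT Y).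

Definition centered_gaussian :=
  (forall B, measurable B -> P (Y @^-1` B) = \d_(0 : R) B) \/
  (exists2 v : R, 0 < v & forall B, measurable B -> P (Y @^-1` B) = normal_prob 0 v B).

Lemma gaussian_expR K : gaussian_law (pushforward P Y) ->
  (\int[P]_w (expR (K * `|Y w|))%:E < +oo)%E.
Proof.
have mf : measurable_fun setT (fun x : R => (expR (K * `|x|))%:E).
  apply/measurable_EFinP; apply: measurableT_comp => //.
  exact: measurable_funM.
have f0 (x : R) : (0 <= (expR (K * `|x|))%:E)%E by rewrite lee_fin expR_ge0.
case=> [[m PY]|[m [v [v0 PY]]]].
  by rewrite (ge0_integral_law mY PY mf f0) integral_dirac// diracT mul1e ltry.
by rewrite (@ge0_integral_law _ _ T (measurableTypeR R) R P (normal_prob m v)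
  Y mY PY _ mf f0); exact: normal_expR.
Qed.

Lemma expR_integrable (f : T -> R) : measurable_fun setT f ->
  (\int[P]_w (expR `|f w|)%:E < +oo)%E -> P.-integrable setT (EFin \o f).
Proof.
move=> mf Mf; apply/integrableP; split; first exact/measurable_EFinP.
apply: le_lt_trans Mf; apply: ge0_le_integral => //=.
- by do 2 apply: measurableT_comp => //.
- by apply/measurable_EFinP; do 2 apply: measurableT_comp => //.
- by move=> w _; rewrite lee_fin (le_trans _ (expR_ge1Dx _))// lerDr.
Qed.

Lemma gaussian_integrable : gaussian_law (pushforward P Y) ->
  P.-integrable setT (EFin \o Y).
Proof.
move=> /(gaussian_expR 1) h; apply: expR_integrable => //.
by under eq_integral do rewrite -[X in expR X]mul1r.
Qed.

Lemma centered_gaussianP : gaussian_law (pushforward P Y) ->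
  (\int[P]_w (Y w)%:E = 0)%E -> centered_gaussian.
Proof.
have mE : measurable_fun setT (EFin : R -> \bar R) by [].
move=> [[m PY]|[m [v [v0 PY]]]] EY; [left|right].
  move: EY; rewrite (integral_law mY PY mE) integral_dirac// diracT mul1e => -[m0].
  by move=> B mB; rewrite -m0; exact: PY.
exists v => //; move: EY; rewrite (@integral_law _ _ T (measurableTypeR R) R P (normal_prob m v)
  Y mY PY _ mE) normal_mean// => -[m0].
by move=> B mB; rewrite -m0; exact: PY.
Qed.

End laws.

Section symmetries.
Context d (T : measurableType d) {R : realType} (P : probability T R).
Variables (Y : T -> R) (mY : measurable_fun setT Y).
Hypothesis cY : centered_gaussian P Y.
Variables (g : R -> R) (cg : continuous g) (g0 : forall x, 0 <= g x).
Let mg : measurable_fun setT (fun x => (g x)%:E).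
Proof. by apply/measurable_EFinP; exact: continuous_measurable_fun. Qed.

Lemma centered_gaussian_opp : (\int[P]_w (g (- Y w))%:E = \int[P]_w (g (Y w))%:E)%E.
Proof.
have mgN : measurable_fun setT (fun x : R => (g (- x))%:E).
  by apply: (measurableT_comp mg); exact: oppr_measurable.
have g0N (x : R) : (0 <= (g x)%:E)%E by rewrite lee_fin.
case: cY => [PY|[v v0 PY]].
  rewrite (ge0_integral_law mY PY mgN (fun x => g0N _)).
  rewrite (ge0_integral_law mY PY mg g0N).
  by rewrite !integral_dirac// !diracT oppr0.
rewrite (@ge0_integral_law _ _ T (measurableTypeR R) R P (normal_prob 0 v)
  Y mY PY _ mgN (fun x => g0N _)).
rewrite (@ge0_integral_law _ _ T (measurableTypeR R) R P (normal_prob 0 v)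
  Y mY PY _ mg g0N).
rewrite [RHS]ge0_integral_normal_opp ?gt_eqF//.
exact: continuous_measurable_fun.
Qed.

Lemma centered_gaussian_stable (r := (Num.sqrt 2)^-1 : R) :
  (\int[P]_w \int[P]_z (g (r * Y w + r * Y z))%:E = \int[P]_w (g (Y w))%:E)%E.
Proof.
have g0N (x : R) : (0 <= (g x)%:E)%E by rewrite lee_fin.
have mgc : measurable_fun setT (fun z : R * R => (g (r * z.1 + r * z.2))%:E).
  apply: (measurableT_comp mg).
  by apply: measurable_funD; apply: measurable_funM.
have mgx (x : R) : measurable_fun setT (fun y => (g (r * x + r * y))%:E).
  apply: (measurableT_comp mg).
  by apply: measurable_funD => //; exact: measurable_funM.
(* Serves both cases: [j] is the identity, seen from the space carrying the point mass or the normal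
   law. *)
have main d' (T' : measurableType d') (nu : probability T' R) (Z : T -> T')
    (j : T' -> R) : measurable_fun setT Z -> measurable_fun setT j ->
    (forall w, j (Z w) = Y w) ->
    (forall B, measurable B -> P (Z @^-1` B) = nu B) ->
    (\int[P]_w \int[P]_z (g (r * Y w + r * Y z))%:E =
     \int[nu]_x \int[nu]_y (g (r * j x + r * j y))%:E)%E.
  move=> mZ mj jZ PY.
  have mjc : measurable_fun setT (fun z : T' * T' => (g (r * j z.1 + r * j z.2))%:E).
    apply: (measurableT_comp mg).
    apply: measurable_funD; apply: measurable_funM => //.
      exact: (measurableT_comp mj).
    exact: (measurableT_comp mj).
  rewrite -(ge0_integral_law mZ PY); last 2 first.
  - by apply: (@measurable_fun_fubini_tonelli_F _ _ _ _ _ nu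
      (fun z : T' * T' => (g (r * j z.1 + r * j z.2))%:E)).
  - by move=> x; exact: integral_ge0.
  apply: eq_integral => w _.
  rewrite -(ge0_integral_law mZ PY) => [|//|//].
    by apply: eq_integral => z _; rewrite !jZ.
  apply: (measurableT_comp mg); apply: measurable_funD => //.
  exact: measurable_funM.
have mid : measurable_fun setT (id : R -> R) by [].
case: cY => [PY|[v v0 PY]].
  rewrite (main _ _ (\d_(0 : R)) Y id)// (ge0_integral_law mY PY mg g0N) integral_dirac//; last first.
    by apply: (@measurable_fun_fubini_tonelli_F _ _ _ _ _ (\d_(0 : R))
      (fun z : R * R => (g (r * z.1 + r * z.2))%:E)).
  by rewrite diracT mul1e !integral_dirac// !diracT !mul1e !mulr0 addr0.
rewrite (main _ (measurableTypeR R) (normal_prob 0 v) Y id)//.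
rewrite (@ge0_integral_law _ _ T (measurableTypeR R) R P (normal_prob 0 v)
  Y mY PY _ mg g0N).
exact: normal_stable.
Qed.

End symmetries.

(** * Invariances of the law of the process *)

Section path_laws.
Context {R : realType} (P : probability (skorokhod R) R).
Local Notation path := (skorokhod R).

(** Cosines are shifted by 1 to be nonnegative, so that integrals can be transported and exchanged
    without integrability conditions; the constant is removed by linearity. *)
Lemma path_law_unique d (T : measurableType d) (Q : probability T R)
    (F : T -> path) : measurable_fun setT F ->
  (forall l x, \int[Q]_t (1 + cos (linform l (F t) + x))%:E =
               \int[P]_w (1 + cos (linform l w + x))%:E)%E ->
  forall A, measurable A -> Q (F @^-1` A) = P A.
Proof.
move=> mF QP A mA.
have Qoo : (pushforward Q F setT < +oo)%E.
  by rewrite /pushforward preimage_setT; exact: probability_setTy.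
change (pushforward Q F A = P A).
apply: (cramer_wold Qoo (probability_setTy P) _ mA) => l x.
have b1 : bmeas (fun w : path => 1 + trig l x w).
  by apply: bmeasD; [exact: bmeas_cst|exact: bmeas_trig].
have -> : trig l x = (fun w => 1 * (1 + trig l x w) + (-1) * 1).
  by apply/funext => w; ring.
have [mb _] := b1.
apply: (same_lin Qoo (probability_setTy P) 1 (-1) b1 (bmeas_cst _ 1)).
- rewrite /same ge0_integral_pushforward//.
  + by rewrite preimage_setT; exact: QP.
  + exact/measurable_EFinP.
  + move=> w _; rewrite lee_fin -lerBlDl sub0r.
    exact: cos_geN1.
- rewrite /same ge0_integral_pushforward// preimage_setT/=.
  by rewrite !integral_probability_cst.
Qed.

Hypothesis gaussP : gaussian_process P.
Hypothesis mean0 : forall s : unit_interval R,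
  ('E_P[fun w : path => w s])%E = 0%E.

Lemma gaussian_linform l : gaussian_law (pushforward P (linform l)).
Proof.
have := gaussP (fun i : 'I_(size l) => (tnth (in_tuple l) i).2)
  (fun i => (tnth (in_tuple l) i).1).
congr (gaussian_law (pushforward P _)); apply/funext => w.
by rewrite /linform (big_tnth _ _ l).
Qed.

Lemma integrable_linform l : P.-integrable setT (EFin \o linform l).
Proof.
apply: gaussian_integrable; first exact: measurable_linform.
exact: gaussian_linform.
Qed.

Lemma mean_linform l : (\int[P]_w (linform l w)%:E = 0)%E.
Proof.
elim: l => [|[c s] l IHl].
  under eq_integral do rewrite /linform big_nil.
  by rewrite integral0.
have e w : linform ((c, s) :: l) w = linform [:: (c, s)] w + linform l w.
  by rewrite -linform_cat.
under eq_integral do rewrite e EFinD.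
rewrite integralD//=; [|exact: integrable_linform..].
rewrite IHl adde0; under eq_integral do rewrite linform1 EFinM.
have Is : P.-integrable setT (EFin \o (fun w : path => w s)).
  have := integrable_linform [:: (1, s)].
  by congr (_.-integrable setT _); apply/funext => w /=; rewrite linform1 mul1r.
rewrite integralZl//.
by have := mean0 s; rewrite unlock => ->; rewrite mule0.
Qed.

Lemma centered_linform l : centered_gaussian P (linform l).
Proof.
apply: centered_gaussianP; first exact: measurable_linform.
  exact: gaussian_linform.
exact: mean_linform.
Qed.

Let cos1 (x y : R) : R := 1 + cos (y + x).

Let continuous_cos1 x : continuous (cos1 x).
Proof.
move=> y; apply: cvgD; first exact: cvg_cst.
apply: (@cvg_comp _ _ _ (fun y => y + x) cos); last exact: continuous_cos.
by apply: cvgD => //; exact: cvg_cst.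
Qed.

Let cos1_ge0 x y : 0 <= cos1 x y.
Proof. by rewrite /cos1 -lerBlDl sub0r cos_geN1. Qed.

Definition path_opp (w : path) : path := comb (-1) 0 w w.

Lemma path_oppE w s : path_opp w s = - w s.
Proof. by rewrite /path_opp /= mulN1r mul0r addr0. Qed.

Lemma measurable_path_opp : measurable_fun setT path_opp.
Proof. exact: measurable_comb. Qed.

(** Every linear form is a centered Gaussian variable, hence symmetric. *)
Lemma path_law_opp A : measurable A -> P (path_opp @^-1` A) = P A.
Proof.
apply: path_law_unique; first exact: measurable_path_opp.
move=> l x.
rewrite -(centered_gaussian_opp (measurable_linform l) (centered_linform l)
  (@continuous_cos1 x) (cos1_ge0 x)).
apply: eq_integral => w _.
by rewrite /cos1 linform_comb mulN1r mul0r addr0.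
Qed.

(** A linear form of the merged path is r Y + r Y' with Y, Y' independent copies of one centered
    Gaussian variable, so stability on the line suffices. *)
Lemma path_law_stable (r := (Num.sqrt 2)^-1 : R) A : measurable A ->
  (P \x P)%E ((fun z => comb r r z.1 z.2) @^-1` A) = P A.
Proof.
have mF : measurable_fun setT (fun z : path * path => comb r r z.1 z.2).
  exact: measurable_comb.
apply: path_law_unique => // l x.
rewrite -(centered_gaussian_stable (measurable_linform l) (centered_linform l)
  (@continuous_cos1 x) (cos1_ge0 x)).
rewrite (fubini_tonelli1 (fun z : path * path =>
  (1 + cos (linform l (comb r r z.1 z.2) + x))%:E)).
- apply: eq_integral => w _; apply: eq_integral => z _.
  by rewrite linform_comb.
- apply/measurable_EFinP.
  apply: (measurableT_comp (continuous_measurable_fun (@continuous_cos1 x))).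
  exact: (measurableT_comp (measurable_linform l) mF).
- by move=> z; rewrite lee_fin; exact: cos1_ge0.
Qed.

End path_laws.

(** * Concentration of the supremum *)

Section exponential_bounds.
Context {R : realType}.
Implicit Types u x : R.

Lemma expR_le_quadratic u : u <= 0 -> expR u <= 1 + u + u ^+ 2 / 2.
Proof.
move=> u0; pose F (x : R) := 1 + x + x ^+ 2 / 2 - expR x.
have dF x : is_derive x 1 F (1 + x - expR x).
  rewrite /F; apply: is_derive_eq.
  by rewrite !(addr0, scaler0, add0r)/= /GRing.scale/=; field.
have : F 0 <= F u.
  apply: (@ler0_derive1_nincrNy _ F 0) => //.
  - move=> x _; rewrite derive1E derive_val.
    by have := expR_ge1Dx x; lra.
  - apply: continuous_subspaceT => x.
    by apply/differentiable_continuous/derivable1_diffP; exact: ex_derive.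
by rewrite /F expR0; lra.
Qed.

Lemma expR_sub1_le u : expR u - 1 <= u * expR u.
Proof.
have := expR_ge1Dx (- u); have := expRxMexpNx_1 u; have := expR_gt0 u; nra.
Qed.

Lemma expR_sub1D_le u : 0 <= u -> expR u - 1 - u <= u ^+ 2 * expR u.
Proof.
move=> u0; apply: (@le_trans _ _ (u * (expR u - 1))).
  by have := expR_sub1_le u; lra.
by rewrite expr2 -mulrA ler_wpM2l// expR_sub1_le.
Qed.

(** The coefficient 1 / 2 must be exact, as it becomes the one of lambda^2 sigma^2 / 2; the cubic
    term may be crude since the iteration makes it vanish. *)
Lemma expR_le_cubic u : expR u <= 1 + u + u ^+ 2 / 2 + `|u| ^+ 3 * expR `|u|.
Proof.
have [u0|u0] := leP u 0.
  by rewrite (le_trans (expR_le_quadratic u0))// lerDl mulr_ge0// ?exprn_ge0// expR_ge0.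
rewrite gtr0_norm//; have {}u0 := ltW u0.
pose G (x : R) := 1 + x + x ^+ 2 / 2 + x ^+ 3 * expR x - expR x.
have dG x : is_derive x 1 G (1 + x + (3 * x ^+ 2 + x ^+ 3) * expR x - expR x).
  rewrite /G; apply: is_derive_eq.
  by rewrite !(addr0, scaler0, add0r)/= /GRing.scale/=; field.
have : G 0 <= G u.
  apply: (@ger0_derive1_ndecry _ G 0) => //.
  - move=> x; rewrite in_itv/= andbT => /ltW x0; rewrite derive1E derive_val.
    have := expR_sub1D_le x0.
    have := mulr_ge0 (mulr_ge0 (sqr_ge0 x) x0) (expR_ge0 x).
    have := mulr_ge0 (sqr_ge0 x) (expR_ge0 x).
    by rewrite (_ : x ^+ 3 = x ^+ 2 * x); [lra|ring].
  - apply: continuous_subspaceT => x.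
    by apply/differentiable_continuous/derivable1_diffP; exact: ex_derive.
by rewrite /G expR0; lra.
Qed.

Lemma expR_quad_upper u : expR u <= 1 + u + u ^+ 2 * expR `|u|.
Proof.
have [u0|u0] := leP u 0; last first.
  by rewrite gtr0_norm//; have := expR_sub1D_le (ltW u0); lra.
rewrite (le_trans (expR_le_quadratic u0))// lerD2l ler_wpM2l ?sqr_ge0//.
have : 1 + `|u| <= expR `|u| by exact: expR_ge1Dx.
by have := normr_ge0 u; lra.
Qed.

(** Cube of u / 3 <= exp (u / 3). *)
Lemma cubic_le_expR u : 0 <= u -> u ^+ 3 <= 27 * expR u.
Proof.
move=> u0; have h : u / 3 <= expR (u / 3).
  by rewrite (le_trans _ (expR_ge1Dx _))// lerDr.
have -> : expR u = expR (u / 3) ^+ 3.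
  by rewrite -expRM_natr; congr expR; field.
have -> : u ^+ 3 = 27 * (u / 3) ^+ 3 by field.
by rewrite ler_pM2l// lerXn2r// nnegrE ?expR_ge0// divr_ge0.
Qed.

End exponential_bounds.

Section path_algebra.
Context {R : realType}.
Implicit Types x y w : skorokhod R.

Lemma path_ext x y : (forall s, x s = y s) -> x = y.
Proof.
case: x y => [f cf] [g cg] /= fg; have {}fg : f = g by apply/funext.
by case: _ / fg cg => cg; congr Skorokhod; exact: Prop_irrelevance.
Qed.

Definition path0 : skorokhod R := comb 0 0 point point.

Lemma comb1_path0 w : comb 1 1 path0 w = w.
Proof. by apply: path_ext => s /=; ring. Qed.

Lemma combCA a b w x y : comb 1 a (comb 1 b w x) y = comb 1 b (comb 1 a w y) x.
Proof. by apply: path_ext => s /=; ring. Qed.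

Lemma comb_comb r q w x y :
  comb 1 r w (comb q q x y) = comb 1 (r * q) (comb 1 (r * q) w x) y.
Proof. by apply: path_ext => s /=; ring. Qed.

End path_algebra.

(** * Concentration for a law invariant under merging two copies *)

Section concentration.
Context {R : realType} (P : probability (skorokhod R) R).
Local Notation path := (skorokhod R).
Let q : R := (Num.sqrt 2)^-1.
Hypothesis stableP : forall A, measurable A ->
  (P \x P)%E ((fun z => comb q q z.1 z.2) @^-1` A) = P A.
Variable m : path -> R.
Hypothesis mm : measurable_fun setT m.
Hypothesis m0 : forall w, 0 <= m w.
Hypothesis expm : forall K, (\int[P]_w (expR (K * m w))%:E < +oo)%E.

Let q0 : 0 < q. Proof. by rewrite invr_gt0 sqrtr_gt0. Qed.
Let q2 : q ^+ 2 = 2^-1. Proof. by rewrite exprVn sqr_sqrtr. Qed.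
Let q1 : q <= 1.
Proof. by rewrite -(@ler_pXn2r _ 2)// ?nnegrE ?ltW// q2 expr1n; lra. Qed.

Let mexpm K : measurable_fun setT (fun w => expR (K * m w)).
Proof. by apply: measurableT_comp => //; exact: measurable_funM. Qed.

Lemma integrable_expm K : P.-integrable setT (EFin \o (fun w => expR (K * m w))).
Proof.
apply/integrableP; split; first by apply/measurable_EFinP; exact: mexpm.
under eq_integral do rewrite /= ger0_norm ?expR_ge0//.
exact: expm.
Qed.

Lemma le_expm_integrable (f : path -> R) (C K : R) : measurable_fun setT f ->
  (forall w, `|f w| <= C * expR (K * m w)) -> P.-integrable setT (EFin \o f).
Proof.
move=> mf fC.
have IC : P.-integrable setT (EFin \o (fun w => C * expR (K * m w))).
  by have := integrableZl measurableT C (integrable_expm K).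
apply: (le_integrable measurableT _ _ IC); first exact/measurable_EFinP.
by move=> w _ /=; rewrite lee_fin (le_trans (fC w))// ler_norm.
Qed.

(** A Lipschitz condition in which [m] measures the size of the noise [x]. It is uniform in the base
    point [w], so that averages inherit it. *)
Definition lip (f : path -> R) := measurable_fun setT f /\
  forall w x r, 0 <= r -> `|f (comb 1 r w x) - f w| <= r * m x.

Lemma measurable_shift (f : path -> R) (r : R) w : measurable_fun setT f ->
  measurable_fun setT (fun x => f (comb 1 r w x)).
Proof. by move=> mf; apply: (measurableT_comp mf); exact: measurable_comb. Qed.

Lemma lip_bound f w : lip f -> `|f w| <= `|f (path0)| + m w.
Proof.
move=> [mf lf]; have := lf path0 w 1 ler01; rewrite comb1_path0 mul1r => h.
rewrite -[X in `|X|](subrKC (f path0)) (le_trans (ler_normD _ _))//.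
by rewrite lerD2l.
Qed.

Let m_le_expm (K : R) w : 0 <= K -> K * m w <= expR (K * m w).
Proof. by move=> K0; rewrite (le_trans _ (expR_ge1Dx _))// lerDr. Qed.

Lemma lip_integrable f r w : 0 <= r -> lip f ->
  P.-integrable setT (EFin \o (fun x => f (comb 1 r w x))).
Proof.
move=> r0 [mf lf].
apply: (@le_expm_integrable _ (`|f w| + 1) r); first exact: measurable_shift.
move=> x; rewrite mulrDl mul1r -[X in `|X|](subrKC (f w)).
rewrite (le_trans (ler_normD _ _))// lerD//; last first.
  by rewrite (le_trans (lf _ _ _ r0))// m_le_expm.
by rewrite ler_peMr// -expR0 ler_expR mulr_ge0.
Qed.

(** The heat semigroup attached to [P], at time r^2: noise r x is added to the path and integrated
    out. *)
Definition avg (f : path -> R) (r : R) (w : path) : R :=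
  \int[P]_x f (comb 1 r w x).

Lemma avgE f r w : 0 <= r -> lip f ->
  (\int[P]_x (f (comb 1 r w x))%:E = (avg f r w)%:E)%E.
Proof.
by move=> r0 lf; rewrite /avg /Rintegral fineK//; apply: integrable_fin_num => //;
  exact: lip_integrable.
Qed.

Lemma integrable_m : P.-integrable setT (EFin \o m).
Proof.
apply: (@le_expm_integrable _ 1 1) => // w.
by rewrite ger0_norm// !mul1r -{1}(mul1r (m w)) -{2}(mul1r (m w)) m_le_expm.
Qed.

Lemma integrable_prod_m : (P \x P)%E.-integrable setT (EFin \o (fun z => m z.1)) /\
  (P \x P)%E.-integrable setT (EFin \o (fun z => m z.2)).
Proof.
have [_ Im] := integrableP _ _ _ integrable_m.
have m1 : measurable_fun setT (EFin \o (fun z : path * path => m z.1)).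
  by apply/measurable_EFinP; exact: (measurableT_comp mm).
have m2 : measurable_fun setT (EFin \o (fun z : path * path => m z.2)).
  by apply/measurable_EFinP; exact: (measurableT_comp mm).
split; apply/integrable12ltyP => //=.
- by under eq_integral do rewrite integral_probability_cst.
- by rewrite integral_cst//= (le_lt_trans _ Im)// probability_setT mule1.
Qed.

(** Adding two noises commutes, so the increment of the average is the average of the increments.
    Measurability in w comes from Fubini, with |f 0| + m w + r m x as integrable bound on the
    product. *)
Lemma lip_avg f r : 0 <= r -> lip f -> lip (avg f r).
Proof.
move=> r0 lf; have [mf Lf] := lf; split.
  have mF : measurable_fun setT (fun z : path * path => f (comb 1 r z.1 z.2)).
    by apply: (measurableT_comp mf); exact: measurable_comb.
  have [I1 I2] := integrable_prod_m.
  have IC : (P \x P)%E.-integrable setT (EFin \o (fun=> `|f path0|)).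
    apply: (bmeas_integrable _ (bmeas_cst _ _)).
    exact: (probability_setTy (P \x P)%E).
  have I : (P \x P)%E.-integrable setT
      (EFin \o (fun z : path * path => f (comb 1 r z.1 z.2))).
    apply: (le_integrable measurableT _ _ (integrableD measurableT IC
      (integrableD measurableT I1 (integrableZl measurableT r I2)))).
      exact/measurable_EFinP.
    move=> [w x] _ /=; rewrite lee_fin [leRHS]ger0_norm; last first.
      by rewrite !addr_ge0// mulr_ge0.
    rewrite -[X in `|X|](subrKC (f w)) (le_trans (ler_normD _ _))//.
    by rewrite addrA lerD ?lip_bound// Lf.
  have := measurable_fubini_F I => mfub.
  by apply: (measurableT_comp (fine_measurable measurableT) mfub).
move=> w x s s0.
have e : avg f r (comb 1 s w x) - avg f r w =
    \int[P]_y (f (comb 1 r (comb 1 s w x) y) - f (comb 1 r w y)).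
  by rewrite RintegralB//; exact: lip_integrable.
rewrite e (le_trans (le_normr_Rintegral _ _))//.
  exact: (integrableB measurableT (lip_integrable _ r0 lf) (lip_integrable _ r0 lf)).
apply: (@le_trans _ _ (\int[P]_y (s * m x))); last first.
  by rewrite /Rintegral integral_probability_cst.
apply: le_Rintegral => //.
- exact: integrable_norm (integrableB measurableT (lip_integrable _ r0 lf) (lip_integrable _ r0 lf)).
- exact: (bmeas_integrable (probability_setTy P) (bmeas_cst _ _)).
- by move=> y _; rewrite combCA Lf.
Qed.

Lemma sqr_Rintegral_le (g : path -> R) : bmeas g ->
  (((\int[P]_x g x) ^+ 2)%:E <= \int[P]_x (g x ^+ 2)%:E)%E.
Proof.
move=> bg; have Pf := probability_setTy P.
set c := \int[P]_x g x.
have Ig := bmeas_integrable Pf bg.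
have Ig2 := bmeas_integrable Pf (bmeasM bg bg).
have Ec : (\int[P]_x (g x)%:E = c%:E)%E.
  by rewrite /c /Rintegral fineK//; exact: integrable_fin_num.
have : (0 <= \int[P]_x ((g x - c) ^+ 2)%:E)%E.
  by apply: integral_ge0 => x _; rewrite lee_fin sqr_ge0.
have -> : (\int[P]_x ((g x - c) ^+ 2)%:E =
    \int[P]_x ((g x * g x)%:E + ((- (2 * c)) * g x)%:E + (c ^+ 2)%:E))%E.
  by apply: eq_integral => x _; rewrite -!EFinD; congr EFin; ring.
have I2 : P.-integrable setT (fun x => ((- (2 * c)) * g x)%:E).
  by have := integrableZl measurableT (- (2 * c)) Ig.
have I3 : P.-integrable setT (fun x : path => (c ^+ 2)%:E).
  exact: (bmeas_integrable Pf (bmeas_cst _ _)).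
rewrite integralD//; last exact: integrableD.
rewrite integralD//.
rewrite (_ : \int[P]_x ((- (2 * c)) * g x)%:E = (- (2 * c) * c)%:E)%E; last first.
  by under eq_integral do rewrite EFinM; rewrite integralZl// Ec.
rewrite integral_probability_cst.
have -> : (\int[P]_x (g x ^+ 2)%:E = \int[P]_x (g x * g x)%:E)%E.
  by apply: eq_integral => x _; rewrite expr2.
have : (\int[P]_x (g x * g x)%:E \is a fin_num)%E by exact: integrable_fin_num Ig2.
case: (\int[P]_x (g x * g x)%:E)%E => // a _.
by rewrite -!EFinD !lee_fin; lra.
Qed.

Variables (s2 kappa : R).
Hypothesis kappa0 : 0 <= kappa.

(** The bound r^2 E m^2 that [lip] gives would bring in the second moment of the maximum; only a
    separate leading coefficient [s2] can be the largest variance. The slack kappa r^3 is harmless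
    in the iteration. *)
Definition vbound (f : path -> R) := forall w r, 0 <= r -> r <= 1 ->
  (\int[P]_x ((f (comb 1 r w x) - f w) ^+ 2)%:E <=
   (r ^+ 2 * s2 + kappa * r ^+ 3)%:E)%E.

(** Jensen's inequality puts the square under the average over y, and after Fubini [vbound] applies
    at each shifted base point. *)
Lemma vbound_avg f s : 0 <= s -> lip f -> vbound f -> vbound (avg f s).
Proof.
move=> s0 lf vf w r r0 r1; have [mf Lf] := lf.
have mH : measurable_fun setT (fun z : path * path =>
    ((f (comb 1 r (comb 1 s w z.2) z.1) - f (comb 1 s w z.2)) ^+ 2)%:E).
  apply/measurable_EFinP/measurable_funX/measurable_funB.
    apply: (measurableT_comp mf); apply: measurable_comb => //.
    exact: measurable_comb.
  by apply: (measurableT_comp mf); exact: measurable_comb.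
have H0 z : (0 <= ((f (comb 1 r (comb 1 s w z.2) z.1) - f (comb 1 s w z.2)) ^+ 2)%:E)%E.
  by rewrite lee_fin sqr_ge0.
have [ma _] := lip_avg s0 lf.
apply: (@le_trans _ _ (\int[P]_x \int[P]_y
    ((f (comb 1 r (comb 1 s w y) x) - f (comb 1 s w y)) ^+ 2)%:E)%E).
  apply: ge0_le_integral => //.
  - by move=> x _; rewrite lee_fin sqr_ge0.
  - apply/measurable_EFinP/measurable_funX/measurable_funB => //.
    exact: measurable_shift.
  - exact: (measurable_fun_fubini_tonelli_F (fun z : path * path =>
    ((f (comb 1 r (comb 1 s w z.2) z.1) - f (comb 1 s w z.2)) ^+ 2)%:E)).
  move=> x _.
  have -> : avg f s (comb 1 r w x) - avg f s w =
      \int[P]_y (f (comb 1 r (comb 1 s w y) x) - f (comb 1 s w y)).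
    rewrite /avg -RintegralB//; [|exact: lip_integrable..].
    by apply: eq_Rintegral => y _; rewrite combCA.
  apply: sqr_Rintegral_le; split.
    apply: measurable_funB; last exact: measurable_shift.
    apply: (measurableT_comp mf); apply: measurable_comb => //.
    exact: measurable_comb.
  by exists (r * m x) => y; exact: Lf.
rewrite (fubini_tonelli (fun z : path * path =>
    ((f (comb 1 r (comb 1 s w z.2) z.1) - f (comb 1 s w z.2)) ^+ 2)%:E))//=.
apply: (@le_trans _ _ (\int[P]_y (r ^+ 2 * s2 + kappa * r ^+ 3)%:E)%E); last first.
  by rewrite integral_probability_cst.
apply: ge0_le_integral => //.
- by move=> y _; apply: integral_ge0 => x _; exact: (H0 (x, y)).
- exact: (measurable_fun_fubini_tonelli_G (fun z : path * path =>
    ((f (comb 1 r (comb 1 s w z.2) z.1) - f (comb 1 s w z.2)) ^+ 2)%:E)).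
- by move=> y _; exact: vf.
Qed.

(** Semigroup property: (x + y) / sqrt 2 has the law of x. *)
Lemma avg_avg f r w : 0 <= r -> lip f ->
  avg (avg f (r * q)) (r * q) w = avg f r w.
Proof.
move=> r0 lf; have [mf _] := lf; have rq0 : 0 <= r * q by rewrite mulr_ge0// ltW.
have mF : measurable_fun setT (fun z : path * path => comb q q z.1 z.2).
  exact: measurable_comb.
have mfw : measurable_fun setT (fun x => (f (comb 1 r w x))%:E).
  by apply/measurable_EFinP; exact: measurable_shift.
rewrite {1}/avg {1}/Rintegral.
transitivity (fine (\int[P]_x \int[P]_y (f (comb 1 r w (comb q q x y)))%:E)%E).
  congr fine; apply: eq_integral => x _; rewrite -avgE//.
  by apply: eq_integral => y _; rewrite comb_comb.
congr fine.
rewrite -(integral_law mF stableP mfw).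
rewrite -(@integral12_prod_meas1 _ _ _ _ _ P P (fun z => (f (comb 1 r w (comb q q z.1 z.2)))%:E))//.
apply/integrableP; split; first exact: (measurableT_comp mfw mF).
rewrite (ge0_integral_law mF stableP (f := fun x => `|(f (comb 1 r w x))%:E|%E))//.
- by have /integrableP[] := lip_integrable w r0 lf.
- exact: measurableT_comp.
Qed.

Variable lam : R.

Let L := fine (\int[P]_w (expR ((1 + `|lam|) * m w))%:E).

(** Integrates the cubic Taylor bound of exp (lam (f (w + r x) - f w)) and closes with 1 + y <= exp
    y. The constant is chosen before f, because the iteration applies the bound to averages of f. *)
Lemma mgf_base : exists2 K, 0 <= K & forall f w r, 0 <= r -> r <= 1 ->
  lip f -> vbound f ->
  (\int[P]_x (expR (lam * f (comb 1 r w x)))%:E <=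
   (expR (lam * avg f r w + (lam ^+ 2 * s2 / 2 * r ^+ 2 + K * r ^+ 3)))%:E)%E.
Proof.
exists (lam ^+ 2 * kappa / 2 + 27 * `|lam| ^+ 3 * L).
  have L0 : 0 <= L.
    by apply: fine_ge0; apply: integral_ge0 => x _; rewrite lee_fin expR_ge0.
  apply: addr_ge0; first by rewrite divr_ge0// mulr_ge0// sqr_ge0.
  by apply: mulr_ge0 => //; apply: mulr_ge0 => //; exact: exprn_ge0.
move=> f w r r0 r1 lf vf; have [mf Lf] := lf.
pose u x := lam * (f (comb 1 r w x) - f w).
have mfx := measurable_shift r w mf.
have mu : measurable_fun setT u.
  by apply: measurable_funM => //; exact: measurable_funB.
have ub x : `|u x| <= `|lam| * (r * m x) by rewrite normrM ler_wpM2l// Lf.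
(* Combines |u x| <= |lam| r m x, m^3 <= 27 exp m, and r <= 1 inside the exponential. *)
pose c x := 27 * `|lam| ^+ 3 * r ^+ 3 * expR ((1 + `|lam|) * m x).
have up x : expR (u x) <= (1 + u x) + (lam ^+ 2 / 2 * (f (comb 1 r w x) - f w) ^+ 2 + c x).
  rewrite (le_trans (expR_le_cubic _))// -addrA; apply: lerD; first by [].
  apply: lerD; first by rewrite /u exprMn mulrAC.
  have h1 : `|u x| ^+ 3 <= `|lam| ^+ 3 * r ^+ 3 * m x ^+ 3.
    by rewrite -!exprMn -mulrA lerXn2r// nnegrE// !mulr_ge0.
  have h2 : expR `|u x| <= expR (`|lam| * m x).
    by rewrite ler_expR (le_trans (ub x))// ler_wpM2l// ler_piMl.
  apply: (le_trans (ler_pM _ (expR_ge0 _) h1 h2)); first by rewrite exprn_ge0.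
  have h3 := cubic_le_expR (m0 x).
  rewrite /c (_ : (1 + `|lam|) * m x = m x + `|lam| * m x); last by ring.
  have -> : 27 * `|lam| ^+ 3 * r ^+ 3 * expR (m x + `|lam| * m x) =
    `|lam| ^+ 3 * r ^+ 3 * (27 * expR (m x)) * expR (`|lam| * m x).
    by rewrite expRD; ring.
  rewrite ler_wpM2r ?expR_ge0// ler_wpM2l//.
  by rewrite mulr_ge0// exprn_ge0.
have If := lip_integrable w r0 lf.
have Ic : P.-integrable setT (EFin \o cst (f w)).
  exact: (bmeas_integrable (probability_setTy P) (bmeas_cst _ _)).
have I1 : P.-integrable setT (EFin \o cst 1).
  exact: (bmeas_integrable (probability_setTy P) (bmeas_cst _ _)).
have Iu : P.-integrable setT (EFin \o u).
  by have := integrableZl measurableT lam (integrableB measurableT If Ic).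
have Eu : (\int[P]_x (1 + u x)%:E = (1 + lam * (avg f r w - f w))%:E)%E.
  under eq_integral do rewrite EFinD.
  rewrite (integralD measurableT I1 Iu) integral_probability_cst.
  under eq_integral do rewrite /u /= EFinM.
  rewrite (integralZl measurableT (integrableB measurableT If Ic)).
  by rewrite (integralB measurableT If Ic) avgE// integral_probability_cst.
have IA : P.-integrable setT (EFin \o (fun x => lam ^+ 2 / 2 * (f (comb 1 r w x) - f w) ^+ 2)).
  have I2 : P.-integrable setT (EFin \o (fun x => (f (comb 1 r w x) - f w) ^+ 2)).
    apply/integrableP; split.
      by apply/measurable_EFinP/measurable_funX; exact: measurable_funB.
    under eq_integral do rewrite /= ger0_norm ?sqr_ge0//.
    by rewrite (le_lt_trans (vf w r r0 r1))// ltry.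
  by have := integrableZl measurableT (lam ^+ 2 / 2) I2.
have EA : (\int[P]_x (lam ^+ 2 / 2 * (f (comb 1 r w x) - f w) ^+ 2)%:E <=
    (lam ^+ 2 / 2 * (r ^+ 2 * s2 + kappa * r ^+ 3))%:E)%E.
  under eq_integral do rewrite EFinM.
  rewrite ge0_integralZl//; last 3 first.
  - by apply/measurable_EFinP/measurable_funX; exact: measurable_funB.
  - by move=> x _; rewrite lee_fin sqr_ge0.
  - by rewrite lee_fin divr_ge0// sqr_ge0.
  by rewrite [leRHS]EFinM lee_wpmul2l ?vf// lee_fin divr_ge0// sqr_ge0.
have IE := integrable_expm (1 + `|lam|).
have Icc : P.-integrable setT (EFin \o c).
  by have := integrableZl measurableT (27 * `|lam| ^+ 3 * r ^+ 3) IE.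
have Ecc : (\int[P]_x (c x)%:E = (27 * `|lam| ^+ 3 * r ^+ 3 * L)%:E)%E.
  under eq_integral do rewrite EFinM.
  rewrite (integralZl measurableT IE) [RHS]EFinM /L fineK//.
  exact: integrable_fin_num IE.
have IAc := integrableD measurableT IA Icc.
have I1u := integrableD measurableT I1 Iu.
have main : (\int[P]_x (expR (u x))%:E <= (1 + (lam * (avg f r w - f w) +
    (lam ^+ 2 * s2 / 2 * r ^+ 2 + (lam ^+ 2 * kappa / 2 + 27 * `|lam| ^+ 3 * L) * r ^+ 3)))%:E)%E.
  apply: (@le_trans _ _ (\int[P]_x ((1 + u x)%:E + ((lam ^+ 2 / 2 * (f (comb 1 r w x) - f w) ^+ 2)%:E + (c x)%:E)))%E).
    apply: ge0_le_integral => //.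
    - by apply/measurable_EFinP; exact: measurableT_comp.
    - by have /integrableP[] := integrableD measurableT I1u IAc.
    - by move=> x _; rewrite -!EFinD lee_fin; exact: up.
  rewrite (integralD measurableT I1u IAc) (integralD measurableT IA Icc) Eu Ecc.
  apply: (@le_trans _ _ ((1 + lam * (avg f r w - f w))%:E +
    ((lam ^+ 2 / 2 * (r ^+ 2 * s2 + kappa * r ^+ 3))%:E + (27 * `|lam| ^+ 3 * r ^+ 3 * L)%:E))%E).
    by rewrite leeD2l// leeD2r.
  by rewrite -!EFinD lee_fin le_eqVlt; apply/orP; left; apply/eqP; field.
have -> : (\int[P]_x (expR (lam * f (comb 1 r w x)))%:E =
    \int[P]_x ((expR (lam * f w))%:E * (expR (u x))%:E))%E.
  apply: eq_integral => x _; rewrite -EFinM -expRD /u; congr (expR _)%:E; ring.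
rewrite ge0_integralZl; [|by []| |by move=> x _; rewrite lee_fin expR_ge0|by rewrite lee_fin expR_ge0]; last first.
  by apply/measurable_EFinP; exact: measurableT_comp.
apply: (@le_trans _ _ ((expR (lam * f w))%:E * (1 + (lam * (avg f r w - f w) +
    (lam ^+ 2 * s2 / 2 * r ^+ 2 + (lam ^+ 2 * kappa / 2 + 27 * `|lam| ^+ 3 * L) * r ^+ 3)))%:E)%E).
  by rewrite lee_wpmul2l// lee_fin expR_ge0.
rewrite -EFinM lee_fin (le_trans (ler_wpM2l (expR_ge0 _) (expR_ge1Dx _)))//.
by rewrite -expRD ler_expR le_eqVlt; apply/orP; left; apply/eqP; ring.
Qed.

(* The doubling step replaces f by its average over one half of the noise, to
   which the induction hypothesis applies at scale r q; the quadratic terms are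
   additive because q^2 = 1 / 2 while the cubic one gains a factor q. *)
Lemma mgf_iter : exists K, forall k f w r, 0 <= r -> r <= 1 ->
  lip f -> vbound f ->
  (\int[P]_x (expR (lam * f (comb 1 r w x)))%:E <=
   (expR (lam * avg f r w + (lam ^+ 2 * s2 / 2 * r ^+ 2 + K * r ^+ 3 * q ^+ k)))%:E)%E.
Proof.
have [K K0 base] := mgf_base; exists K; elim => [|k IHk] f w r r0 r1 lf vf.
  by rewrite expr0 mulr1; exact: base.
have [mf Lf] := lf.
have rq0 : 0 <= r * q by rewrite mulr_ge0// ltW.
have rq1 : r * q <= 1 by rewrite mulr_ile1// ltW.
have mF : measurable_fun setT (fun z : path * path => comb q q z.1 z.2).
  exact: measurable_comb.
have mE : measurable_fun setT (fun x => (expR (lam * f (comb 1 r w x)))%:E).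
  apply/measurable_EFinP; apply: measurableT_comp => //.
  by apply: measurable_funM => //; exact: measurable_shift.
have E0 x : (0 <= (expR (lam * f (comb 1 r w x)))%:E)%E by rewrite lee_fin expR_ge0.
set cst := lam ^+ 2 * s2 / 2 * (r * q) ^+ 2 + K * (r * q) ^+ 3 * q ^+ k.
have lf' := lip_avg rq0 lf.
have vf' := vbound_avg rq0 lf vf.
have mA : measurable_fun setT (fun x => expR (lam * avg f (r * q) (comb 1 (r * q) w x))).
  apply: measurableT_comp => //; apply: measurable_funM => //.
  by apply: measurable_shift; case: lf'.
rewrite -(ge0_integral_law mF stableP mE E0).
rewrite (fubini_tonelli1 (fun z => (expR (lam * f (comb 1 r w (comb q q z.1 z.2))))%:E)); last 2 first.
- exact: (measurableT_comp mE mF).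
- by move=> z; exact: E0.
apply: (@le_trans _ _ (\int[P]_x ((expR cst)%:E * (expR (lam * avg f (r * q) (comb 1 (r * q) w x)))%:E))%E).
  apply: ge0_le_integral => //.
  - by move=> x _; apply: integral_ge0 => y _; rewrite lee_fin expR_ge0.
  - apply: (measurable_fun_fubini_tonelli_F (fun z => (expR (lam * f (comb 1 r w (comb q q z.1 z.2))))%:E)).
      exact: (measurableT_comp mE mF).
    by move=> z; exact: E0.
  - by apply: measurable_funeM; exact/measurable_EFinP.
  move=> x _; rewrite /fubini_F/=; under eq_integral do rewrite comb_comb.
  by rewrite -EFinM -expRD addrC; exact: IHk.
rewrite ge0_integralZl; [|by []| |by move=> x _; rewrite lee_fin expR_ge0|by rewrite lee_fin expR_ge0]; last first.
  exact/measurable_EFinP.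
have h := IHk _ w (r * q) rq0 rq1 lf' vf'.
apply: (le_trans (lee_wpmul2l _ h)); first by rewrite lee_fin expR_ge0.
rewrite -EFinM -expRD lee_fin ler_expR avg_avg// le_eqVlt; apply/orP; left; apply/eqP.
have q3 : q ^+ 3 = q * 2^-1 by rewrite exprS q2.
by rewrite /cst (exprS q k) !(exprMn _ r) q2 q3; field.
Qed.

(** At w = 0 and r = 1 the remainder is K q^k, and q < 1. *)
Lemma lip_concentration f : lip f -> vbound f ->
  (\int[P]_x (expR (lam * f x))%:E <=
   (expR (lam * \int[P]_x f x + lam ^+ 2 * s2 / 2))%:E)%E.
Proof.
move=> lf vf; have [K h] := mgf_iter.
have q1' : q < 1.
  by rewrite -(@ltr_pXn2r _ 2)// ?nnegrE ?ltW// q2 expr1n; lra.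
have -> : \int[P]_x f x = avg f 1 path0.
  by apply: eq_Rintegral => x _; rewrite comb1_path0.
have -> : (\int[P]_x (expR (lam * f x))%:E =
    \int[P]_x (expR (lam * f (comb 1 1 path0 x)))%:E)%E.
  by apply: eq_integral => x _; rewrite comb1_path0.
set a := lam * _; set b := lam ^+ 2 * _ / 2.
have cK : (fun k => a + (b * 1 ^+ 2 + K * 1 ^+ 3 * q ^+ k)) @ \oo --> a + (b * 1 ^+ 2 + K * 1 ^+ 3 * 0).
  apply: cvgD; first exact: cvg_cst.
  apply: cvgD; first exact: cvg_cst.
  apply: cvgM; first exact: cvg_cst.
  by apply: cvg_expr; rewrite gtr0_norm.
rewrite !expr1n !mulr1 mulr0 addr0 in cK.
have {}cK : (fun k => (expR (a + (b + K * q ^+ k)))%:E) @ \oo --> (expR (a + b))%:E.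
  apply: cvg_EFin; first exact: nearW.
  by apply: (@cvg_comp _ _ _ _ expR _ _ _ cK); exact: continuous_expR.
rewrite -(cvg_lim _ cK)//; apply: lime_ge; first by apply/cvg_ex; eexists; exact: cK.
apply: nearW => k; have := h k f path0 1 ler01 (lexx 1) lf vf.
by rewrite !expr1n !mulr1.
Qed.

End concentration.

(** * Increments of log-sum-exp *)

Section log_sum_exp.
Context {R : realType} (n : nat) (beta : R).
Hypothesis beta0 : 0 < beta.
Implicit Types v d : nat -> R.

Let bn0 : beta != 0. Proof. by rewrite gt_eqF. Qed.

(* The extra 1 makes [lse] approximate the maximum of 0 and the [v i]. *)
Definition sumexp v : R := 1 + \sum_(i < n) expR (beta * v i).

Definition lse v : R := beta^-1 * ln (sumexp v).

Lemma sumexp_gt0 v : 0 < sumexp v.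
Proof. by rewrite ltr_pwDl// sumr_ge0// => i _; exact: expR_ge0. Qed.

Lemma le_lse v (c : R) : 0 <= c -> (forall i : 'I_n, v i <= c) ->
  lse v <= c + beta^-1 * ln n.+1%:R.
Proof.
move=> c0 vc; rewrite /lse -(mulKf bn0 c) -mulrDr ler_pM2l ?invr_gt0//.
rewrite -[X in X + _]expRK -lnM ?posrE ?expR_gt0//.
rewrite ler_ln ?posrE ?sumexp_gt0 ?mulr_gt0 ?expR_gt0//.
rewrite /sumexp -natr1 mulrDr mulr1 addrC lerD//.
  rewrite mulr_natr -[X in _ *+ X]card_ord -sumr_const.
  by apply: ler_sum => i _; rewrite ler_expR ler_pM2l.
by rewrite -expR0 ler_expR mulr_ge0// ltW.
Qed.

Lemma lse_ge0 v : 0 <= lse v.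
Proof.
rewrite mulr_ge0 ?invr_ge0 ?(ltW beta0)// ln_ge0// lerDl.
by rewrite sumr_ge0// => i _; exact: expR_ge0.
Qed.

Lemma lse_ge v (i : 'I_n) : v i <= lse v.
Proof.
rewrite /lse -[leLHS](mulKf bn0) ler_pM2l ?invr_gt0//.
rewrite -[leLHS]expRK ler_ln ?posrE ?expR_gt0 ?sumexp_gt0//.
by rewrite /sumexp (bigD1 i)//= addrCA lerDl addr_ge0// sumr_ge0.
Qed.

Variables (v d : nat -> R) (M : R).
Hypothesis M0 : 0 <= M.
Hypothesis dM : forall i : 'I_n, `|d i| <= M.

(** The a i / Z are Gibbs weights, whose missing mass 1 / Z belongs to the extra value 0. [Lm] is
    the derivative of [lse] at [v] along [d], [u] the true increment, and [A] the ratio of partition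
    functions. *)
Let a i := expR (beta * v i).
Let Z := sumexp v.
Let A := sumexp (fun i => v i + d i) / Z.
Let Lm := (\sum_(i < n) a i * d i) / Z.
Let u := lse (fun i => v i + d i) - lse v.

Let Z0 : 0 < Z. Proof. exact: sumexp_gt0. Qed.
Let A0 : 0 < A. Proof. by rewrite divr_gt0 ?sumexp_gt0. Qed.
Let a0 i : 0 <= a i. Proof. exact: expR_ge0. Qed.
Let ZE : Z = 1 + \sum_(i < n) a i. Proof. by []. Qed.

Let AZ : A * Z = 1 + \sum_(i < n) a i * expR (beta * d i).
Proof.
rewrite mulfVK ?gt_eqF//; congr (_ + _); apply: eq_bigr => i _.
by rewrite mulrDr expRD.
Qed.

Let LZ : Lm * Z = \sum_(i < n) a i * d i.
Proof. by rewrite mulfVK// gt_eqF. Qed.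

Let uE : beta * u = ln A.
Proof.
rewrite /u /lse -mulrBr mulVKf ?gt_eqF// -ln_div ?posrE ?sumexp_gt0//.
Qed.

Let d_le (i : 'I_n) : d i <= M. Proof. exact: le_trans (ler_norm _) (dM i). Qed.
Let d_ge (i : 'I_n) : - M <= d i.
Proof. by rewrite lerNl (le_trans (ler_norm _))// normrN. Qed.

(** Convexity of [lse]: each exp (beta d_i) lies above the tangent at [Lm], and so does the extra
    term, whose increment is 0. *)
Let mean_le : Lm <= u.
Proof.
rewrite -(ler_pM2l beta0) uE -[leLHS]expRK ler_ln ?posrE ?expR_gt0//.
rewrite -(ler_pM2r Z0) AZ.
have e i : expR (beta * Lm) * (1 + beta * (d i - Lm)) <= expR (beta * d i).
  have -> : beta * d i = beta * Lm + beta * (d i - Lm) by ring.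
  by rewrite expRD ler_wpM2l ?expR_ge0// expR_ge1Dx.
have e0 : expR (beta * Lm) * (1 - beta * Lm) <= 1.
  rewrite -[leRHS](expRxMexpNx_1 (beta * Lm)) ler_wpM2l ?expR_ge0//.
  exact: expR_ge1Dx.
apply: (@le_trans _ _ (expR (beta * Lm) * (1 - beta * Lm) +
    \sum_(i < n) a i * (expR (beta * Lm) * (1 + beta * (d i - Lm))))).
  rewrite [X in _ <= _ + X](_ : _ = expR (beta * Lm) *
    ((1 - beta * Lm) * (\sum_(i < n) a i) + beta * (Lm * Z))).
    rewrite -mulrDr ler_wpM2l ?expR_ge0// ZE; lra.
  rewrite LZ !mulr_sumr -big_split/= mulr_sumr; apply: eq_bigr => i _; ring.
by apply: lerD => //; apply: ler_sum => i _; rewrite ler_wpM2l.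
Qed.

(** The converse up to second order, from ln A <= A - 1 and exp y <= 1 + y + y^2 exp |y|. *)
Let mean_ge : u <= Lm + beta * M ^+ 2 * expR (beta * M).
Proof.
rewrite -(ler_pM2l beta0) uE.
apply: (@le_trans _ _ (A - 1)).
  by have := expR_ge1Dx (ln A); rewrite lnK ?posrE//; lra.
rewrite -(ler_pM2r Z0) mulrBl AZ mul1r ZE opprD addrACA subrr add0r -sumrB.
apply: (@le_trans _ _ (\sum_(i < n) (beta * (a i * d i) + a i * (beta ^+ 2 * M ^+ 2 * expR (beta * M))))).
  apply: ler_sum => i _.
  have := expR_quad_upper (beta * d i).
  have : (beta * d i) ^+ 2 * expR `|beta * d i| <= beta ^+ 2 * M ^+ 2 * expR (beta * M).
    rewrite exprMn; apply: ler_pM; [|exact: expR_ge0| |].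
    - by rewrite -exprMn sqr_ge0.
    - by rewrite ler_wpM2l ?sqr_ge0// -(real_normK (num_real (d i))) lerXn2r ?nnegrE.
    - by rewrite ler_expR normrM gtr0_norm// ler_pM2l.
  move=> h1 h2; have h3 : expR (beta * d i) <= 1 + beta * d i + beta ^+ 2 * M ^+ 2 * expR (beta * M) by lra.
  by have := ler_wpM2l (a0 i) h3; lra.
rewrite big_split/= -mulr_sumr -mulr_suml -LZ ZE; set S := \sum_(i < n) a i.
rewrite -subr_ge0 (_ : _ - _ = beta ^+ 2 * M ^+ 2 * expR (beta * M)); last by ring.
by rewrite mulr_ge0 ?expR_ge0// mulr_ge0 ?sqr_ge0.
Qed.

Lemma lse_lip : `|u| <= M.
Proof.
have bM : 0 <= beta * M by rewrite mulr_ge0// ltW.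
rewrite ler_norml; apply/andP; split; rewrite -(ler_pM2l beta0) uE.
  rewrite -[leLHS]expRK ler_ln ?posrE ?expR_gt0// -(ler_pM2r Z0) AZ ZE mulrDr mulr1.
  rewrite mulr_sumr lerD//; first by rewrite mulrN -expR0 ler_expR oppr_le0.
  by apply: ler_sum => i _; rewrite mulrC ler_wpM2l// ler_expR ler_pM2l.
rewrite -[leRHS]expRK ler_ln ?posrE ?expR_gt0// -(ler_pM2r Z0) AZ ZE mulrDr mulr1.
rewrite mulr_sumr lerD//; first by rewrite -expR0 ler_expR.
by apply: ler_sum => i _; rewrite [leRHS]mulrC ler_wpM2l// ler_expR ler_pM2l.
Qed.

Let mean_norm : `|Lm| <= M.
Proof.
rewrite -(ler_pM2r Z0) -{1}(gtr0_norm Z0) -normrM LZ.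
rewrite (le_trans (ler_norm_sum _ _ _))//.
apply: (@le_trans _ _ (\sum_(i < n) a i * M)).
  by apply: ler_sum => i _; rewrite normrM (ger0_norm (a0 i)) ler_wpM2l.
by rewrite -mulr_suml mulrC ler_wpM2l// ZE lerDr.
Qed.

(** u^2 - Lm^2 is at most 2 M (u - Lm), and Lm^2 is at most the weighted mean of the d_i^2 by
    Cauchy-Schwarz, the weights having total at most 1. In expectation each d_i^2 contributes a
    single variance: this is where the largest variance comes in. *)
Lemma lse_sqr : u ^+ 2 <= (\sum_(i < n) expR (beta * v i) / sumexp v * d i ^+ 2) +
  2 * beta * M ^+ 3 * expR (beta * M).
Proof.
have h1 : u ^+ 2 <= Lm ^+ 2 + 2 * M * (beta * M ^+ 2 * expR (beta * M)).
  have := mean_le; have := mean_ge; have := lse_lip; have := mean_norm.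
  rewrite !ler_norml; move: (beta * _ * _) Lm u => e l w.
  by move=> /andP[? ?] /andP[? ?] ? ?; nra.
have h2 : Lm ^+ 2 <= \sum_(i < n) expR (beta * v i) / sumexp v * d i ^+ 2.
  have h3 : 0 <= \sum_(i < n) a i * (d i - Lm) ^+ 2.
    by apply: sumr_ge0 => i _; rewrite mulr_ge0// sqr_ge0.
  rewrite -(ler_pM2r Z0) mulr_suml.
  rewrite [leRHS](_ : _ = \sum_(i < n) a i * d i ^+ 2); last first.
    by apply: eq_bigr => i _; rewrite mulrAC mulfVK// gt_eqF.
  have : \sum_(i < n) a i * (d i - Lm) ^+ 2 =
     \sum_(i < n) a i * d i ^+ 2 - 2 * Lm * (Lm * Z) + Lm ^+ 2 * (Z - 1).
    rewrite LZ ZE (addrC 1) addrK !mulr_sumr -sumrB -big_split/=.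
    by apply: eq_bigr => i _; ring.
  by have := sqr_ge0 Lm; lra.
rewrite (le_trans h1)// lerD// le_eqVlt; apply/orP; left; apply/eqP; ring.
Qed.

End log_sum_exp.

Lemma measurable_bigmax d (T : measurableType d) {R : realType}
    (f : nat -> T -> R) n : (forall i, measurable_fun setT (f i)) ->
  measurable_fun setT (fun w => \big[Num.max/0]_(i < n) f i w).
Proof.
elim: n f => [|n IHn] f mf.
  by under eq_fun do rewrite big_ord0; exact: measurable_cst.
under eq_fun do rewrite big_ord_recl/=.
by apply: measurable_maxr => //; apply: (IHn (f \o succn)) => i; exact: mf.
Qed.

(** * Concentration of finite maxima *)

Section maximum_concentration.
Context {R : realType} (P : probability (skorokhod R) R).
Local Notation path := (skorokhod R).
Hypothesis gaussP : gaussian_process P.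
Hypothesis mean0 : forall s : unit_interval R,
  ('E_P[fun w : path => w s])%E = 0%E.
Variables (s : nat -> unit_interval R) (n : nat).

(** Size of the noise on the chosen times, in the role of [m] above; the maximum of interest is
    [posmax]. *)
Definition absmax (w : path) : R := \big[Num.max/0]_(i < n) `|w (s i)|.

Definition posmax (w : path) : R := \big[Num.max/0]_(i < n) w (s i).

Lemma measurable_absmax : measurable_fun setT absmax.
Proof.
have h i : measurable_fun setT (fun w : path => `|w (s i)|).
  by apply: measurableT_comp => //; exact: measurable_coord.
exact: (measurable_bigmax n h).
Qed.

Lemma measurable_posmax : measurable_fun setT posmax.
Proof.
exact: (measurable_bigmax n (fun i => measurable_coord (s i))).
Qed.

Lemma absmax_ge0 w : 0 <= absmax w.
Proof. exact: bigmax_ge_id. Qed.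

Lemma posmax_ge0 w : 0 <= posmax w.
Proof. exact: bigmax_ge_id. Qed.

Lemma posmax_le_absmax w : posmax w <= absmax w.
Proof.
apply: bigmax_le => [|i _]; first exact: absmax_ge0.
by rewrite (le_trans (ler_norm _))// (le_bigmax _ (fun i : 'I_n => `|w (s i)|)).
Qed.

Lemma expR_coord_lty (t : unit_interval R) (K : R) :
  (\int[P]_w (expR (K * `|w t|))%:E < +oo)%E.
Proof.
have := gaussian_expR (measurable_linform [:: (1, t)]) K
  (gaussian_linform gaussP [:: (1, t)]).
by under eq_integral do rewrite linform1 mul1r.
Qed.

Lemma expR_absmax_lty (K : R) : (\int[P]_w (expR (K * absmax w))%:E < +oo)%E.
Proof.
have mE (k : R) i : measurable_fun setT (fun w : path => (expR (k * `|w (s i)|))%:E).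
  apply/measurable_EFinP; apply: measurableT_comp => //; apply: measurable_funM => //.
  by apply: measurableT_comp => //; exact: measurable_coord.
have E0 k i (w : path) : (0 <= (expR (k * `|w (s i)|))%:E)%E by rewrite lee_fin expR_ge0.
(* The exponential of a maximum is at most the sum of the exponentials; the 1 covers the base value
   0. *)
apply: (@le_lt_trans _ _ (\int[P]_w (1%:E + \sum_(i < n) (expR (`|K| * `|w (s i)|))%:E))%E).
  apply: ge0_le_integral => //.
  - apply/measurable_EFinP; apply: measurableT_comp => //; apply: measurable_funM => //.
    exact: measurable_absmax.
  - apply: emeasurable_funD => //; apply: emeasurable_sum => i; exact: mE.
  move=> w _; rewrite sumEFin -EFinD lee_fin.
  apply: (@le_trans _ _ (expR (`|K| * absmax w))).
    by rewrite ler_expR ler_wpM2r ?ler_norm// absmax_ge0.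
  rewrite /absmax; elim/big_ind : _ => [|x y hx hy|i _].
  - by rewrite mulr0 expR0 lerDl sumr_ge0.
  - by rewrite /Num.max; case: ifP.
  - by rewrite (bigD1 i)//= addrCA lerDl addr_ge0// sumr_ge0.
rewrite ge0_integralD; [|by []|by []|by []
  |by move=> w _; apply: sume_ge0 => i _; exact: E0
  |by apply: emeasurable_sum => i; exact: mE].
rewrite integral_probability_cst ge0_integral_sum//.
rewrite lte_add_pinfty// ?ltry// lte_sum_pinfty// => i _.
exact: expR_coord_lty.
Qed.

Variable s2 : R.
Hypothesis s20 : 0 <= s2.
Hypothesis var : forall i : 'I_n, (\int[P]_w (w (s i) ^+ 2)%:E <= s2%:E)%E.

Section soft_maximum.
Variable beta : R.
Hypothesis beta0 : 0 < beta.

Let F (w : path) : R := lse n beta (fun i => w (s i)).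

Let combE r (w x : path) : F (comb 1 r w x) =
  lse n beta (fun i => w (s i) + r * x (s i)).
Proof. by congr lse; apply/funext => i /=; rewrite mul1r. Qed.

Let shift_le r (x : path) (i : 'I_n) : 0 <= r -> `|r * x (s i)| <= r * absmax x.
Proof.
move=> r0; rewrite normrM ger0_norm// ler_wpM2l//.
exact: (le_bigmax _ (fun i : 'I_n => `|x (s i)|)).
Qed.

Let mF : measurable_fun setT F.
Proof.
apply: measurable_funM => //; apply: (measurableT_comp (@measurable_ln R)).
apply: measurable_funD => //; apply: measurable_sum => i.
by apply: measurableT_comp => //; apply: measurable_funM => //; exact: measurable_coord.
Qed.

Lemma lip_soft : lip absmax F.
Proof.
split=> // w x r r0; rewrite combE.
apply: lse_lip => //; first by rewrite mulr_ge0// absmax_ge0.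
by move=> i; exact: shift_le.
Qed.

Let L := fine (\int[P]_w (expR ((1 + beta) * absmax w))%:E).

(** This is [lse_sqr] with d_i = r x (s i) and M = r [absmax x]. Weights of total at most 1 turn the
    variances into [s2]; in 54 = 2 * 27, the 27 bounds the cube of [absmax] by an exponential. *)
Lemma vbound_soft : vbound P s2 (54 * beta * L) F.
Proof.
move=> w r r0 r1; have b0 := ltW beta0.
pose p i := expR (beta * w (s i)) / sumexp n beta (fun i => w (s i)).
have Z0 := sumexp_gt0 n beta (fun i => w (s i)).
have p0 i : 0 <= p i by rewrite divr_ge0 ?expR_ge0// ltW.
have p1 : \sum_(i < n) p i <= 1.
  by rewrite -mulr_suml ler_pdivrMr// mul1r /sumexp lerDr.
have mE : measurable_fun setT (fun x => (expR ((1 + beta) * absmax x))%:E).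
  apply/measurable_EFinP; apply: measurableT_comp => //.
  by apply: measurable_funM => //; exact: measurable_absmax.
have m2 i : measurable_fun setT (fun x : path => ((x (s i)) ^+ 2)%:E).
  by apply/measurable_EFinP/measurable_funX; exact: measurable_coord.
apply: (@le_trans _ _ (\int[P]_x (\sum_(i < n) ((r ^+ 2 * p i)%:E * (x (s i) ^+ 2)%:E) +
   (54 * beta * r ^+ 3)%:E * (expR ((1 + beta) * absmax x))%:E))%E).
  apply: ge0_le_integral => //.
  - by move=> x _; rewrite lee_fin sqr_ge0.
  - apply/measurable_EFinP/measurable_funX/measurable_funB => //.
    exact: (measurable_shift r w mF).
  - apply: emeasurable_funD; last exact: measurable_funeM.
    by apply: emeasurable_sum => i; exact: measurable_funeM.
  move=> x _.
  under eq_bigr do rewrite -EFinM.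
  rewrite sumEFin -EFinM -EFinD lee_fin combE.
  have rm0 : 0 <= r * absmax x by rewrite mulr_ge0// absmax_ge0.
  have h := @lse_sqr _ n beta beta0 (fun i => w (s i)) (fun i => r * x (s i)) _
    rm0 (fun i => shift_le x i r0).
  rewrite (le_trans h)//; apply: lerD.
    by apply: ler_sum => i _; rewrite exprMn mulrA (mulrC (r ^+ 2)).
  have c1 := cubic_le_expR (absmax_ge0 x).
  have c2 : expR (beta * (r * absmax x)) <= expR (beta * absmax x).
    by rewrite ler_expR ler_wpM2l// ler_piMl// absmax_ge0.
  have -> : (1 + beta) * absmax x = absmax x + beta * absmax x by ring.
  rewrite expRD exprMn.
  have -> : 54 * beta * r ^+ 3 * (expR (absmax x) * expR (beta * absmax x)) =
    2 * beta * (r ^+ 3 * (27 * expR (absmax x))) * expR (beta * absmax x) by ring.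
  apply: ler_pM => //.
  - apply: mulr_ge0; first exact: mulr_ge0.
    by apply: mulr_ge0; apply: exprn_ge0 => //; exact: absmax_ge0.
  - apply: ler_wpM2l; first exact: mulr_ge0.
    by apply: ler_wpM2l c1; exact: exprn_ge0.
have b3 : (0 <= (54 * beta * r ^+ 3)%:E)%E.
  by rewrite lee_fin mulr_ge0 ?exprn_ge0// mulr_ge0.
have mS i : measurable_fun setT (fun x : path => (r ^+ 2 * p i)%:E * (x (s i) ^+ 2)%:E)%E.
  exact: measurable_funeM.
have S0 i (x : path) : (0 <= (r ^+ 2 * p i)%:E * (x (s i) ^+ 2)%:E)%E.
  by rewrite -EFinM lee_fin mulr_ge0 ?sqr_ge0// mulr_ge0 ?sqr_ge0.
rewrite ge0_integralD; [|by []|by move=> x _; apply: sume_ge0 => i _; exact: S0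
  |by apply: emeasurable_sum => i; exact: mS
  |by move=> x _; rewrite mule_ge0// lee_fin expR_ge0|exact: measurable_funeM].
rewrite ge0_integral_sum; [|by []|by move=> i; exact: mS|by move=> i x _; exact: S0].
rewrite EFinD; apply: leeD.
  apply: (@le_trans _ _ (\sum_(i < n) (r ^+ 2 * p i * s2)%:E)%E).
    apply: lee_sum => i _; rewrite ge0_integralZl; [|by []|exact: m2
      |by move=> x _; rewrite lee_fin sqr_ge0
      |by rewrite lee_fin mulr_ge0// sqr_ge0].
    by rewrite [leRHS]EFinM lee_wpmul2l// lee_fin mulr_ge0// sqr_ge0.
  rewrite sumEFin lee_fin -mulr_suml ler_wpM2r// -mulr_sumr ler_piMr//.
  exact: sqr_ge0.
rewrite ge0_integralZl; [|by []|exact: mE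
  |by move=> x _; rewrite lee_fin expR_ge0|exact: b3].
rewrite (_ : (\int[P]_x (expR ((1 + beta) * absmax x))%:E)%E = L%:E); last first.
  rewrite /L fineK// ge0_fin_numE; first exact: expR_absmax_lty.
  by apply: integral_ge0 => x _; rewrite lee_fin expR_ge0.
by rewrite -EFinM lee_fin le_eqVlt; apply/orP; left; apply/eqP; ring.
Qed.

End soft_maximum.

Lemma posmax_integrable : P.-integrable setT (EFin \o posmax).
Proof.
apply: (le_expm_integrable measurable_absmax expR_absmax_lty (C := 1) (K := 1)).
  exact: measurable_posmax.
move=> w; rewrite ger0_norm ?posmax_ge0// (le_trans (posmax_le_absmax w))//.
by rewrite !mul1r (le_trans _ (expR_ge1Dx _))// lerDr.
Qed.

(** The soft maximum with beta = k + 1 is within ln (n + 1) / (k + 1) of [posmax]; this is paid once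
    in the exponent and once in the mean, hence the factor 2. The slack of [vbound_soft] depends on
    beta but is absent from the concentration bound, so k may tend to infinity. *)
Lemma posmax_concentration (lam : R) :
  (\int[P]_w (expR (lam * posmax w))%:E <=
   (expR (lam * \int[P]_w posmax w + lam ^+ 2 * s2 / 2))%:E)%E.
Proof.
have main (k : nat) : (\int[P]_w (expR (lam * posmax w))%:E <=
   (expR (lam * \int[P]_w posmax w + lam ^+ 2 * s2 / 2 +
     2 * `|lam| * (k.+1%:R^-1 * ln n.+1%:R)))%:E)%E.
  set e := _^-1 * _; have k0 : (0 : R) < k.+1%:R by [].
  pose F (w : path) : R := lse n k.+1%:R (fun i => w (s i)).
  have lF := lip_soft k0; have vF := vbound_soft k0.
  have [mF _] := lF.
  have K0 : 0 <= 54 * k.+1%:R * fine (\int[P]_w (expR ((1 + k.+1%:R) * absmax w))%:E) :> R.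
    apply: mulr_ge0; first exact: mulr_ge0.
    by apply: fine_ge0; apply: integral_ge0 => w _; rewrite lee_fin expR_ge0.
  have conc := lip_concentration (path_law_stable gaussP mean0)
    measurable_absmax absmax_ge0 expR_absmax_lty K0 lam lF vF.
  have F1 w : posmax w <= F w.
    apply: bigmax_le => [|i _]; first exact: lse_ge0.
    exact: (lse_ge k0 (fun i => w (s i))).
  have F2 w : F w <= posmax w + e.
    apply: le_lse => //; first exact: posmax_ge0.
    by move=> i; exact: (le_bigmax _ (fun i : 'I_n => w (s i))).
  have FP w : `|posmax w - F w| <= e.
    by rewrite distrC ger0_norm ?subr_ge0// lerBlDl.
  have lFP w : lam * posmax w <= lam * F w + `|lam| * e.
    rewrite -lerBlDl -mulrBr (le_trans (ler_norm _))// normrM ler_wpM2l//.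
  have IF : P.-integrable setT (EFin \o F).
    have := lip_integrable measurable_absmax absmax_ge0 expR_absmax_lty path0 ler01 lF.
    congr (_.-integrable setT _); apply/funext => w.
    exact: (congr1 (fun z => (F z)%:E) (comb1_path0 w)).
  have IP := posmax_integrable.
  have EF : lam * (\int[P]_x F x) <= lam * (\int[P]_w posmax w) + `|lam| * e.
    rewrite -lerBlDl -mulrBr -RintegralB// (le_trans (ler_norm _))// normrM.
    rewrite ler_wpM2l// (le_trans (le_normr_Rintegral _ _))//.
      exact: (integrableB measurableT IF IP).
    apply: (@le_trans _ _ (\int[P]_w e)); last first.
      by rewrite /Rintegral integral_probability_cst.
    apply: le_Rintegral => //.
    - exact: (integrable_norm (integrableB measurableT IF IP)).
    - exact: (bmeas_integrable (probability_setTy P) (bmeas_cst _ _)).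
    - by move=> w _; rewrite distrC.
  apply: (@le_trans _ _ (\int[P]_w ((expR (`|lam| * e))%:E * (expR (lam * F w))%:E))%E).
    apply: ge0_le_integral => //.
    - apply/measurable_EFinP; apply: measurableT_comp => //.
      by apply: measurable_funM => //; exact: measurable_posmax.
    - apply: measurable_funeM; apply/measurable_EFinP; apply: measurableT_comp => //.
      exact: measurable_funM.
    - by move=> w _; rewrite -EFinM -expRD lee_fin ler_expR addrC.
  rewrite ge0_integralZl; [|by []| |by move=> x _; rewrite lee_fin expR_ge0|by rewrite lee_fin expR_ge0]; last first.
    by apply/measurable_EFinP; apply: measurableT_comp => //; exact: measurable_funM.
  apply: (le_trans (lee_wpmul2l _ conc)); first by rewrite lee_fin expR_ge0.
  rewrite -EFinM -expRD lee_fin ler_expR; lra.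
have c1 : (fun k : nat => k.+1%:R^-1 * ln n.+1%:R) @ \oo --> (0 * ln n.+1%:R : R).
  by apply: cvgM; [exact: cvg_harmonic|exact: cvg_cst].
rewrite mul0r in c1.
set a := (X in expR X).
have c2 : (fun k : nat => a + 2 * `|lam| * (k.+1%:R^-1 * ln n.+1%:R)) @ \oo --> a + 2 * `|lam| * 0.
  by apply: cvgD; [exact: cvg_cst|apply: cvgM => //; exact: cvg_cst].
rewrite mulr0 addr0 in c2.
have {}c2 : (fun k : nat => (expR (a + 2 * `|lam| * (k.+1%:R^-1 * ln n.+1%:R)))%:E) @ \oo --> (expR a)%:E.
  apply: cvg_EFin; first exact: nearW.
  by apply: (@cvg_comp _ _ _ _ expR _ _ _ c2); exact: continuous_expR.
rewrite -(cvg_lim _ c2)//; apply: lime_ge; first by apply/cvg_ex; eexists; exact: c2.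
by apply: nearW => k; exact: main.
Qed.

End maximum_concentration.

(** * The running supremum *)

Section running_supremum.
Context {R : realType}.
Local Notation path := (skorokhod R).
Implicit Types (w : path) (t x : R) (s u : unit_interval R).

Lemma right_nbhs w s (A : set R) : nbhs (w s) A ->
  exists2 e : R, 0 < e & forall u, set_val s < set_val u ->
    set_val u < set_val s + e -> A (w u).
Proof.
move=> wA; have [/(_ _ wA) h _] := path_cadlag w s.
have : nbhs s [set u | set_val s < set_val u -> A (w u)] by exact: h.
move=> /nbhs_ballP[e /= e0 eA]; exists e => // u su ue.
apply: eA => //; rewrite -initial_ballE /= /ball/= distrC ger0_norm ?subr_ge0 ?ltW//.
by rewrite ltrBlDl.
Qed.

Lemma clamp_subproof x : Num.min 1 (Num.max 0 x) \in unit_interval R.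
Proof.
apply/mem_set; rewrite /unit_interval /= in_itv /= le_min ler01/= le_max lexx/=.
by rewrite ge_min lexx.
Qed.

Definition clamp x : unit_interval R := 
  exist _ (Num.min 1 (Num.max 0 x)) (clamp_subproof x).

Lemma clampE x : 0 <= x -> x <= 1 -> set_val (clamp x) = x.
Proof. by move=> x0 x1; rewrite set_valE/= (max_r x0) (min_r x1). Qed.

Lemma unit_intervalP s : 0 <= set_val s <= 1.
Proof. by have := set_valP s; rewrite /unit_interval/= in_itv. Qed.

(* Enumerates the rationals of [0, t] together with t itself, on which the
   supremum of a right continuous path is already reached. *)
Definition times t (n : nat) : unit_interval R :=
  clamp (Num.min t (Num.max 0 (ratr (odflt 0 (unpickle n))))).

Lemma times_le t n : 0 <= t -> t <= 1 -> set_val (times t n) <= t.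
Proof.
move=> t0 t1; rewrite /times clampE//; first by rewrite ge_min lexx.
  by rewrite le_min t0 le_max lexx.
by rewrite ge_min t1.
Qed.

Lemma times_rat t (r : rat) : 0 <= t -> t <= 1 -> 0 <= (ratr r : R) -> ratr r <= t ->
  exists n, set_val (times t n) = ratr r.
Proof.
move=> t0 t1 r0 rt; exists (pickle r); rewrite /times pickleK/= (max_r r0) (min_r rt).
by rewrite clampE// (le_trans rt).
Qed.

Lemma times_last t : 0 <= t -> t <= 1 -> exists n, set_val (times t n) = t.
Proof.
move=> t0 t1; have t2 : t <= (ratr 1 : R) by rewrite rmorph1.
exists (pickle (1 : rat)); rewrite /times pickleK/= (max_r (le_trans t0 t2)) (min_l t2).
exact: clampE.
Qed.

(** If w s > y with s < t, this persists on a right neighbourhood of s, which contains rationals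
    below t. At s = t such a neighbourhood leaves [0, t], which is why t itself is enumerated. *)
Lemma times_bound t w (y : R) : 0 <= t -> t <= 1 -> (forall n, w (times t n) <= y) ->
  forall s, set_val s <= t -> w s <= y.
Proof.
move=> t0 t1 wy s; rewrite le_eqVlt => /predU1P[st|st].
  have [n tn] := times_last t0 t1; have <- : times t n = s.
    by apply: val_inj; rewrite [LHS]tn.
  exact: wy.
rewrite leNgt; apply/negP => yw.
have [e e0 ew] := right_nbhs (lt_nbhsr yw).
have /andP[s0 s1] := unit_intervalP s.
have sm : set_val s < Num.min t (set_val s + e) by rewrite lt_min st ltrDl.
have [r] := rat_in_itvoo sm; rewrite in_itv/= lt_min => /andP[sr /andP[rt re]].
have [n tn] := times_rat t0 t1 (le_trans s0 (ltW sr)) (ltW rt).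
have := ew (times t n); rewrite tn => /(_ sr re)/=.
by rewrite ltNge wy.
Qed.

(** The truncation makes every integral that of a nonnegative function. It changes nothing for paths
    starting at 0, whose supremum is at least 0. *)
Definition possup t w : \bar R := maxe 0%E (running_sup t w).

Lemma possup_ge0 t w : (0 <= possup t w)%E.
Proof. by rewrite /possup le_max lexx. Qed.

Lemma coord_le_possup t w s : set_val s <= t -> ((w s)%:E <= possup t w)%E.
Proof.
move=> st; rewrite /possup le_max; apply/orP; right.
by apply: ereal_sup_ubound; exists s.
Qed.

Lemma possup_le t w (y : \bar R) : (0 <= y)%E ->
  (possup t w <= y)%E <-> (forall s, set_val s <= t -> ((w s)%:E <= y)%E).
Proof.
move=> y0; split=> [h s st|h]; first exact: le_trans (coord_le_possup w st) h.
rewrite /possup ge_max y0/=; apply: ge_ereal_sup => _ [s st <-]; exact: h.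
Qed.

Lemma posmax_nd t w :
  {homo (fun n => (posmax (times t) n w)%:E) : m n / (m <= n)%N >-> (m <= n)%E}.
Proof.
move=> m n mn; rewrite lee_fin; apply: bigmax_le => [|i _]; first exact: posmax_ge0.
exact: (le_bigmax _ (fun i : 'I_n => w (times t i)) (widen_ord mn i)).
Qed.

Lemma cvg_posmax t w : 0 <= t -> t <= 1 ->
  (posmax (times t) n w)%:E @[n --> \oo] --> possup t w.
Proof.
move=> t0 t1.
have := ereal_nondecreasing_cvgn (posmax_nd t w); congr (_ --> _).
apply/eqP; rewrite eq_le; apply/andP; split.
  apply: ge_ereal_sup => _ [n _ <-]; rewrite /posmax.
  elim/big_ind : _ => [|x y hx hy|i _]; first exact: possup_ge0.
    by rewrite /Num.max; case: ifP.
  by apply: coord_le_possup; exact: times_le.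
set S := ereal_sup _.
have S0 : (0 <= S)%E.
  apply: (@le_trans _ _ (posmax (times t) 0 w)%:E); first by rewrite lee_fin posmax_ge0.
  by apply: ereal_sup_ubound; exists 0%N.
have ST n : ((w (times t n))%:E <= S)%E.
  apply: (@le_trans _ _ (posmax (times t) n.+1 w)%:E).
    rewrite lee_fin.
    exact: (le_bigmax _ (fun i : 'I_n.+1 => w (times t i)) ord_max).
  by apply: ereal_sup_ubound; exists n.+1.
apply/(possup_le t w S0) => s st.
move: S0 ST; case: S => [y|_ _|//]; last by rewrite leey.
rewrite !lee_fin => _ wy; apply: (times_bound t0 t1 _ st) => n.
by rewrite -lee_fin.
Qed.

Lemma measurable_possup t : 0 <= t -> t <= 1 -> measurable_fun setT (possup t).
Proof.
move=> t0 t1.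
apply: (@emeasurable_fun_cvg _ _ _ _ (fun n w => (posmax (times t) n w)%:E)) => //.
  by move=> n; apply/measurable_EFinP; exact: measurable_posmax.
by move=> w _; exact: cvg_posmax.
Qed.

End running_supremum.

(** * Moments of the running supremum *)

Section moments.
Context {R : realType} (P : probability (skorokhod R) R).
Local Notation path := (skorokhod R).
Hypothesis gaussP : gaussian_process P.
Hypothesis mean0 : forall s : unit_interval R,
  ('E_P[fun w : path => w s])%E = 0%E.

(* Length 1 of [x, x + 1] times the least value of the normal density there. *)
Definition gauss_tail (x : R) : R :=
  (Num.sqrt (2 * pi))^-1 * expR (- (x + 1) ^+ 2 / 2).

Lemma gauss_tail_gt0 x : 0 < gauss_tail x.
Proof. by rewrite mulr_gt0 ?expR_gt0// invr_gt0 sqrtr_gt0 mulr_gt0// pi_gt0. Qed.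

Lemma gauss_tail_le (x y : R) : 0 <= x -> x <= y -> gauss_tail y <= gauss_tail x.
Proof.
move=> x0 xy; rewrite ler_wpM2l ?invr_ge0 ?sqrtr_ge0// ler_expR !mulNr lerN2.
by rewrite ler_wpM2r ?invr_ge0// lerXn2r ?nnegrE; lra.
Qed.

(* [v] is the standard deviation of [w s]; the constant 8 is not sharp. *)
Lemma coord_scale s : exists v : R, [/\ 0 <= v,
  (\int[P]_w (w s ^+ 2)%:E <= (8 * v ^+ 2)%:E)%E,
  v = 0 -> P [set w : path | w s != 0%R] = 0%E &
  0 < v -> forall x, 0 <= x ->
    ((gauss_tail (x / v))%:E <= P [set w : path | (x <= w s)%R])%E].
Proof.
have mY := measurable_coord s.
have : centered_gaussian P (fun w : path => w s).
  have := centered_linform gaussP mean0 [:: (1, s)].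
  by congr centered_gaussian; apply/funext => w; rewrite linform1 mul1r.
have mf : measurable_fun setT (fun x : R => (x ^+ 2)%:E).
  by apply/measurable_EFinP; exact: exprn_measurable.
have f0 (x : R) : (0 <= (x ^+ 2)%:E)%E by rewrite lee_fin sqr_ge0.
case=> [PY|[v v0 PY]]; [exists 0|exists v]; split => //; rewrite ?ltxx ?(ltW v0)//.
- rewrite (ge0_integral_law mY PY mf f0) integral_dirac// diracT mul1e.
  by rewrite lee_fin expr0n/= mulr0.
- move=> _; transitivity (P ((fun w : path => w s) @^-1` (~` [set 0]))).
    by congr (P _); apply/seteqP; split => w /=; [move/eqP|move=> /eqP].
  rewrite PY; last exact: measurableC (measurable_set1 0).
  by rewrite diracE memNset// => /(_ erefl).
- rewrite (@ge0_integral_law _ _ path (measurableTypeR R) R P (normal_prob 0 v)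
    _ mY PY _ mf f0); exact: normal_sqr.
- by move=> v00; move: v0; rewrite v00 ltxx.
- move=> _ x x0; apply: le_trans (normal_tail v0 x0) _.
  rewrite -(PY `[x, +oo[%classic)//.
  rewrite (_ : [set w | _] = (fun w : path => w s) @^-1` `[x, +oo[%classic)//.
  by apply/seteqP; split => w /=; rewrite in_itv/= andbT.
Qed.

Definition meansup t : \bar R := (\int[P]_w possup t w)%E.

Lemma meansup_ge0 t : (0 <= meansup t)%E.
Proof. by apply: integral_ge0 => w _; exact: possup_ge0. Qed.

Lemma measurable_coord_ge s x : measurable [set w : path | x <= w s].
Proof.
rewrite (_ : [set w : path | x <= w s] = setT `&` (fun w : path => w s) @^-1` `[x, +oo[%classic).
  exact: (measurable_coord s).
by rewrite setTI; apply/seteqP; split => w /=; rewrite in_itv/= andbT.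
Qed.

Lemma markov_coord t s x : 0 <= t -> t <= 1 -> set_val s <= t -> 0 <= x ->
  (x%:E * P [set w : path | (x <= w s)%R] <= meansup t)%E.
Proof.
move=> t0 t1 st x0; set A := [set _ | _].
have mA : measurable A by exact: measurable_coord_ge.
have mI : measurable_fun setT (fun w : path => (\1_A w : R)%:E).
  by apply/measurable_EFinP; exact: measurable_indic.
have I0 (w : path) : (0 <= (\1_A w : R)%:E)%E by rewrite lee_fin.
have <- : (\int[P]_w (\1_A w : R)%:E = P A)%E by rewrite integral_indic// setIT.
rewrite -ge0_integralZl; [|by []|exact: mI|by move=> w _; exact: I0|by rewrite lee_fin].
apply: ge0_le_integral; [by []|by move=> w _; rewrite mule_ge0// lee_fin
  |exact: measurable_funeM|exact: measurable_possup|].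
move=> w _; rewrite indicE; have [/set_mem|] := boolP (w \in A).
  rewrite /A/= mule1 => xw; apply: (@le_trans _ _ (w s)%:E); first by rewrite lee_fin.
  exact: coord_le_possup.
by rewrite mule0 possup_ge0.
Qed.

(** Markov's inequality at the level v of one standard deviation bounds the product of v and
    [gauss_tail 1] by the mean supremum. *)
Lemma sqr_coord_le_meansup t s : 0 <= t -> t <= 1 -> (meansup t < +oo)%E ->
  set_val s <= t ->
  (\int[P]_w (w s ^+ 2)%:E <=
   (8 / gauss_tail 1 ^+ 2 * fine (meansup t) ^+ 2)%:E)%E.
Proof.
move=> t0 t1 mt st; have [v [v0 sv _ tv]] := coord_scale s.
have g0 := gauss_tail_gt0 1.
have m0 : 0 <= fine (meansup t) by rewrite fine_ge0// meansup_ge0.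
apply: (le_trans sv); rewrite lee_fin.
rewrite (_ : 8 / _ * _ = 8 * (fine (meansup t) / gauss_tail 1) ^+ 2); last first.
  by field; rewrite gt_eqF.
rewrite ler_wpM2l// lerXn2r ?nnegrE ?divr_ge0 ?(ltW g0)//.
rewrite le_eqVlt in v0; case/predU1P : v0 => [<-|v0].
  by rewrite divr_ge0 ?(ltW g0).
rewrite ler_pdivlMr// -lee_fin fineK ?ge0_fin_numE ?meansup_ge0//.
apply: le_trans (markov_coord t0 t1 st (ltW v0)).
rewrite EFinM lee_wpmul2l ?lee_fin ?(ltW v0)//.
by have := tv v0 v (ltW v0); rewrite divff ?gt_eqF.
Qed.

Lemma posmax_le_meansup t n : 0 <= t -> t <= 1 ->
  ((\int[P]_w posmax (times t) n w)%:E <= meansup t)%E.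
Proof.
move=> t0 t1; have IP := posmax_integrable gaussP (times t) n.
rewrite /Rintegral fineK; last exact: integrable_fin_num IP.
apply: ge0_le_integral => //.
- by move=> w _; rewrite lee_fin posmax_ge0.
- by apply/measurable_EFinP; exact: measurable_posmax.
- exact: measurable_possup.
move=> w _; have c := @cvg_posmax _ t w t0 t1.
rewrite -(cvg_lim _ c)//; apply: lime_ge; first by apply/cvg_ex; eexists; exact: c.
by exists n => // k /= nk; exact: posmax_nd.
Qed.

Lemma cvg_meansup t : 0 <= t -> t <= 1 ->
  (\int[P]_w posmax (times t) n w)%:E @[n --> \oo] --> meansup t.
Proof.
move=> t0 t1; rewrite (_ : (fun n => _) = (fun n => \int[P]_w (posmax (times t) n w)%:E)%E).
  apply: nd_cvg_integral => [n|n w|w|w].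
  - by apply/measurable_EFinP; exact: measurable_posmax.
  - by rewrite lee_fin posmax_ge0.
  - exact: posmax_nd.
  - exact: cvg_posmax.
apply/funext => n; rewrite /Rintegral fineK//.
exact: integrable_fin_num (posmax_integrable gaussP (times t) n).
Qed.

(** From x <= exp x, the excess of y over v is at most exp (lam (y - v)) / lam. Finite maxima
    concentrate around their own means, which are at most [meansup t], and monotone convergence
    passes to the supremum. *)
Lemma excess_bound t (s2 lam v : R) : 0 <= t -> t <= 1 -> 0 <= s2 -> 0 < lam ->
  (meansup t < +oo)%E ->
  (forall s, set_val s <= t -> (\int[P]_w (w s ^+ 2)%:E <= s2%:E)%E) ->
  (\int[P]_w maxe 0 (possup t w - v%:E) <=
   (expR (lam * (fine (meansup t) - v) + lam ^+ 2 * s2 / 2) / lam)%:E)%E.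
Proof.
move=> t0 t1 s20 lam0 mt var.
pose h n w : \bar R := maxe 0%E ((posmax (times t) n w)%:E - v%:E)%E.
have mh n : measurable_fun setT (h n).
  apply: measurable_maxe => //; apply/measurable_EFinP.
  by apply: measurable_funB => //; exact: measurable_posmax.
have h0 n w : (0 <= h n w)%E by rewrite le_max lexx.
have hnd w : {homo (fun n => h n w) : m n / (m <= n)%N >-> (m <= n)%E}.
  move=> m n mn; rewrite /h ge_max h0/= le_max; apply/orP; right.
  by rewrite -!EFinB lee_fin lerD2r -lee_fin; exact: posmax_nd.
have hcvg w : h n w @[n --> \oo] --> maxe 0%E (possup t w - v%:E)%E.
  have c := @cvg_posmax _ t w t0 t1; have := possup_ge0 t w.
  case: (possup t w) c => [y c _|c _|//].
    have c' : posmax (times t) n w @[n --> \oo] --> y by exact: (fine_cvg c).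
    rewrite (_ : (fun n => h n w) = (fun n => (Num.max 0 (posmax (times t) n w - v))%:E)); last first.
      by apply/funext => n; rewrite /h -EFinB -EFin_max.
    rewrite -EFinB -EFin_max; apply: cvg_EFin; first exact: nearW.
    apply: (@cvg_comp _ _ _ (fun n => posmax (times t) n w) (fun x => Num.max 0 (x - v)) _ _ _ c').
    apply: (@continuous_max _ _ (fun=> 0) (fun x : R => x - v)); first exact: cvg_cst.
    by apply: cvgB => //; exact: cvg_cst.
  rewrite (_ : maxe 0 (+oo - v%:E) = +oo)%E; last by rewrite addye// max_r// leey.
  apply/cvgeyPge => A; near=> n.
  rewrite /h le_max; apply/orP; right.
  rewrite -EFinB lee_fin lerBrDr -lee_fin.
  by near: n; exact: (cvgey_ge c).
have c := nd_cvg_integral mh h0 hnd hcvg (mu := P).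
rewrite -(cvg_lim _ c)//; apply: lime_le; first by apply/cvg_ex; eexists; exact: c.
apply: nearW => n.
have conc := posmax_concentration gaussP mean0 (s := times t) (n := n) s20
  (fun i => var _ (times_le i t0 t1)) lam.
have mE : measurable_fun setT (fun w => (expR (lam * posmax (times t) n w))%:E).
  apply/measurable_EFinP; apply: measurableT_comp => //.
  by apply: measurable_funM => //; exact: measurable_posmax.
have b0 : (0 <= (expR (- (lam * v)) / lam)%:E)%E by rewrite lee_fin divr_ge0 ?expR_ge0// ltW.
apply: (@le_trans _ _ (\int[P]_w ((expR (- (lam * v)) / lam)%:E * (expR (lam * posmax (times t) n w))%:E))%E).
  apply: ge0_le_integral => //; first exact: measurable_funeM.
  move=> w _; rewrite /h ge_max -EFinB -EFinM !lee_fin mulrAC -expRD.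
  rewrite divr_ge0 ?expR_ge0 ?(ltW lam0)//= ler_pdivlMr//.
  apply: le_trans (expR_ge1Dx _); lra.
rewrite ge0_integralZl; [|by []|exact: mE|by move=> w _; rewrite lee_fin expR_ge0|exact: b0].
apply: (le_trans (lee_wpmul2l b0 conc)).
rewrite -EFinM lee_fin mulrAC -expRD ler_wpM2r ?invr_ge0 ?(ltW lam0)// ler_expR.
rewrite addrA lerD2r mulrBr addrC lerD2r ler_wpM2l ?(ltW lam0)//.
by rewrite -lee_fin (@fineK _ (meansup t)) ?ge0_fin_numE ?meansup_ge0// posmax_le_meansup.
Unshelve. all: by end_near. Qed.

End moments.

(** A simple function below f is below g, whether or not f and g are measurable. The heat content
    calls for this, its integrand being only enclosed between measurable ones. *)
Lemma le_integral_nomeas d (T : measurableType d) (R : realType)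
    (mu : {measure set T -> \bar R}) (D : set T) (f g : T -> \bar R) :
  (forall x, D x -> 0 <= f x)%E -> (forall x, D x -> f x <= g x)%E ->
  (\int[mu]_(x in D) f x <= \int[mu]_(x in D) g x)%E.
Proof.
move=> f0 fg; have g0 x : D x -> (0 <= g x)%E.
  by move=> Dx; exact: le_trans (f0 x Dx) (fg x Dx).
rewrite !ge0_integralE//; apply: le_ereal_sup => _ [h hf <-]; exists h => //= x.
by apply: (le_trans (hf x)); exact: lee_restrict.
Qed.

Section supremum_mean.
Context {R : realType} (P : probability (skorokhod R) R).
Local Notation path := (skorokhod R).
Hypothesis gaussP : gaussian_process P.
Hypothesis mean0 : forall s : unit_interval R,
  ('E_P[fun w : path => w s])%E = 0%E.

Lemma possup_tail t (g : R) : 0 <= t -> t <= 1 -> 0 < g ->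
  {ae P, forall w : path, (running_sup t w < +oo)%E} ->
  exists k : nat, (P [set w | (k%:R%:E < possup t w)%E] < g%:E)%E.
Proof.
move=> t0 t1 g0 ae; pose A k := [set w : path | (k%:R%:E < possup t w)%E].
have mp := measurable_possup t0 t1.
have mA k : measurable (A k).
  rewrite -[A k]setTI; exact: emeasurable_fun_o_infty.
have mI : measurable (\bigcap_k A k) by exact: bigcapT_measurable.
have P0 : P (\bigcap_k A k) = 0%E.
  apply: measure_negligible => //; case: ae => N [mN N0 sN].
  exists N; split => // w wA; apply: sN => /= wy.
  have : (possup t w < +oo)%E by rewrite /possup gt_max ltry wy.
  rewrite -ge0_fin_numE ?possup_ge0// => wf.
  have := wA (Num.trunc (fine (possup t w))).+1 Logic.I; rewrite /A/= -[X in (_ < X)%E]fineK// lte_fin.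
  by apply/negP; rewrite -leNgt ltW// truncnS_gt.
have h : (P \o A) @ \oo --> 0%E.
  rewrite -P0; apply: nonincreasing_cvg_mu => //.
  - by rewrite (le_lt_trans (probability_le1 P (mA 0%N)))// ltry.
  - move=> m n mn; apply/subsetPset => w /=; apply: le_lt_trans.
    by rewrite lee_fin ler_nat.
have g0' : (0 < g%:E)%E by rewrite lte_fin.
have [k _ hk] := h _ (open_ereal_lt' g0').
by exists k; exact: hk k (leqnn k).
Qed.

(* As [possup t] is at most k with probability at least 1 / 2, all coordinates
   have a standard deviation at most k + 1, and concentration at parameter -1
   bounds the means of the finite maxima. *)
Lemma meansup_fin t : 0 <= t -> t <= 1 ->
  {ae P, forall w : path, (running_sup t w < +oo)%E} -> (meansup P t < +oo)%E.
Proof.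
(* The first term excludes a standard deviation above k + 1; the second leaves probability at least
   1 / 2 to a supremum at most k. *)
move=> t0 t1 ae; pose g := Num.min (gauss_tail 1) (2^-1 : R).
have g0 : 0 < g by rewrite /g lt_min gauss_tail_gt0 invr_gt0 ltr0n.
have [k] := possup_tail t0 t1 g0 ae; set A := [set w | _] => PA.
have mA : measurable A.
  have mp := measurable_possup t0 t1.
  by rewrite -[A]setTI; exact: emeasurable_fun_o_infty.
have scale s : set_val s <= t -> (\int[P]_w (w s ^+ 2)%:E <= (8 * k.+1%:R ^+ 2)%:E)%E.
  move=> st; have [v [v0 sv _ tv]] := coord_scale gaussP mean0 s.
  apply: (le_trans sv); rewrite lee_fin ler_wpM2l// lerXn2r ?nnegrE// leNgt.
  apply/negP => kv; have v1 : 0 < v by rewrite (lt_trans _ kv).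
  have := tv v1 k.+1%:R (ler0n _ _); apply/negP; rewrite -ltNge.
  apply: (@le_lt_trans _ _ (P A)).
    apply: le_measure; rewrite ?inE//; first exact: measurable_coord_ge.
    move=> w /= kw; apply: (@lt_le_trans _ _ (w s)%:E).
      by rewrite lte_fin (lt_le_trans _ kw)// ltr_nat.
    exact: coord_le_possup.
  apply: (lt_le_trans PA); rewrite lee_fin /g ge_min gauss_tail_le ?orTb//.
    by rewrite divr_ge0.
  by rewrite ler_pdivrMr// mul1r ltW.
pose s2 : R := 8 * k.+1%:R ^+ 2; have s20 : 0 <= s2 by rewrite mulr_ge0// sqr_ge0.
have bnd n : \int[P]_w posmax (times t) n w <= k%:R + 1 + s2 / 2.
  have conc := posmax_concentration gaussP mean0 (s := times t) (n := n) s20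
    (fun i => scale _ (times_le i t0 t1)) (-1).
  have mE : measurable_fun setT (fun w => (expR (-1 * posmax (times t) n w))%:E).
    apply/measurable_EFinP; apply: measurableT_comp => //.
    by apply: measurable_funM => //; exact: measurable_posmax.
  have PB : ((2^-1)%:E <= P (~` A))%E.
    rewrite probability_setC// (_ : (2^-1)%:E = 1 - (2^-1)%:E)%E; last first.
      by rewrite -EFinB; congr EFin; field.
    rewrite leeB// ltW// (lt_le_trans PA)// lee_fin /g ge_min lexx orbT//.
  (* A lower bound on E exp (- max), compared with the upper bound from concentration, bounds the
     mean from above. *)
  have h1 : ((expR (- k%:R) * 2^-1)%:E <= \int[P]_w (expR (-1 * posmax (times t) n w))%:E)%E.
    apply: (@le_trans _ _ ((expR (- k%:R))%:E * P (~` A))%E).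
      by rewrite EFinM lee_wpmul2l// lee_fin expR_ge0.
    have <- : (\int[P]_w (\1_(~` A) w : R)%:E = P (~` A))%E.
      by rewrite integral_indic ?setIT//; exact: measurableC.
    have mI : measurable_fun setT (fun w : path => (\1_(~` A) w : R)%:E).
      by apply/measurable_EFinP; apply: measurable_indic; exact: measurableC.
    rewrite -ge0_integralZl; [|by []|exact: mI|by move=> w _; rewrite lee_fin|by rewrite lee_fin expR_ge0].
    apply: ge0_le_integral; [by []|by move=> w _; rewrite mule_ge0 ?lee_fin ?expR_ge0
      |exact: measurable_funeM|exact: mE|].
    move=> w _; rewrite indicE; have [/set_mem|_] := boolP (w \in ~` A); last first.
      by rewrite mule0 lee_fin expR_ge0.
    rewrite /A/= => /negP; rewrite -leNgt => wk.
    rewrite mule1 lee_fin ler_expR mulN1r lerN2 -lee_fin (le_trans _ wk)//.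
    have c := @cvg_posmax _ t w t0 t1.
    rewrite -(cvg_lim _ c)//; apply: lime_ge; first by apply/cvg_ex; eexists; exact: c.
    by exists n => // j /= nj; exact: posmax_nd.
  have := le_trans h1 conc; rewrite lee_fin.
  (* As exp 1 >= 2, the probability 1 / 2 is absorbed into the exponent; this is the 1 in the bound
     on the means. *)
  have h2 : expR (- k%:R - 1) <= expR (- k%:R) * 2^-1 :> R.
    rewrite expRD ler_wpM2l ?expR_ge0// expRN lef_pV2 ?posrE ?expR_gt0//.
    by rewrite (le_trans _ (expR_ge1Dx _)).
  move=> /(le_trans h2); rewrite ler_expR sqrrN expr1n mul1r mulN1r; lra.
apply: (@le_lt_trans _ _ (k%:R + 1 + s2 / 2)%:E); last exact: ltry.
have c := cvg_meansup gaussP t0 t1.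
rewrite -(cvg_lim _ c)//; apply: lime_le; first by apply/cvg_ex; eexists; exact: c.
by apply: nearW => n; rewrite lee_fin.
Qed.

Lemma meansup_gt0 t : 0 < t -> t <= 1 ->
  (0 < P [set w : path | w (clamp t) != 0%R])%E -> (0 < meansup P t)%E.
Proof.
move=> t0 t1 nd; have [v [v0 _ v1 tv]] := coord_scale gaussP mean0 (clamp t).
rewrite le_eqVlt in v0; case/predU1P : v0 => [v0|v0].
  by move: nd; rewrite v1// ltxx.
have ct : set_val (clamp t) <= t by rewrite clampE// ltW.
apply: lt_le_trans (markov_coord P (ltW t0) t1 ct (ltW v0)).
apply: (@lt_le_trans _ _ (v * gauss_tail 1)%:E).
  by rewrite lte_fin mulr_gt0// gauss_tail_gt0.
rewrite EFinM lee_wpmul2l ?lee_fin ?(ltW v0)//.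
by have := tv v0 v (ltW v0); rewrite divff ?gt_eqF.
Qed.

Hypothesis start0 : P [set w : path | w (time0 R) = 0] = 1%E.

Lemma measurable_start : measurable [set w : path | w (time0 R) = 0].
Proof.
rewrite (_ : [set w : path | _] = setT `&` (fun w : path => w (time0 R)) @^-1` [set 0]).
  exact: measurable_coord.
by rewrite setTI.
Qed.

Lemma start_ae : {ae P, forall w : path, w (time0 R) = 0}.
Proof.
apply/negligibleP; first exact: measurableC measurable_start.
have := probability_setC P measurable_start.
by rewrite start0 subee// => <-.
Qed.

(** The negative part of the supremum is at most |w 0|, which is almost surely 0, and its positive
    part is [possup]. *)
Lemma mean_supE t : 0 <= t -> t <= 1 -> mean_sup P t = meansup P t.
Proof.
move=> t0 t1; rewrite /mean_sup integralE.
have -> : (\int[P]_w (running_sup t)^\- w = 0)%E.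
  apply/eqP; rewrite eq_le integral_ge0 ?andbT; last by move=> w _; exact: funeneg_ge0.
  apply: (@le_trans _ _ (\int[P]_w `|(w (time0 R))%:E|)%E).
    apply: le_integral_nomeas => w _; first exact: funeneg_ge0.
    rewrite funenegE ge_max abse_ge0 andbT leeNl.
    apply: (@le_trans _ _ (w (time0 R))%:E).
      by rewrite leeNl -EFinN lee_fin -normrN ler_norm.
    by apply: ereal_sup_ubound; exists (time0 R).
  rewrite (@ae_eq_integral _ _ _ P setT (cst 0%E)).
  - by rewrite integral0.
  - exact: measurableT.
  - by apply/measurable_EFinP; apply: measurableT_comp => //; exact: measurable_coord.
  - exact: measurable_cst.
  - by apply: filterS start_ae => w w0 _; rewrite w0 /= normr0.
rewrite sube0; apply: eq_integral => w _.
by rewrite funeposE /possup maxC.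
Qed.

Lemma possup_nd t t' (w : path) : t <= t' -> (possup t w <= possup t' w)%E.
Proof.
move=> tt'; apply/possup_le; first exact: possup_ge0.
by move=> s st; apply: coord_le_possup; exact: le_trans st tt'.
Qed.

Lemma meansup_nd t t' : 0 <= t -> t <= t' -> t' <= 1 -> (meansup P t <= meansup P t')%E.
Proof.
move=> t0 tt' t1; apply: ge0_le_integral; [by []|by move=> w _; exact: possup_ge0| | |].
- by apply: measurable_possup => //; exact: le_trans tt' t1.
- by apply: measurable_possup => //; exact: le_trans t0 tt'.
- by move=> w _; exact: possup_nd.
Qed.

Lemma possup_cvg0 (w : path) : w (time0 R) = 0 ->
  possup n.+1%:R^-1 w @[n --> \oo] --> 0%E.
Proof.
move=> w0.
have ni : {homo (fun n => possup n.+1%:R^-1 w) : m n / (m <= n)%N >-> (n <= m)%E}.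
  by move=> m n mn; apply: possup_nd; rewrite lef_pV2 ?posrE// ler_nat.
have := ereal_nonincreasing_cvgn ni; congr (_ --> _).
apply/eqP; rewrite eq_le; apply/andP; split; last first.
  by apply: le_ereal_inf_tmp => _ [n _ <-]; exact: possup_ge0.
apply/lee_addgt0Pr => e e0; rewrite add0e.
have [|d d0 de] := @right_nbhs _ w (time0 R) [set y | y < e].
  by rewrite w0; exact: lt_nbhsl.
have [n nd] : exists n : nat, n.+1%:R^-1 < d.
  have [n _ h] := near_infty_natSinv_lt (PosNum d0).
  by exists n; exact: (h n (leqnn n)).
apply: (@le_trans _ _ (possup n.+1%:R^-1 w)).
  by apply: ereal_inf_lbound; exists n.
apply/possup_le; first by rewrite lee_fin ltW.
move=> s sn; rewrite lee_fin; have /andP[s0 _] := unit_intervalP s.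
rewrite le_eqVlt in s0; case/predU1P : s0 => [s0|s0].
  have -> : s = time0 R by apply: val_inj; rewrite [LHS](esym s0).
  by rewrite w0 ltW.
apply/ltW/de => //; rewrite set_valE/= add0r.
exact: le_lt_trans sn nd.
Qed.

Lemma meansup_small (e : R) : (meansup P 1 < +oo)%E -> 0 < e ->
  exists t, [/\ 0 < t, t <= 1 & (meansup P t < e%:E)%E].
Proof.
move=> m1 e0.
have n0 n : 0 <= n.+1%:R^-1 :> R by rewrite invr_ge0.
have n1 n : n.+1%:R^-1 <= 1 :> R by rewrite invf_le1// ler1n.
have I1 : P.-integrable setT (possup 1).
  apply/integrableP; split; first exact: measurable_possup.
  by under eq_integral do rewrite gee0_abs ?possup_ge0//.
have c0 : {ae P, forall w : path, setT w ->
    possup n.+1%:R^-1 w @[n --> \oo] --> 0%E}.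
  by apply: filterS start_ae => w w0 _; exact: possup_cvg0.
have dom : {ae P, forall (w : path) (n : nat), setT w ->
    (`|possup n.+1%:R^-1 w| <= possup 1 w)%E}.
  by apply: aeW => w n _; rewrite gee0_abs ?possup_ge0//; exact: possup_nd.
have [_ _] := dominated_convergence measurableT
  (fun n => measurable_possup (n0 n) (n1 n)) (measurable_cst (0%E : \bar R))
  c0 I1 dom.
rewrite integral0 => h.
have g0' : (0 < e%:E)%E by rewrite lte_fin.
have [k _ hk] := h _ (open_ereal_lt' g0').
exists k.+1%:R^-1; split => //.
exact: hk k (leqnn k).
Qed.

End supremum_mean.

(** * Heat content *)

Section strip.
Context d (T : measurableType d) {R : realType} (P : probability T R).
Variables (f g : T -> \bar R) (a b : R).
Hypotheses (mf : measurable_fun setT f) (mg : measurable_fun setT g).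
Hypotheses (f0 : forall w, (0 <= f w)%E) (g0 : forall w, (0 <= g w)%E).

Let M := measurableTypeR R.
Let strip_lt : set (M * T) :=
  [set z | (f z.2 < (b - z.1)%:E)%E /\ (g z.2 < (z.1 - a)%:E)%E].
Let strip_le : set (M * T) :=
  [set z | (f z.2 <= (b - z.1)%:E)%E /\ (g z.2 <= (z.1 - a)%:E)%E].

Let m1 : measurable_fun setT (fun z : M * T => (b - z.1)%:E).
Proof.
by apply/measurable_EFinP; apply: measurable_funB => //; exact: measurable_fst.
Qed.
Let m2 : measurable_fun setT (fun z : M * T => (z.1 - a)%:E).
Proof.
by apply/measurable_EFinP; apply: measurable_funB => //; exact: measurable_fst.
Qed.
Let mf2 : measurable_fun setT (fun z : M * T => f z.2).
Proof. by apply: measurableT_comp mf _; exact: measurable_snd. Qed.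
Let mg2 : measurable_fun setT (fun z : M * T => g z.2).
Proof. by apply: measurableT_comp mg _; exact: measurable_snd. Qed.

Let mlt : measurable strip_lt.
Proof.
rewrite (_ : strip_lt = (setT `&` [set z : M * T | (f z.2 < (b - z.1)%:E)%E]) `&`
   (setT `&` [set z | (g z.2 < (z.1 - a)%:E)%E])); last by rewrite !setTI.
by apply: measurableI; exact: measurable_lte.
Qed.

Let mle : measurable strip_le.
Proof.
rewrite (_ : strip_le = (setT `&` [set z : M * T | (f z.2 <= (b - z.1)%:E)%E]) `&`
   (setT `&` [set z | (g z.2 <= (z.1 - a)%:E)%E])); last by rewrite !setTI.
by apply: measurableI; exact: measurable_lee.
Qed.

(** For fixed w the section over x lies between the open and the closed interval from a + g w to b -
    f w, which have the same length; it is empty if f w or g w is infinite. *)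
Let strip_fubini (A : set (M * T)) : measurable A ->
  strip_lt `<=` A -> A `<=` strip_le ->
  (\int[lebesgue_measure]_x P [set w | A (x, w)] =
   \int[P]_w maxe 0 ((b - a)%:E - (f w + g w)))%E.
Proof.
move=> mA ltA leA.
have := @indic_fubini_tonelli _ _ _ _ _ (@lebesgue_measure R) P _ mA.
rewrite indic_fubini_tonelli_FE// indic_fubini_tonelli_GE//= => e.
transitivity (\int[lebesgue_measure]_x P (xsection A x))%E.
  by apply: eq_integral => x _; rewrite xsectionE.
rewrite e; apply: eq_integral => w _.
have mAw : measurable (ysection A w) by exact: measurable_ysection.
have : [set x : M | (f w < (b - x)%:E)%E /\ (g w < (x - a)%:E)%E] `<=` ysection A w.
  by move=> x xA; rewrite ysectionE; exact: ltA.
have : ysection A w `<=` [set x : M | (f w <= (b - x)%:E)%E /\ (g w <= (x - a)%:E)%E].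
  by move=> x; rewrite ysectionE => /leA.
have := f0 w; have := g0 w.
case: (f w) => [y||]//; case: (g w) => [z||]// z0 y0 Ale Alt.
- have -> : (maxe 0 ((b - a)%:E - (y%:E + z%:E)))%E = lebesgue_measure (`]a + z, b - y[%classic : set M).
    rewrite lebesgue_measure_itv/= lte_fin -!EFinD -EFin_max.
    case: ltP => h; congr EFin; first by rewrite max_r; lra.
    by rewrite max_l//; lra.
  apply/eqP; rewrite eq_le; apply/andP; split.
    apply: (@le_trans _ _ (lebesgue_measure (`[a + z, b - y]%classic : set M))).
      apply: le_measure; rewrite ?inE//.
      move=> x /Ale/=; rewrite !lee_fin in_itv/= => -[? ?]; apply/andP; lra.
    by rewrite !lebesgue_measure_itv.
  apply: le_measure; rewrite ?inE//.
  by move=> x /=; rewrite in_itv/= => /andP[? ?]; apply: Alt; rewrite /= !lte_fin; lra.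
- have -> : ysection A w = set0 by apply/seteqP; split => x // /Ale[].
  by rewrite measure0 max_l//= leNye.
- have -> : ysection A w = set0 by apply/seteqP; split => x // /Ale[].
  by rewrite measure0 max_l//= leNye.
- have -> : ysection A w = set0 by apply/seteqP; split => x // /Ale[].
  by rewrite measure0 max_l//= leNye.
Qed.

Lemma strip_fubini_lt :
  (\int[lebesgue_measure]_x P [set w | f w < (b - x)%:E /\ g w < (x - a)%:E] =
   \int[P]_w maxe 0 ((b - a)%:E - (f w + g w)))%E.
Proof. by apply: strip_fubini mlt _ _ => // z [? ?]; split; exact: ltW. Qed.

Lemma strip_fubini_le :
  (\int[lebesgue_measure]_x P [set w | f w <= (b - x)%:E /\ g w <= (x - a)%:E] =
   \int[P]_w maxe 0 ((b - a)%:E - (f w + g w)))%E.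
Proof. by apply: strip_fubini mle _ _ => // z [? ?]; split; exact: ltW. Qed.

End strip.

(** * Exit times and one-sided suprema *)

Section exit.
Context {R : realType}.
Local Notation path := (skorokhod R).
Implicit Types (w : path) (a b t x : R).

(** The infimum must exceed t strictly, so staying inside up to t is not enough: right continuity at
    t keeps the path in the open interval for a further time e. *)
Lemma exit_time_gt a b t x w : 0 <= t -> t <= 1 ->
  (possup t w < (b - x)%:E)%E -> (possup t (path_opp w) < (x - a)%:E)%E ->
  (t%:E < exit_time `]a, b[%classic (translate x w))%E.
Proof.
move=> t0 t1 wb wa.
have wt s : set_val s <= t -> a < w s + x < b.
  move=> st; apply/andP; split.
    have := le_lt_trans (coord_le_possup (path_opp w) st) wa.
    by rewrite path_oppE lte_fin; lra.
  by have := le_lt_trans (coord_le_possup w st) wb; rewrite lte_fin; lra.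
have ct : set_val (clamp t) <= t by rewrite clampE.
have /andP[ca cb] := wt _ ct.
have ca' : a - x < w (clamp t) by lra.
have cb' : w (clamp t) < b - x by lra.
have wn : nbhs (w (clamp t)) `]a - x, b - x[%classic.
  by apply: open_nbhs_nbhs; split => //=; rewrite in_itv/= ca' cb'.
have [e e0 ew] := right_nbhs wn.
apply: (@lt_le_trans _ _ (t + e)%:E); first by rewrite lte_fin ltrDl.
apply: le_ereal_inf_tmp => _ [s [s0 sD] <-]; rewrite lee_fin leNgt.
apply/negP => se; apply: sD; rewrite /= in_itv/=.
have [st|ts] := leP (set_val s) t; first exact: wt.
have := ew s; rewrite (clampE t0 t1) => /(_ ts se)/=; rewrite in_itv/=.
by move=> /andP[? ?]; apply/andP; split; lra.
Qed.

(** The exit time ignores time 0, whose value is recovered from the right. *)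
Lemma coord_le_right t w (y : R) : 0 < t -> t <= 1 ->
  (forall s, 0 < set_val s -> set_val s <= t -> w s <= y) ->
  forall s, set_val s <= t -> w s <= y.
Proof.
move=> t0 t1 wt s; have /andP[s0 _] := unit_intervalP s.
rewrite le_eqVlt in s0; case/predU1P : s0 => [s0 _|]; last exact: wt.
rewrite leNgt; apply/negP => ws; have [e e0 ew] := right_nbhs (lt_nbhsr ws).
pose u := clamp (Num.min t (e / 2)).
have uE : set_val u = Num.min t (e / 2).
  by rewrite clampE// ?le_min ?ge_min ?t1// (ltW t0)/= divr_ge0// ltW.
have u0 : 0 < set_val u by rewrite uE lt_min t0 divr_gt0.
have ut : set_val u <= t by rewrite uE ge_min lexx.
have ue : set_val u < e by rewrite uE gt_min; apply/orP; right; lra.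
by have /= := ew u; rewrite -s0 add0r => /(_ u0 ue); rewrite ltNge wt.
Qed.

(** Only weak inequalities survive: a path inside the open interval may approach an end as a left
    limit, so that the supremum equals the boundary value. *)
Lemma exit_time_lt a b t x w : 0 < t -> t <= 1 ->
  a < x -> x < b -> (t%:E < exit_time `]a, b[%classic (translate x w))%E ->
  (possup t w <= (b - x)%:E)%E /\ (possup t (path_opp w) <= (x - a)%:E)%E.
Proof.
move=> t0 t1 ax xb te.
have wt s : 0 < set_val s -> set_val s <= t -> a < w s + x < b.
  move=> s0 st; apply/negPn/negP => sD; move: te; apply/negP; rewrite -leNgt.
  apply: (@le_trans _ _ (set_val s)%:E); last by rewrite lee_fin.
  apply: ereal_inf_lbound; exists s => //; split => //=.
  by rewrite in_itv/=; exact/negP.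
split; apply/possup_le; rewrite ?lee_fin ?subr_ge0 ?(ltW ax) ?(ltW xb)// => s st.
  rewrite lee_fin; apply: coord_le_right t0 t1 _ s st => s s0 st.
  by have /andP[? ?] := wt s s0 st; lra.
rewrite lee_fin; apply: coord_le_right t0 t1 _ s st => s s0 st.
by have /andP[? ?] := wt s s0 st; rewrite path_oppE; lra.
Qed.

(** On arbitrary sets the completion is the outer measure of [P], which is monotone. *)
Lemma completed_measure_extension_between d (T : measurableType d)
    (P : probability T R) (A B F : set T) : measurable A -> measurable B ->
  A `<=` F -> F `<=` B ->
  (P A <= @completed_measure_extension _ _ _ P F <= P B)%E.
Proof.
move=> mA mB AF FB; rewrite -(measurable_mu_extE P mA) -(measurable_mu_extE P mB).
by apply/andP; split; exact: le_outer_measure.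
Qed.

End exit.

Section heat.
Context {R : realType} (P : probability (skorokhod R) R).
Local Notation path := (skorokhod R).

Lemma measurable_possup_opp t : 0 <= t -> t <= 1 ->
  measurable_fun setT (fun w : path => possup t (path_opp w)).
Proof.
move=> t0 t1; apply: measurableT_comp (measurable_possup t0 t1) _.
exact: measurable_path_opp.
Qed.

(** The exit probability lies between the strict and the weak strip probabilities, whose integrals
    over x agree; this fixes the integral without deciding whether exit events are measurable. *)
Lemma heat_contentE a b t : 0 < t -> t <= 1 ->
  heat_content P `]a, b[%classic t =
  (\int[P]_w maxe 0 ((b - a)%:E - (possup t w + possup t (path_opp w))))%E.
Proof.
move=> t0 t1; have t0' := ltW t0.
have mS := measurable_possup t0' t1; have mJ := measurable_possup_opp t0' t1.
have S0 (w : path) : (0 <= possup t w)%E := possup_ge0 t w.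
have J0 (w : path) : (0 <= possup t (path_opp w))%E := possup_ge0 t (path_opp w).
have mlt (x : R) : measurable [set w : path | (possup t w < (b - x)%:E)%E /\
    (possup t (path_opp w) < (x - a)%:E)%E].
  rewrite (_ : [set w : path | _] = (setT `&` [set w : path | (possup t w < (b - x)%:E)%E]) `&`
     (setT `&` [set w : path | (possup t (path_opp w) < (x - a)%:E)%E])); last by rewrite !setTI.
  by apply: measurableI; apply: measurable_lte.
have mle (x : R) : measurable [set w : path | (possup t w <= (b - x)%:E)%E /\
    (possup t (path_opp w) <= (x - a)%:E)%E].
  rewrite (_ : [set w : path | _] = (setT `&` [set w : path | (possup t w <= (b - x)%:E)%E]) `&`
     (setT `&` [set w : path | (possup t (path_opp w) <= (x - a)%:E)%E])); last by rewrite !setTI.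
  by apply: measurableI; apply: measurable_lee.
have sandwich (x : R) : a < x -> x < b ->
  (P [set w : path | possup t w < (b - x)%:E /\ possup t (path_opp w) < (x - a)%:E] <=
   prob_from P x [set w | t%:E < exit_time `]a, b[%classic w] <=
   P [set w : path | possup t w <= (b - x)%:E /\ possup t (path_opp w) <= (x - a)%:E])%E.
  move=> ax xb; apply: completed_measure_extension_between (mlt x) (mle x) _ _.
    by move=> w [? ?]; exact: exit_time_gt.
  by move=> w /(exit_time_lt t0 t1 ax xb).
apply/eqP; rewrite eq_le; apply/andP; split.
  rewrite -(strip_fubini_le P a b mS mJ S0 J0) /heat_content integral_mkcond.
  apply: le_integral_nomeas => x _; rewrite patchE; case: ifPn => //.
  by rewrite inE/= in_itv/= => /andP[ax xb]; have /andP[] := sandwich x ax xb.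
  by move=> _; exact: measure_ge0.
rewrite -(strip_fubini_lt P a b mS mJ S0 J0).
rewrite /heat_content [leRHS]integral_mkcond.
apply: le_integral_nomeas => x _ //; rewrite patchE; case: ifPn.
  by rewrite inE/= in_itv/= => /andP[ax xb]; have /andP[] := sandwich x ax xb.
(* Outside the interval one of the two bounds is nonpositive, and a nonnegative supremum cannot lie
   strictly below it. *)
rewrite notin_setE/= in_itv/= => abx.
rewrite (_ : [set w | _] = set0) ?measure0//.
apply/seteqP; split => // w [wb wa]; apply: abx.
by have := le_lt_trans (S0 w) wb; have := le_lt_trans (J0 w) wa;
  rewrite !lte_fin !subr_gt0 => -> ->.
Qed.

End heat.

(** * The error term *)

Section error_term.
Context {R : realType} (P : probability (skorokhod R) R).
Local Notation path := (skorokhod R).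
Hypothesis gaussP : gaussian_process P.
Hypothesis mean0 : forall s : unit_interval R,
  ('E_P[fun w : path => w s])%E = 0%E.
Hypothesis nondeg : forall s : unit_interval R, 0 < set_val s ->
  (0 < P [set w : path | w s != 0%R])%E.
Variables (a b t : R).
Hypotheses (ltab : a < b) (t0 : 0 < t) (t1 : t <= 1) (mfin : (meansup P t < +oo)%E).
Local Notation len := (b - a).
Local Notation S := (fun w : path => possup t w).
Local Notation J := (fun w : path => possup t (path_opp w)).

Definition heat_error : \bar R := (\int[P]_w maxe 0 (S w + J w - len%:E))%E.

Let t0' : 0 <= t. Proof. exact: ltW. Qed.
Let mS : measurable_fun setT S. Proof. exact: measurable_possup. Qed.
Let mJ : measurable_fun setT J. Proof. exact: measurable_possup_opp. Qed.
Let S0 w : (0 <= S w)%E. Proof. exact: possup_ge0. Qed.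
Let J0 w : (0 <= J w)%E. Proof. exact: possup_ge0. Qed.

Lemma integral_path_opp (f : path -> \bar R) : measurable_fun setT f ->
  (forall w, (0 <= f w)%E) -> (\int[P]_w f (path_opp w) = \int[P]_w f w)%E.
Proof.
move=> mf f0.
apply: (ge0_integral_law (measurable_path_opp (R := R)) _ mf f0) => A mA.
exact: path_law_opp.
Qed.

Lemma measurable_excess (f : path -> \bar R) (v : R) : measurable_fun setT f ->
  measurable_fun setT (fun w => maxe 0 (f w - v%:E))%E.
Proof.
by move=> mf; apply: measurable_maxe => //; exact: emeasurable_funB.
Qed.

Lemma integralDT (f g : path -> \bar R) : measurable_fun setT f -> measurable_fun setT g ->
  (forall w, (0 <= f w)%E) -> (forall w, (0 <= g w)%E) ->
  (\int[P]_w f w + \int[P]_w g w = \int[P]_w (f w + g w))%E.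
Proof.
by move=> mf mg f0 g0; rewrite (ge0_integralD P measurableT (fun w _ => f0 w) mf (fun w _ => g0 w) mg).
Qed.

(** Integrates (L - Y)^+ + Y = L + (Y - L)^+ with Y = S + J. The additive form avoids subtracting
    infinite values. *)
Lemma heat_content_add :
  (heat_content P `]a, b[%classic t + (meansup P t + meansup P t) =
   len%:E + heat_error)%E.
Proof.
rewrite heat_contentE//.
have mSJ : measurable_fun setT (fun w => S w + J w)%E by exact: emeasurable_funD.
have SJ0 w : (0 <= S w + J w)%E by rewrite adde_ge0.
have mQ : measurable_fun setT (fun w => maxe 0 (len%:E - (S w + J w)))%E.
  by apply: measurable_maxe => //; exact: emeasurable_funB.
rewrite {2}/meansup -(integral_path_opp mS S0) /meansup.
have maxe0 (x : \bar R) : (0 <= maxe 0 x)%E by rewrite le_max lexx.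
rewrite (integralDT mS mJ S0 J0) (integralDT mQ mSJ (fun w => maxe0 _) SJ0).
rewrite -[X in (X + heat_error)%E](integral_probability_cst P).
have len0 : forall w : path, (0 <= cst len%:E w)%E.
  by move=> w; rewrite lee_fin subr_ge0 ltW.
rewrite (integralDT _ (measurable_excess len mSJ) len0 (fun w => maxe0 _)); last exact: measurable_cst.
apply: eq_integral => w _; have := S0 w; have := J0 w => /=.
case: (possup t w) => [y||]//; case: (possup t (path_opp w)) => [z||]// z0 y0.
- rewrite -!EFinD -!EFin_max -!EFinD; congr EFin.
  case: (leP (len - (y + z)) 0) => h; first by rewrite max_r; lra.
  by rewrite max_l; lra.
- by rewrite /= (max_l (leNye _)) (max_r (leey _)).
- by rewrite /= (max_l (leNye _)) (max_r (leey _)).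
- by rewrite /= (max_l (leNye _)) (max_r (leey _)).
Qed.

Lemma heat_content_fin : heat_content P `]a, b[%classic t \is a fin_num.
Proof.
have Q0 (w : path) : (0 <= maxe 0 (len%:E - (S w + J w)))%E by rewrite le_max lexx.
rewrite heat_contentE// ge0_fin_numE; last exact: integral_ge0.
apply: (@le_lt_trans _ _ (len%:E)); last exact: ltry.
rewrite -[leRHS](integral_probability_cst P); apply: le_integral_nomeas => // w _; rewrite ge_max /= lee_fin subr_ge0 ltW//=.
by rewrite geeDl ?oppe_le0 ?adde_ge0.
Qed.

Lemma heat_error_ge0 : (0 <= heat_error)%E.
Proof. by apply: integral_ge0 => w _; rewrite le_max lexx. Qed.

Lemma heat_error_fin : heat_error \is a fin_num.
Proof.
rewrite ge0_fin_numE ?heat_error_ge0//.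
have : (len%:E + heat_error < +oo)%E.
  rewrite -heat_content_add; apply: lte_add_pinfty; last exact: lte_add_pinfty.
  by move: heat_content_fin; case: (heat_content _ _ _) => // q _; exact: ltry.
by apply: le_lt_trans; rewrite leeDr// lee_fin subr_ge0 ltW.
Qed.

(** A nondegenerate centered Gaussian value at time t is at least L + 1 with positive probability,
    and then S + J - L >= 1. *)
Lemma heat_error_gt0 : (0 < heat_error)%E.
Proof.
have ct : set_val (clamp t) <= t by rewrite clampE.
have [v [v0 _ v1 tv]] := coord_scale gaussP mean0 (clamp t).
have nd : (0 < P [set w : path | w (clamp t) != 0%R])%E.
  by apply: nondeg; rewrite clampE.
rewrite le_eqVlt in v0; case/predU1P : v0 => [v0|v0].
  by move: nd; rewrite v1// ltxx.
set A := [set w : path | len + 1 <= w (clamp t)].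
have mA : measurable A by exact: measurable_coord_ge.
have l1 : 0 <= len + 1 by have := ltab; lra.
apply: (@lt_le_trans _ _ (P A)).
  apply: lt_le_trans (tv v0 _ l1); rewrite lte_fin gauss_tail_gt0.
  by [].
have <- : (\int[P]_w (\1_A w : R)%:E = P A)%E by rewrite integral_indic// setIT.
apply: le_integral_nomeas => w _; first by rewrite lee_fin.
rewrite indicE; have [/set_mem wA|_] := boolP (w \in A); last by rewrite le_max lexx.
rewrite le_max; apply/orP; right.
rewrite leeBrDr//; apply: (@le_trans _ _ (w (clamp t))%:E).
  by rewrite lee_fin addrC.
by apply: (le_trans (coord_le_possup w ct)); rewrite leeDl.
Qed.

Lemma heat_error_le (s2 lam : R) : 0 <= s2 -> 0 < lam ->
  (forall s, set_val s <= t -> (\int[P]_w (w s ^+ 2)%:E <= s2%:E)%E) ->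
  (heat_error <=
   (2 * (expR (lam * (fine (meansup P t) - len / 2) + lam ^+ 2 * s2 / 2) / lam))%:E)%E.
Proof.
move=> s20 lam0 var.
have mx v := measurable_excess v mS; have mxJ v := measurable_excess v mJ.
have x0 v (f : path -> \bar R) w : (0 <= maxe 0 (f w - v%:E))%E by rewrite le_max lexx.
have e := excess_bound gaussP mean0 (len / 2) t0' t1 s20 lam0 mfin var.
rewrite mulrDl !mul1r EFinD; apply: le_trans (leeD e e).
rewrite -[X in (_ <= _ + X)%E](integral_path_opp (mx _) (x0 _ _)).
rewrite (integralDT (mx _) (mxJ _) (x0 _ _) (x0 _ J)).
apply: le_integral_nomeas => w _; first by rewrite le_max lexx.
(* Half of the length is charged to each supremum: the positive part is subadditive. *)
rewrite [X in (_ - X%:E)%E]splitr ge_max adde_ge0 ?le_max ?lexx//=.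
have := S0 w; have := J0 w => /=.
case: (possup t w) => [y||]//; case: (possup t (path_opp w)) => [z||]// z0 y0.
  rewrite -?EFinD -!EFin_max -?EFinD lee_fin.
  rewrite opprD addrACA lerD// le_max lexx orbT//.
- by rewrite /= (max_r (leey _)) -EFin_max addey// addey// leey.
- by rewrite /= (max_r (leey _)) -EFin_max addye// leey.
- by rewrite /= (max_r (leey _)).
Qed.

Lemma heat_deficit : (len%:E - heat_content P `]a, b[%classic t =
  2%:E * meansup P t - (fine heat_error)%:E)%E.
Proof.
have := heat_content_add; have Mf : meansup P t \is a fin_num.
  by rewrite ge0_fin_numE// meansup_ge0.
move: heat_content_fin heat_error_fin Mf.
case: (heat_content _ _ _) => // q _; case: heat_error => // e _; case: (meansup P t) => // m _.
rewrite -EFinM -!EFinD => -[h]; congr EFin => /=; lra.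
Qed.

End error_term.

(** * The largest variance against the mean supremum *)

Section variance.
Context {R : realType} (P : probability (skorokhod R) R).
Local Notation path := (skorokhod R).
Hypothesis gaussP : gaussian_process P.
Hypothesis mean0 : forall s : unit_interval R,
  ('E_P[fun w : path => w s])%E = 0%E.
Hypothesis nondeg : forall s : unit_interval R, 0 < set_val s ->
  (0 < P [set w : path | w s != 0%R])%E.
Variable t : R.
Hypotheses (t0 : 0 < t) (t1 : t <= 1) (mfin : (meansup P t < +oo)%E).
Let t0' : 0 <= t. Proof. exact: ltW. Qed.

Lemma sqr_coord_le_max_variance s : set_val s <= t ->
  (\int[P]_w (w s ^+ 2)%:E <= max_variance P t)%E.
Proof. by move=> st; apply: ereal_sup_ubound; exists s => //; rewrite unlock. Qed.

Lemma max_variance_ge0 : (0 <= max_variance P t)%E.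
Proof.
apply: le_trans (sqr_coord_le_max_variance (s := time0 R) t0').
by apply: integral_ge0 => w _; rewrite lee_fin sqr_ge0.
Qed.

Lemma max_variance_le : (max_variance P t <=
  (8 / gauss_tail 1 ^+ 2 * fine (meansup P t) ^+ 2)%:E)%E.
Proof.
apply: ge_ereal_sup => _ [s st <-]; rewrite unlock.
exact: sqr_coord_le_meansup.
Qed.

(** [fine] would turn an infinite variance into 0; finiteness comes from the bound by the mean of
    the supremum. *)
Lemma max_stddev_sqr : ((max_stddev P t ^+ 2)%:E = max_variance P t)%E.
Proof.
rewrite /max_stddev sqr_sqrtr ?fine_ge0 ?max_variance_ge0// fineK//.
rewrite ge0_fin_numE ?max_variance_ge0//.
exact: le_lt_trans max_variance_le (ltry _).
Qed.

Lemma sqr_coord_le_stddev s : set_val s <= t ->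
  (\int[P]_w (w s ^+ 2)%:E <= (max_stddev P t ^+ 2)%:E)%E.
Proof. by rewrite max_stddev_sqr; exact: sqr_coord_le_max_variance. Qed.

Lemma max_stddev_gt0 : 0 < max_stddev P t.
Proof.
rewrite lt_neqAle sqrtr_ge0 andbT eq_sym; apply/eqP => sd0.
have ct : set_val (clamp t) <= t by rewrite clampE.
have [v [v0 _ v1 tv]] := coord_scale gaussP mean0 (clamp t).
have nd : (0 < P [set w : path | w (clamp t) != 0%R])%E.
  by apply: nondeg; rewrite clampE.
rewrite le_eqVlt in v0; case/predU1P : v0 => [v0|v0].
  by move: nd; rewrite v1// ltxx.
set A := [set w : path | v <= w (clamp t)].
have mA : measurable A by exact: measurable_coord_ge.
have : (0 < \int[P]_w (w (clamp t) ^+ 2)%:E)%E.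
  apply: (@lt_le_trans _ _ ((v ^+ 2)%:E * P A)%E).
    rewrite mule_gt0 ?lte_fin ?exprn_gt0//.
    by apply: lt_le_trans (tv v0 _ (ltW v0)); rewrite lte_fin gauss_tail_gt0.
  rewrite -(integral_cst P mA) integral_mkcond.
  apply: le_integral_nomeas => w _; rewrite patchE; case: ifPn => //.
  - by rewrite lee_fin sqr_ge0.
  - by rewrite inE /A/= => wA; rewrite lee_fin lerXn2r ?nnegrE ?(le_trans (ltW v0))// ltW.
  - by rewrite lee_fin sqr_ge0.
by rewrite ltNge (le_trans (sqr_coord_le_stddev ct))// sd0 expr0n.
Qed.

End variance.

Section bound.
Context {R : realType} (P : probability (skorokhod R) R).
Local Notation path := (skorokhod R).
Hypothesis gaussP : gaussian_process P.
Hypothesis mean0 : forall s : unit_interval R,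
  ('E_P[fun w : path => w s])%E = 0%E.
Hypothesis nondeg : forall s : unit_interval R, 0 < set_val s ->
  (0 < P [set w : path | w s != 0%R])%E.
Variables a b t : R.
Hypotheses (ltab : a < b) (t0 : 0 < t) (t1 : t <= 1).

Lemma heat_error_bound (v := (b - a) / 2 - fine (meansup P t)) :
  (meansup P t < ((b - a) / 2)%:E)%E ->
  fine (heat_error P a b t) <=
  2 * max_stddev P t ^+ 2 / v * expR (- (1 / 2) * (v / max_stddev P t) ^+ 2).
Proof.
move=> ml; have mfin : (meansup P t < +oo)%E by exact: lt_trans ml (ltry _).
have v0 : 0 < v.
  by rewrite subr_gt0 -lte_fin fineK// ge0_fin_numE// meansup_ge0.
have s0 := max_stddev_gt0 gaussP mean0 nondeg t0 t1 mfin.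
set s := max_stddev P t in s0 *.
(* This value of lam minimizes - lam v + lam^2 s^2 / 2, with minimum - v^2 / (2 s^2). *)
have l0 : 0 < v / s ^+ 2 by rewrite divr_gt0 ?exprn_gt0.
have := heat_error_le gaussP mean0 a b t0 t1 mfin (sqr_ge0 s) l0
  (sqr_coord_le_stddev gaussP mean0 t0 t1 mfin).
rewrite -[X in (X <= _)%E]fineK; last exact: heat_error_fin.
rewrite lee_fin => /le_trans; apply.
rewrite (_ : _ + _ = - (1 / 2) * (v / s) ^+ 2); last first.
  have -> : fine (meansup P t) - (b - a) / 2 = - v by rewrite opprB.
  by field; rewrite gt_eqF.
rewrite le_eqVlt; apply/orP; left; apply/eqP; field.
by rewrite !gt_eqF.
Qed.

End bound.

Theorem theorem4p1 (R : realType) (a b : R) (P : probability (skorokhod R) R)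
    (ltab : a < b)
    (start0 : P [set w : skorokhod R | w (time0 R) = 0] = 1%E)
    (gaussP : gaussian_process P)
    (mean0 : forall s : unit_interval R,
       ('E_P[fun w : skorokhod R => w s])%E = 0%E)
    (sup_fin : forall t : R, 0 < t <= 1 ->
       {ae P, forall w : skorokhod R, (running_sup t w < +oo)%E})
    (nondeg : forall s : unit_interval R, 0 < set_val s ->
       (0 < P [set w : skorokhod R | w s != 0%R])%E) :
  let D : set R := `]a, b[%classic in
  let len : R := b - a in
  (forall t : R, 0 < t <= 1 -> (mean_sup P t < (len / 2)%:E)%E ->
     let mu : R := fine (mean_sup P t) in
     let sigma : R := max_stddev P t in
     exists err : R,
       [/\ (len%:E - heat_content P D t = 2%:E * mean_sup P t - err%:E)%E,
           0 < err &
           err <= 4 * sigma ^+ 2 / (len - mu)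
                    * expR (- (1 / 2) * ((len - mu) / sigma) ^+ 2)
                + 4 * sigma ^+ 2 / (1 / 2 * len - mu)
                    * expR (- (1 / 2) * ((1 / 2 * len - mu) / sigma) ^+ 2)]) /\
  ((len - fine (heat_content P D t)) / fine (mean_sup P t) @[t --> (0 : R)^'+] --> (2 : R)).
Proof.
move=> D len.
have len0 : 0 < len by rewrite subr_gt0.
have fin t : 0 < t -> t <= 1 -> (meansup P t < +oo)%E.
  move=> t0 t1; apply: (meansup_fin gaussP mean0 (ltW t0) t1).
  by apply: sup_fin; rewrite t0 t1.
split.
  move=> t /andP[t0 t1]; rewrite (mean_supE start0 (ltW t0) t1) => ml mu sigma.
  have mfin := fin _ t0 t1.
  exists (fine (heat_error P a b t)); split.
  - exact: heat_deficit.
  - apply: fine_gt0; rewrite heat_error_gt0//=.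
    by rewrite ltey_eq heat_error_fin.
  have v0 : 0 < len / 2 - mu.
    by rewrite subr_gt0 -lte_fin fineK// ge0_fin_numE// meansup_ge0.
  apply: (le_trans (heat_error_bound gaussP mean0 nondeg ltab t0 t1 ml)).
  rewrite -/len -/mu -/sigma (_ : 1 / 2 * len = len / 2); last by rewrite mul1r mulrC.
  (* The estimate obtained is half of the second summand; the first one is only seen to be
     nonnegative. *)
  rewrite -[leLHS]add0r lerD//.
    have l1 : 0 <= len - mu.
      by rewrite (le_trans (ltW v0))// lerD2r ler_pdivrMr// ler_peMr ?ler1n// ltW.
    by rewrite mulr_ge0 ?expR_ge0// mulr_ge0 ?invr_ge0// mulr_ge0// sqr_ge0.
  by rewrite ler_wpM2r ?expR_ge0// ler_wpM2r ?invr_ge0 ?(ltW v0)// ler_wpM2r ?sqr_ge0// ler_nat.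
apply/cvgrPdist_lt => e e0.
pose C : R := 8 / gauss_tail 1 ^+ 2.
have C0 : 0 <= C by rewrite divr_ge0// sqr_ge0.
have k0 : 0 < 8 * C / len + 1 by rewrite ltr_wpDl ?ltr01// divr_ge0 ?(ltW len0)// mulr_ge0.
(* mu < L / 4 keeps L / 2 - mu above L / 4; the second threshold makes 8 C mu / L less than e, the 1
   keeping the divisor positive. *)
have d0 : 0 < Num.min (len / 4) (e / (8 * C / len + 1)).
  by rewrite lt_min !divr_gt0.
have [t' [t'0 t'1 mt']] := meansup_small start0 (fin 1 ltr01 (lexx _)) d0.
near=> t.
have t0 : 0 < t by near: t; exact: nbhs_right_gt.
have tt' : t <= t' by near: t; exact: nbhs_right_le.
have t1 := le_trans tt' t'1.
have mfin := fin _ t0 t1.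
have mtf : meansup P t \is a fin_num by rewrite ge0_fin_numE ?meansup_ge0.
pose mu := fine (meansup P t).
have mu0 : 0 < mu.
  apply: fine_gt0; rewrite mfin andbT; apply: meansup_gt0 gaussP mean0 _ t0 t1 _.
  by apply: nondeg; rewrite clampE// ltW.
have : mu < Num.min (len / 4) (e / (8 * C / len + 1)).
  by rewrite -lte_fin fineK// (le_lt_trans _ mt')// meansup_nd// ltW.
rewrite lt_min => /andP[mu4 mue].
have ml : (meansup P t < (len / 2)%:E)%E by rewrite -(fineK mtf) lte_fin -/mu; lra.
rewrite (mean_supE start0 (ltW t0) t1) -/mu.
pose err := fine (heat_error P a b t).
have err0 : 0 <= err by rewrite fine_ge0// heat_error_ge0.
have errE : len - fine (heat_content P D t) = 2 * mu - err.
  apply: EFin_inj; rewrite !EFinB EFinM /mu (fineK mtf) -heat_deficit//.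
  by rewrite fineK// heat_content_fin.
pose v := len / 2 - mu.
have v4 : len / 4 <= v by rewrite /v; lra.
have v0 : 0 < v by rewrite (lt_le_trans _ v4)// divr_gt0.
have sC : max_stddev P t ^+ 2 <= C * mu ^+ 2.
  by rewrite -lee_fin max_stddev_sqr// max_variance_le.
(* 8 = 2 * 4: the constant 2 of the bound and v >= L / 4, the exponential being at most 1. *)
have errC : err <= 8 * C / len * mu * mu.
  apply: (le_trans (heat_error_bound gaussP mean0 nondeg ltab t0 t1 ml)).
  rewrite -/len -/mu -/v -[leRHS]mulr1.
  apply: ler_pM; rewrite ?expR_ge0//.
  - by rewrite divr_ge0 ?(ltW v0)// mulr_ge0// sqr_ge0.
  - rewrite (_ : 8 * C / len * mu * mu = 2 * (C * mu ^+ 2) / (len / 4)); last first.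
      by field; rewrite gt_eqF.
    apply: ler_pM; rewrite ?invr_ge0 ?(ltW v0)//.
      by rewrite mulr_ge0// sqr_ge0.
      by rewrite ler_wpM2l.
    by rewrite lef_pV2 ?posrE// divr_gt0.
  - by rewrite -expR0 ler_expR mulNr oppr_le0 mulr_ge0// sqr_ge0.
rewrite errE (_ : 2 - _ = err / mu); last by field; rewrite gt_eqF.
rewrite ger0_norm ?divr_ge0 ?(ltW mu0)// ltr_pdivrMr//.
apply: (le_lt_trans errC); rewrite ltr_pM2r//.
apply: (@le_lt_trans _ _ ((8 * C / len + 1) * mu)).
  by rewrite ler_wpM2r ?(ltW mu0)// lerDl.
by rewrite mulrC -ltr_pdivlMr.
Unshelve. all: by end_near.
Qed.
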